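(* Let $n$ be a positive integer. Let $\alpha,\gamma>0$ be real and $0<\mu\leqq 1$, and suppose that $$\alpha=\beta+\frac{2}{\pi}\arctan(n\beta),\qquad \beta=\gamma+\frac{2}{\pi}\arctan(n\gamma),\qquad \frac{\pi}{2}(\alpha+\gamma)\leqq\phi(\mu),$$ where $$\phi(\mu)=\frac{\pi}{2}(\mu+1)-\arctan\frac{\cos\frac{\mu\pi}{2}}{\sin\frac{\mu\pi}{2}+\frac{n\mu}{1-\mu}\left(\frac{1-\mu}{1+\mu}\right)^{\frac{1+\mu}{2}}}.$$ If $f(z)\in\mathcal{A}_n$ satisfies $$|\arg(f'(z))|<\frac{\pi}{2}\alpha\qquad(z\in\mathbb{U}),$$ then the function $F(z)=\int_0^z\frac{f(t)}{t}\,dt$ $(z\in\mathbb{U})$ belongs to $\mathcal{STS}(\mu)$, i.e. $\left|\arg\left(\frac{zF'(z)}{F(z)}\right)\right|<\frac{\pi}{2}\mu$ for all $z\in\mathbb{U}$.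
   Context: $\mathbb{U}=\{z\in\mathbb{C}:|z|<1\}$. For a positive integer $n$, $\mathcal{A}_n$ is the class of functions $f(z)=z+a_{n+1}z^{n+1}+a_{n+2}z^{n+2}+\cdots$ analytic in $\mathbb{U}$. For $0<\mu\leqq1$, $\mathcal{STS}(\mu)=\{f\in\mathcal{A}_n:\left|\arg\left(\frac{zf'(z)}{f(z)}\right)\right|<\frac{\pi}{2}\mu \text{ for } z\in\mathbb{U}\}$. $\arg$ denotes the principal argument. *)

(* Defs.v *)
From Stdlib Require Import Reals.
From Coquelicot Require Import Coquelicot.
Open Scope R_scope.

(* Principal argument of a complex number, with values in (-PI, PI];
   Carg 0 = 0 (but we never use it at 0: all arg-conditions below require
   the argument to be nonzero). *)
Definition Carg (z : C) : R :=
  let x := Re z in let y := Im z in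
  if Rlt_dec 0 x then atan (y / x)
  else if Rlt_dec x 0 then
    (if Rle_dec 0 y then atan (y / x) + PI else atan (y / x) - PI)
  else
    if Rlt_dec 0 y then PI / 2
    else if Rlt_dec y 0 then - (PI / 2) else 0.

Definition abs_arg_lt (w : C) (c : R) : Prop :=
  w <> RtoC 0 /\ Rabs (Carg w) < c.

Definition in_U (z : C) : Prop := Cmod z < 1.

Definition in_A (n : nat) (f : C -> C) : Prop :=
  exists a : nat -> C,
    a 0%nat = RtoC 0 /\ a 1%nat = RtoC 1 /\
    (forall k : nat, (2 <= k <= n)%nat -> a k = RtoC 0) /\
    (forall z : C, in_U z -> is_pseries (K := C_AbsRing) (V := C_NormedModule) a z (f z)).

(* STS(mu): |arg (z F'(z) / F(z))| < (pi/2) mu in U.  At z = 0 the quotient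
   z F'(z)/F(z) is understood by continuity (value 1), so the condition is
   imposed for z <> 0. *)
Definition in_STS (n : nat) (mu : R) (F : C -> C) : Prop :=
  in_A n F /\
  forall z : C, in_U z -> z <> RtoC 0 ->
    exists dF : C,
      is_derive (K := C_AbsRing) (V := C_NormedModule) F z dF /\
      F z <> RtoC 0 /\
      abs_arg_lt (z * dF / F z)%C (PI / 2 * mu).

(* F(z) = \int_0^z f(t)/t dt, integrated along the segment [0, z]
   (t = s z, dt = z ds, s in [0,1]). *)
Definition int_f_over_t (f : C -> C) (z : C) : C :=
  RInt (V := C_R_CompleteNormedModule)
    (fun s : R => (f (RtoC s * z) / (RtoC s * z) * z)%C) 0 1.

Definition phi (n : nat) (mu : R) : R :=
  PI / 2 * (mu + 1)
  - atan (cos (mu * PI / 2) /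
           (sin (mu * PI / 2)
            + INR n * mu / (1 - mu)
              * Rpower ((1 - mu) / (1 + mu)) ((1 + mu) / 2))).

(* Main.v *)
(** Put p = f/z, q = F/z and P = zF'/F = p/q.  Then f' = p + zp', p = q + zq' and
    f'/q = P^2 + zP'.  The tool is Nunokawa's lemma: if p(z) = 1 + O(z^n) stays in the
    closed sector |arg p| <= pi b/2 for |z| <= |z0| and reaches its boundary at z0 with
    |p(z0)| = a^b, then z0 p'(z0)/p(z0) = +- i b k with k >= n (a + 1/a)/2.  Hence a first
    exit of p from its sector forces |arg (p + zp')| >= pi b/2 + arctan(n b); applied to p
    and then to q this gives |arg p| < pi beta/2 and |arg q| < pi gamma/2, so that
    |arg (P^2 + zP')| < pi (alpha + gamma)/2 <= phi(mu).  A first exit of P from the sector of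
    opening pi mu would contradict this, phi(mu) being the minimum over a of the argument
    that P^2 + zP' then takes.  Nunokawa's lemma follows from Jack's lemma for
    w = (p^(1/b) - 1)/(p^(1/b) + 1), and Jack's lemma from the Schwarz lemma
    |w(z)| <= |z/z0|^n; the maximum principle behind it is obtained from second
    derivatives, so that no Cauchy theory is needed. *)

Require Import Defs.
From Stdlib Require Import Reals Lra Lia Classical ClassicalEpsilon.
From Coquelicot Require Import Coquelicot.
Open Scope R_scope.

(** Sectors are written as [Cmod w * cos c < Re w], which for 0 <= c <= PI says that w is nonzero
    with |arg w| < c. This form is continuous in w, involves no branch of the argument and makes
    sense for half-openings up to PI. The obstacle is a zero. The hypothesis concerns p + zp' only,
    so p might leave its sector through 0, where neither its argument nor p^(1/b) exists and
    Nunokawa's lemma says nothing. [exit_neq0] excludes this as long as the half-openings of the two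
    sectors, in units of PI/2, add up to at most 3. For p these are alpha and beta, and alpha + beta
    < 3 follows from alpha + gamma <= 2 and beta < gamma + 1. The w of Jack's lemma is a composition
    whose power series is never formed. Having two complex derivatives survives products and
    compositions, and it suffices for the maximum principle: at an interior maximum the second
    derivatives along 1 and i are both <= 0, whereas their sum is a Laplacian made positive. Up to
    the factor n mu, the constant in [phi] is the minimum over a > 0 of (a + 1/a) / (2 a^mu),
    attained at a^2 = (1 + mu) / (1 - mu). *)

Local Notation cderiv := (is_derive (K := C_AbsRing) (V := C_NormedModule)).

(** * Complex differentiation *)

(** Both structures on C have the same operations and norm but different balls: squares for
    [C_NormedModule], discs for the ring seen as a module over itself. The product and chain rules
    want the second structure on the values, power series and the theorem use the first. *)
Lemma cderiv_iff_AbsRing (f : C -> C) (z d : C) :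
  cderiv f z d <->
  is_derive (K := C_AbsRing) (V := AbsRing_NormedModule C_AbsRing) f z d.
Proof.
  split; intros [H1 H2]; (split; [destruct H1; split; assumption | exact H2]).
Qed.

Lemma cderiv_iff (f : C -> C) (z d : C) :
  cderiv f z d <->
  forall eps, 0 < eps -> exists delta, 0 < delta /\ forall h, Cmod h < delta ->
    Cmod (f (z + h) - f z - d * h)%C <= eps * Cmod h.
Proof.
  split.
  - intros [_ H] eps He.
    destruct (H z (fun P HP => HP) (mkposreal eps He)) as [[de Hde] Hd].
    exists de; split; auto. intros h Hh.
    specialize (Hd (z + h)%C). simpl in Hd.
    replace h with (z + h - z)%C at 2 3 by ring.
    rewrite (Cmult_comm d).
    apply Hd.
    change (Cmod (z + h - z)%C < de).
    replace (z + h - z)%C with h by ring. exact Hh.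
  - intros H. split.
    + exact (is_linear_scal_l (K := C_AbsRing) (V := C_NormedModule) d).
    + intros x Hx eps.
      assert (z = x) by
        (apply (is_filter_lim_locally_unique (K := C_AbsRing)
                  (V := AbsRing_NormedModule C_AbsRing)); exact Hx).
      subst x.
      destruct (H eps (cond_pos eps)) as [de [Hde Hd]].
      exists (mkposreal de Hde). intros y Hy.
      assert (E : forall u v : C, (u + (v - u))%C = v) by (intros; ring).
      specialize (Hd (y - z)%C Hy). rewrite (E z y) in Hd.
      rewrite Cmult_comm in Hd. exact Hd.
Qed.

Lemma cderiv_ext_loc (f g : C -> C) (z d : C) :
  (exists delta, 0 < delta /\ forall h, Cmod h < delta -> f (z + h)%C = g (z + h)%C) ->
  cderiv f z d -> cderiv g z d.
Proof.
  intros [de [Hde E]] H.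
  apply (is_derive_ext_loc (K := C_AbsRing) (V := C_NormedModule) f g z d); auto.
  exists (mkposreal de Hde). intros y Hy.
  assert (E2 : forall u v : C, (u + (v - u))%C = v) by (intros; ring).
  rewrite <- (E2 z y). apply E. exact Hy.
Qed.

Lemma cderiv_ext (f g : C -> C) (z d e : C) :
  (forall y, f y = g y) -> d = e -> cderiv f z d -> cderiv g z e.
Proof.
  intros E <-. apply cderiv_ext_loc. exists 1; split; [lra | auto].
Qed.

Lemma cderiv_const (c z : C) : cderiv (fun _ => c) z (RtoC 0).
Proof. exact (is_derive_const (K := C_AbsRing) (V := C_NormedModule) c z). Qed.

Lemma cderiv_id (z : C) : cderiv (fun y => y) z (RtoC 1).
Proof. apply cderiv_iff_AbsRing. exact (is_derive_id (K := C_AbsRing) z). Qed.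

Lemma cderiv_plus (f g : C -> C) (z a b : C) :
  cderiv f z a -> cderiv g z b -> cderiv (fun y => f y + g y)%C z (a + b)%C.
Proof.
  exact (is_derive_plus (K := C_AbsRing) (V := C_NormedModule) f g z a b).
Qed.

Lemma cderiv_minus (f g : C -> C) (z a b : C) :
  cderiv f z a -> cderiv g z b -> cderiv (fun y => f y - g y)%C z (a - b)%C.
Proof.
  exact (is_derive_minus (K := C_AbsRing) (V := C_NormedModule) f g z a b).
Qed.

Lemma cderiv_mult (f g : C -> C) (z a b : C) :
  cderiv f z a -> cderiv g z b ->
  cderiv (fun y => f y * g y)%C z (a * g z + f z * b)%C.
Proof.
  rewrite !cderiv_iff_AbsRing. intros Ha Hb.
  exact (is_derive_mult (K := C_AbsRing) f g z a b Ha Hb Cmult_comm).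
Qed.

Lemma cderiv_comp (f g : C -> C) (z a b : C) :
  cderiv f (g z) a -> cderiv g z b -> cderiv (fun y => f (g y)) z (a * b)%C.
Proof.
  intros Ha Hb. rewrite Cmult_comm. rewrite cderiv_iff_AbsRing in Hb.
  exact (is_derive_comp (K := C_AbsRing) (V := C_NormedModule) f g z a b Ha Hb).
Qed.

Lemma cderiv_scal (c : C) (f : C -> C) (z a : C) :
  cderiv f z a -> cderiv (fun y => c * f y)%C z (c * a)%C.
Proof.
  intros H.
  apply (cderiv_ext (fun y => c * f y)%C _ z (0 * f z + c * a)%C); auto.
  - ring.
  - apply (cderiv_mult (fun _ => c) f); auto using cderiv_const.
Qed.

Lemma Cmod_minus_sym (x y : C) : Cmod (x - y)%C = Cmod (y - x)%C.
Proof. rewrite <- Cmod_opp. f_equal. ring. Qed.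

Lemma Cmod_triangle_rev (x y : C) : Cmod x - Cmod y <= Cmod (x - y)%C.
Proof.
  assert (H := Cmod_triangle (x - y)%C y).
  replace (x - y + y)%C with x in H by ring. lra.
Qed.

Lemma Cmod_triangle_rev' (x h : C) : Cmod x - Cmod h <= Cmod (x + h)%C.
Proof.
  assert (H := Cmod_triangle_rev x (- h)%C). rewrite Cmod_opp in H.
  replace (x - - h)%C with (x + h)%C in H by ring. exact H.
Qed.

Lemma Cmod_pos_neq0 (z : C) : 0 < Cmod z -> z <> RtoC 0.
Proof. intros; apply Cmod_gt_0; auto. Qed.

Lemma cderiv_Cinv (z : C) : z <> RtoC 0 -> cderiv Cinv z (- / (z * z))%C.
Proof.
  intros Hz. assert (Hm := proj1 (Cmod_gt_0 z) Hz).
  apply cderiv_iff. intros eps He.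
  (* The first bound keeps |z + h| >= |z| / 2; the second then makes the error h^2 / (z^2 (z + h))
     at most eps |h|. *)
  exists (Rmin (Cmod z / 2) (eps * (Cmod z ^ 3 / 2))).
  assert (0 < Cmod z ^ 3) by (apply pow_lt; auto).
  split.
  { apply Rmin_pos; [lra | apply Rmult_lt_0_compat; lra]. }
  intros h Hh.
  assert (h1 := Rmin_l (Cmod z / 2) (eps * (Cmod z ^ 3 / 2))).
  assert (h2 := Rmin_r (Cmod z / 2) (eps * (Cmod z ^ 3 / 2))).
  assert (h3 : Cmod z / 2 <= Cmod (z + h)%C)
    by (assert (H3 := Cmod_triangle_rev' z h); lra).
  assert (Hzh : (z + h)%C <> RtoC 0) by (apply Cmod_pos_neq0; lra).
  replace (/ (z + h) - / z - - / (z * z) * h)%C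
    with (h * (h / (z * z * (z + h))))%C by (field; auto).
  assert (Hd : (z * z * (z + h))%C <> RtoC 0) by (repeat apply Cmult_neq_0; auto).
  rewrite Cmod_mult, Cmod_div, !Cmod_mult by auto. rewrite Rmult_comm.
  apply Rmult_le_compat_r; [apply Cmod_ge_0|].
  apply Rmult_le_reg_r with (Cmod z * Cmod z * Cmod (z + h)%C).
  - repeat apply Rmult_lt_0_compat; lra.
  - unfold Rdiv. rewrite Rmult_assoc, Rinv_l, Rmult_1_r
      by (apply Rgt_not_eq; repeat apply Rmult_lt_0_compat; lra).
    apply Rle_trans with (eps * (Cmod z ^ 3 / 2)); [lra|].
    apply Rmult_le_compat_l; [lra|].
    replace (Cmod z ^ 3 / 2) with (Cmod z * Cmod z * (Cmod z / 2)) by (simpl; field).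
    apply Rmult_le_compat_l; [|lra]. apply Rmult_le_pos; lra.
Qed.

Lemma cderiv_inv (f : C -> C) (z a : C) :
  f z <> RtoC 0 -> cderiv f z a ->
  cderiv (fun y => / f y)%C z (- a / (f z * f z))%C.
Proof.
  intros Hz H.
  apply (cderiv_ext (fun y => / f y)%C _ z (- / (f z * f z) * a)%C); auto.
  - field; auto.
  - apply cderiv_comp; auto. apply cderiv_Cinv; auto.
Qed.

Lemma im_le_Cmod (c : C) : Rabs (Im c) <= Cmod c.
Proof. eapply Rle_trans; [apply Rmax_r | apply Rmax_Cmod]. Qed.

(** * Continuity in terms of the modulus *)

Local Notation ccontinuous := (continuous (T := C_UniformSpace) (U := C_UniformSpace)).
Local Notation rcontinuous := (continuous (T := C_UniformSpace) (U := R_UniformSpace)).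

(** The balls of the product uniform structure are squares. A disc of radius d lies in the square of
    half-side d and contains the one of half-side d / sqrt 2. *)
Lemma locally_C_iff (P : C -> Prop) (z : C) :
  locally (T := C_UniformSpace) z P <->
  exists delta, 0 < delta /\ forall h, Cmod h < delta -> P (z + h)%C.
Proof.
  split.
  - intros [de Hd]. exists de; split; [apply cond_pos|].
    intros h Hh. apply Hd.
    assert (H1 := re_le_Cmod h). assert (H2 := im_le_Cmod h).
    split; [change (Rabs (Re z + Re h - Re z) < de) | change (Rabs (Im z + Im h - Im z) < de)].
    + replace (Re z + Re h - Re z) with (Re h) by ring; lra.
    + replace (Im z + Im h - Im z) with (Im h) by ring; lra.
  - intros [de [Hde Hd]].
    assert (Hs : 0 < sqrt 2) by (apply sqrt_lt_R0; lra).
    assert (Hp : 0 < de / sqrt 2) by (apply Rdiv_lt_0_compat; auto).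
    exists (mkposreal _ Hp). intros y Hy.
    assert (E : (z + (y - z))%C = y) by ring. rewrite <- E. apply Hd.
    apply Rlt_le_trans with (sqrt 2 * (de / sqrt 2)).
    + exact (C_NormedModule_mixin_compat2 z y (mkposreal _ Hp) Hy).
    + right. field. lra.
Qed.

Lemma rcontinuous_iff (f : C -> R) (z : C) :
  rcontinuous f z <->
  forall eps, 0 < eps -> exists delta, 0 < delta /\
    forall h, Cmod h < delta -> Rabs (f (z + h)%C - f z) < eps.
Proof.
  split.
  - intros H eps He.
    apply (locally_C_iff (fun y => Rabs (f y - f z) < eps)).
    apply (H (fun u => Rabs (u - f z) < eps)).
    exists (mkposreal eps He). intros u Hu. exact Hu.
  - intros H P [eps HP]. apply locally_C_iff.
    destruct (H eps (cond_pos eps)) as [de [Hde Hd]].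
    exists de; split; auto. intros h Hh. apply HP. exact (Hd h Hh).
Qed.

Lemma ccontinuous_iff (f : C -> C) (z : C) :
  ccontinuous f z <->
  forall eps, 0 < eps -> exists delta, 0 < delta /\
    forall h, Cmod h < delta -> Cmod (f (z + h) - f z)%C < eps.
Proof.
  split.
  - intros H eps He.
    apply (locally_C_iff (fun y => Cmod (f y - f z)%C < eps)).
    apply (H (fun u => Cmod (u - f z)%C < eps)).
    apply locally_C_iff. exists eps; split; auto. intros h Hh.
    replace (f z + h - f z)%C with h by ring. auto.
  - intros H P HP. apply locally_C_iff in HP. apply locally_C_iff.
    destruct HP as [eps [He HP]].
    destruct (H eps He) as [de [Hde Hd]].
    exists de; split; auto. intros h Hh.
    assert (E : (f z + (f (z + h) - f z))%C = f (z + h)%C) by ring.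
    rewrite <- E. apply HP. exact (Hd h Hh).
Qed.

Lemma rcontinuous_1Lipschitz (L : C -> R) (z : C) :
  (forall x y, Rabs (L x - L y) <= Cmod (x - y)%C) -> rcontinuous L z.
Proof.
  intros HL. apply rcontinuous_iff. intros eps He. exists eps; split; auto.
  intros h Hh. eapply Rle_lt_trans; [apply HL|].
  replace (z + h - z)%C with h by ring. auto.
Qed.

Lemma rcontinuous_Re (z : C) : rcontinuous Re z.
Proof. apply rcontinuous_1Lipschitz. intros; apply (re_le_Cmod (x - y)). Qed.

Lemma rcontinuous_Im (z : C) : rcontinuous Im z.
Proof. apply rcontinuous_1Lipschitz. intros; apply (im_le_Cmod (x - y)). Qed.

Lemma rcontinuous_Cmod (z : C) : rcontinuous Cmod z.
Proof.
  apply rcontinuous_1Lipschitz. intros x y.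
  assert (H1 := Cmod_triangle_rev x y). assert (H2 := Cmod_triangle_rev y x).
  rewrite Cmod_minus_sym in H2. apply Rabs_le; lra.
Qed.

Lemma cderiv_lipschitz (f : C -> C) (z d : C) :
  cderiv f z d -> exists delta, 0 < delta /\ forall h, Cmod h < delta ->
    Cmod (f (z + h) - f z)%C <= (Cmod d + 1) * Cmod h.
Proof.
  intros H. destruct (proj1 (cderiv_iff f z d) H 1 Rlt_0_1) as [de [Hde Hd]].
  exists de; split; auto. intros h Hh. specialize (Hd h Hh).
  replace (f (z + h) - f z)%C with (f (z + h) - f z - d * h + d * h)%C by ring.
  eapply Rle_trans; [apply Cmod_triangle|]. rewrite Cmod_mult. lra.
Qed.

Lemma cderiv_continuous (f : C -> C) (z d : C) : cderiv f z d -> ccontinuous f z.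
Proof.
  intros H. apply ccontinuous_iff. intros eps He. destruct (cderiv_lipschitz f z d H) as [de [Hde Hd]].
  assert (Hm := Cmod_ge_0 d).
  exists (Rmin de (eps / (Cmod d + 1))). split.
  - apply Rmin_pos; auto. apply Rdiv_lt_0_compat; lra.
  - intros h Hh.
    assert (h1 := Rmin_l de (eps / (Cmod d + 1))).
    assert (h2 := Rmin_r de (eps / (Cmod d + 1))).
    apply Rle_lt_trans with ((Cmod d + 1) * Cmod h); [apply Hd; lra|].
    apply Rlt_le_trans with ((Cmod d + 1) * (eps / (Cmod d + 1))).
    + apply Rmult_lt_compat_l; lra.
    + right. field. lra.
Qed.

(* [L] stands for [Re] or [Im]. *)
Lemma cderiv_line_gen (L : C -> R) (f : C -> C) (z e d : C) (t0 : R) :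
  (forall a b, L (a - b)%C = L a - L b) ->
  (forall (r : R) a, L (r * a)%C = r * L a) ->
  (forall a, Rabs (L a) <= Cmod a) ->
  cderiv f (z + t0 * e)%C d ->
  is_derive (fun t : R => L (f (z + t * e)%C)) t0 (L (d * e)%C).
Proof.
  intros Lm Ls Lb H. apply is_derive_Reals. intros eps He.
  assert (Hm := Cmod_ge_0 e).
  set (e' := eps / (2 * (Cmod e + 1))).
  assert (He' : 0 < e') by (apply Rdiv_lt_0_compat; lra).
  destruct (proj1 (cderiv_iff _ _ _) H e' He') as [de [Hde Hd]].
  assert (Hp : 0 < de / (Cmod e + 1)) by (apply Rdiv_lt_0_compat; lra).
  exists (mkposreal _ Hp). intros t Ht Htd. simpl in Htd.
  replace ((L (f (z + (t0 + t)%R * e)%C) - L (f (z + t0 * e)%C)) / t - L (d * e)%C)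
    with (/ t * L (f (z + t0 * e + t * e) - f (z + t0 * e) - d * (t * e))%C).
  2:{ rewrite !Lm. replace (d * (t * e))%C with (t * (d * e))%C by ring.
      rewrite Ls. replace (z + t0 * e + t * e)%C with (z + (t0 + t)%R * e)%C
        by (rewrite RtoC_plus; ring). field; auto. }
  rewrite Rabs_mult, Rabs_inv.
  assert (Hat : 0 < Rabs t) by (apply Rabs_pos_lt; auto).
  assert (Hte : Cmod (t * e)%C = Rabs t * Cmod e) by (rewrite Cmod_mult, Cmod_R; auto).
  assert (B : Cmod (f (z + t0 * e + t * e) - f (z + t0 * e) - d * (t * e))%C
              <= e' * (Rabs t * Cmod e)).
  { rewrite <- Hte. apply Hd. rewrite Hte.
    apply Rle_lt_trans with (Rabs t * (Cmod e + 1)).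
    - apply Rmult_le_compat_l; lra.
    - apply Rlt_le_trans with (de / (Cmod e + 1) * (Cmod e + 1)).
      + apply Rmult_lt_compat_r; lra.
      + right; field; lra. }
  apply Rle_lt_trans with (/ Rabs t * (e' * (Rabs t * Cmod e))).
  - apply Rmult_le_compat_l; [left; apply Rinv_0_lt_compat; auto|].
    eapply Rle_trans; [apply Lb | exact B].
  - replace (/ Rabs t * (e' * (Rabs t * Cmod e))) with (e' * Cmod e) by (field; lra).
    apply Rlt_le_trans with (e' * (2 * (Cmod e + 1))).
    + apply Rmult_lt_compat_l; lra.
    + unfold e'. right. field. lra.
Qed.

Lemma cderiv_line_Re (f : C -> C) (z e d : C) (t0 : R) :
  cderiv f (z + t0 * e)%C d ->
  is_derive (fun t : R => Re (f (z + t * e)%C)) t0 (Re (d * e)%C).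
Proof.
  apply cderiv_line_gen; [reflexivity | intros; apply re_scal_l | apply re_le_Cmod].
Qed.

Lemma cderiv_line_Im (f : C -> C) (z e d : C) (t0 : R) :
  cderiv f (z + t0 * e)%C d ->
  is_derive (fun t : R => Im (f (z + t * e)%C)) t0 (Im (d * e)%C).
Proof.
  apply cderiv_line_gen; [reflexivity | | apply im_le_Cmod].
  intros. rewrite im_mult. simpl. ring.
Qed.

(** * Exponential and logarithm *)

Definition cexp (z : C) : C := (exp (Re z) * cos (Im z), exp (Re z) * sin (Im z)).

Lemma cexp_plus (x y : C) : cexp (x + y)%C = (cexp x * cexp y)%C.
Proof.
  destruct x as [a b], y as [c d].
  unfold cexp. apply injective_projections; simpl;
    rewrite exp_plus; [rewrite cos_plus | rewrite sin_plus]; ring.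
Qed.

Lemma cexp_0 : cexp 0 = 1%C.
Proof.
  unfold cexp. simpl. rewrite exp_0, cos_0, sin_0.
  apply injective_projections; simpl; ring.
Qed.

Lemma Cmod_polar (r t : R) : 0 <= r -> Cmod (r * cos t, r * sin t) = r.
Proof.
  intros Hr. unfold Cmod. simpl.
  replace (r * cos t * (r * cos t * 1) + r * sin t * (r * sin t * 1))
    with (Rsqr r * (Rsqr (sin t) + Rsqr (cos t))) by (unfold Rsqr; ring).
  rewrite sin2_cos2, Rmult_1_r. apply sqrt_Rsqr; auto.
Qed.

Lemma Cmod_cexp (z : C) : Cmod (cexp z) = exp (Re z).
Proof. apply Cmod_polar. left; apply exp_pos. Qed.

Lemma cexp_neq0 (z : C) : cexp z <> RtoC 0.
Proof. apply Cmod_pos_neq0. rewrite Cmod_cexp. apply exp_pos. Qed.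

(** From 1 + x <= exp x and 1 - x <= exp (- x): the second gives exp x <= 1 / (1 - x), which is
    within 2 x^2 of 1 + x for |x| <= 1/2. *)
Lemma Rabs_exp_taylor1 (x : R) : Rabs x <= / 2 -> Rabs (exp x - 1 - x) <= 2 * x ^ 2.
Proof.
  intros Hx. apply Rabs_le_between in Hx.
  assert (H1 := exp_ineq1_le x). assert (H2 := exp_ineq1_le (- x)).
  rewrite exp_Ropp in H2. assert (Hp := exp_pos x).
  assert (H3 : exp x * (1 + - x) <= 1).
  { apply Rle_trans with (exp x * / exp x).
    - apply Rmult_le_compat_l; lra.
    - right; field; lra. }
  apply Rabs_le. split; nra.
Qed.

Lemma Rabs_sin_le (x : R) : Rabs (sin x) <= Rabs x.
Proof.
  assert (P : forall y, 0 < y -> Rabs (sin y) <= y).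
  { intros y Hy. destruct (Rle_dec y 1).
    - assert (H := sin_lt_x y Hy). assert (0 < sin y) by (apply sin_gt_0; [auto|assert (H1:=PI2_1); lra]).
      rewrite Rabs_pos_eq; lra.
    - assert (H := SIN_bound y). apply Rabs_le. lra. }
  destruct (Rtotal_order x 0) as [H|[->|H]].
  - rewrite <- (Rabs_Ropp x), <- (Rabs_Ropp (sin x)), <- sin_neg.
    rewrite (Rabs_pos_eq (-x)) by lra. apply P; lra.
  - rewrite sin_0. lra.
  - rewrite (Rabs_pos_eq x) by lra. auto.
Qed.

Lemma Rabs_cos_taylor (y : R) : Rabs (cos y - 1) <= y ^ 2 / 2.
Proof.
  replace (cos y) with (cos (2 * (y / 2))) by (f_equal; field).
  rewrite cos_2a_sin.
  replace (1 - 2 * sin (y / 2) * sin (y / 2) - 1) with (- (2 * (sin (y/2) * sin (y/2)))) by ring.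
  rewrite Rabs_Ropp, Rabs_mult, Rabs_mult, (Rabs_pos_eq 2) by lra.
  assert (H := Rabs_sin_le (y / 2)). assert (H0 := Rabs_pos (sin (y/2))).
  replace (y ^ 2 / 2) with (2 * (Rabs (y/2) * Rabs (y/2))).
  - apply Rmult_le_compat_l; [lra|]. apply Rmult_le_compat; auto.
  - rewrite <- Rabs_mult. rewrite Rabs_pos_eq; [field | nra].
Qed.

Lemma Rabs_sin_taylor (y : R) : Rabs y <= 1 -> Rabs (sin y - y) <= y ^ 2.
Proof.
  intros Hy.
  destruct (MVT_abs (fun t => sin t - t) (fun t => cos t - 1) 0 y) as [c [H1 H2]].
  { intros c _. apply derivable_pt_lim_minus; [apply derivable_pt_lim_sin | apply derivable_pt_lim_id]. }
  rewrite sin_0 in H1. replace (sin y - y - (0 - 0)) with (sin y - y) in H1 by ring.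
  rewrite H1, Rminus_0_r.
  assert (Hc : Rabs c <= Rabs y).
  { unfold Rmin, Rmax in H2. destruct (Rle_dec 0 y).
    - rewrite !Rabs_pos_eq; lra.
    - rewrite (Rabs_left1 y), (Rabs_left1 c); lra. }
  assert (B := Rabs_cos_taylor c).
  assert (c ^ 2 <= Rabs y ^ 2) by (rewrite <- (pow2_abs c); apply pow_incr; split; [apply Rabs_pos|auto]).
  rewrite <- (pow2_abs y). assert (H3 := Rabs_pos y).
  apply Rle_trans with (Rabs y * Rabs y); [|right; ring].
  apply Rmult_le_compat_r; auto. nra.
Qed.

Lemma cderiv_cexp (z : C) : cderiv cexp z (cexp z).
Proof.
  apply cderiv_iff. intros eps He.
  assert (Hm : 0 < Cmod (cexp z)) by (apply Cmod_gt_0, cexp_neq0).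
  exists (Rmin (/ 2) (eps / (8 * Cmod (cexp z)))). split.
  { apply Rmin_pos; [lra | apply Rdiv_lt_0_compat; lra]. }
  intros h Hh.
  assert (h1 := Rmin_l (/ 2) (eps / (8 * Cmod (cexp z)))).
  assert (h2 := Rmin_r (/ 2) (eps / (8 * Cmod (cexp z)))).
  rewrite cexp_plus.
  replace (cexp z * cexp h - cexp z - cexp z * h)%C with (cexp z * (cexp h - 1 - h))%C by ring.
  (* The functional equation reduces everything to the Taylor remainder at 0. Its real and imaginary
     parts are at most 3 m^2 and 4 m^2, so its modulus is at most 5 m^2; the constant 8 is
     generous. *)
  assert (T : Cmod (cexp h - 1 - h)%C <= 8 * Cmod h ^ 2).
  { destruct h as [x y]. set (m := Cmod (x, y)) in *.
    assert (Hx : Rabs x <= m) by apply (re_le_Cmod (x, y)).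
    assert (Hy : Rabs y <= m) by apply (im_le_Cmod (x, y)).
    assert (Hm0 : x ^ 2 + y ^ 2 = m ^ 2) by (symmetry; apply (Cmod2_alt (x, y))).
    assert (E1 := Rabs_exp_taylor1 x ltac:(lra)).
    assert (E2 := Rabs_cos_taylor y). assert (E3 := Rabs_sin_taylor y ltac:(lra)).
    assert (0 <= m) by apply Cmod_ge_0.
    assert (Ex : 0 < exp x <= 2).
    { split; [apply exp_pos|]. apply Rabs_le_between in E1.
      apply Rabs_le_between in Hx. nra. }
    assert (Ex1 : Rabs (exp x - 1) <= 2 * Rabs x).
    { replace (exp x - 1) with (exp x - 1 - x + x) by ring.
      eapply Rle_trans; [apply Rabs_triang|].
      rewrite <- (pow2_abs x) in E1. assert (Hp := Rabs_pos x). nra. }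
    set (U := exp x * cos y - 1 - x). set (V := exp x * sin y - y).
    assert (HU : Rabs U <= 3 * m ^ 2).
    { unfold U. replace (exp x * cos y - 1 - x) with (exp x * (cos y - 1) + (exp x - 1 - x)) by ring.
      eapply Rle_trans; [apply Rabs_triang|]. rewrite Rabs_mult, (Rabs_pos_eq (exp x)) by lra.
      assert (Hp := Rabs_pos (cos y - 1)). nra. }
    assert (HV : Rabs V <= 4 * m ^ 2).
    { unfold V. replace (exp x * sin y - y) with (exp x * (sin y - y) + (exp x - 1) * y) by ring.
      eapply Rle_trans; [apply Rabs_triang|]. rewrite !Rabs_mult, (Rabs_pos_eq (exp x)) by lra.
      assert (Hp := Rabs_pos (sin y - y)). assert (Hp2 := Rabs_pos (exp x - 1)).
      assert (Hp3 := Rabs_pos y).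
      assert (Rabs (exp x - 1) * Rabs y <= 2 * (m * m)).
      { apply Rle_trans with (2 * Rabs x * Rabs y).
        - apply Rmult_le_compat_r; lra.
        - rewrite Rmult_assoc. apply Rmult_le_compat_l; [lra|].
          apply Rmult_le_compat; auto; apply Rabs_pos. }
      nra. }
    replace (cexp (x, y) - 1 - (x, y))%C with (U, V)
      by (apply injective_projections; unfold U, V, cexp; simpl; ring).
    assert (H3 : Cmod (U, V) ^ 2 <= (8 * m ^ 2) ^ 2).
    { rewrite Cmod2_alt. simpl Re; simpl Im. rewrite <- (pow2_abs U), <- (pow2_abs V).
      assert (Rabs U ^ 2 <= (3 * m ^ 2) ^ 2) by (apply pow_incr; split; [apply Rabs_pos|auto]).
      assert (Rabs V ^ 2 <= (4 * m ^ 2) ^ 2) by (apply pow_incr; split; [apply Rabs_pos|auto]).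
      assert (0 <= (m ^ 2) ^ 2) by apply pow2_ge_0. nra. }
    apply Rsqr_incr_0; [rewrite !Rsqr_pow2; exact H3 | apply Cmod_ge_0 |].
    assert (Hq := pow2_ge_0 m). lra. }
  rewrite Cmod_mult. assert (Hh0 := Cmod_ge_0 h).
  apply Rle_trans with (Cmod (cexp z) * (8 * Cmod h ^ 2)).
  - apply Rmult_le_compat_l; lra.
  - replace (Cmod (cexp z) * (8 * Cmod h ^ 2)) with (8 * Cmod (cexp z) * Cmod h * Cmod h) by ring.
    apply Rmult_le_compat_r; auto.
    apply Rle_trans with (8 * Cmod (cexp z) * (eps / (8 * Cmod (cexp z)))).
    + apply Rmult_le_compat_l; lra.
    + right; field; lra.
Qed.

(* Half-angle formula: equals the principal argument off the half-line (-oo, 0]. *)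
Definition carg (w : C) : R := 2 * atan (Im w / (Cmod w + Re w)).

Definition clog (w : C) : C := (ln (Cmod w), carg w).

(** The plane without (-oo, 0]: the sum vanishes exactly on that half-line, 0 included. It is also
    the denominator in [carg]. *)
Definition slit (w : C) : Prop := 0 < Cmod w + Re w.

Lemma slit_neq0 (w : C) : slit w -> w <> RtoC 0.
Proof.
  intros H ->. unfold slit in H. rewrite Cmod_0 in H. simpl in H. lra.
Qed.

Lemma carg_bound (w : C) : - PI < carg w < PI.
Proof. unfold carg. assert (H := atan_bound (Im w / (Cmod w + Re w))). lra. Qed.

(** With s = tan (arg / 2) = Im w / (|w| + Re w) one has 1 + s^2 = 2 |w| / (|w| + Re w), and the
    double angle formulas return the coordinates of w. *)
Lemma carg_polar (w : C) : slit w ->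
  w = (Cmod w * cos (carg w), Cmod w * sin (carg w)).
Proof.
  intros Hs. assert (Hn := proj1 (Cmod_gt_0 w) (slit_neq0 w Hs)).
  assert (E := Cmod2_alt w). unfold slit in Hs.
  unfold carg. set (m := Cmod w) in *. destruct w as [x y].
  simpl Re in *. simpl Im in *. set (s := y / (m + x)).
  rewrite cos_2a_sin, sin_2a, sin_atan, cos_atan.
  assert (Hp : 0 < 1 + Rsqr s) by (assert (H := Rle_0_sqr s); lra).
  assert (Hq : sqrt (1 + Rsqr s) * sqrt (1 + Rsqr s) = 2 * m / (m + x)).
  { rewrite sqrt_sqrt by lra. unfold s, Rsqr. replace (y / (m + x) * (y / (m + x))) with (y ^ 2 / (m + x) ^ 2) by (field; lra).
    replace (y ^ 2) with (m ^ 2 - x ^ 2) by lra. field. lra. }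
  assert (Hr := sqrt_lt_R0 _ Hp). set (r := sqrt (1 + Rsqr s)) in *.
  assert (F1 : s / r * (s / r) = s * s * ((m + x) / (2 * m))).
  { replace (s / r * (s / r)) with (s * s * / (r * r)) by (field; lra).
    rewrite Hq. field. lra. }
  assert (F2 : s / r * (1 / r) = s * ((m + x) / (2 * m))).
  { replace (s / r * (1 / r)) with (s * / (r * r)) by (field; lra).
    rewrite Hq. field. lra. }
  apply injective_projections; simpl.
  - rewrite Rmult_assoc, F1. unfold s.
    replace (m * (1 - 2 * (y / (m + x) * (y / (m + x)) * ((m + x) / (2 * m)))))
      with (m - y ^ 2 / (m + x)) by (field; lra).
    replace (y ^ 2) with (m ^ 2 - x ^ 2) by lra. field. lra.
  - rewrite Rmult_assoc, F2. unfold s. field. lra.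
Qed.

Lemma carg_of_polar (r t : R) : 0 < r -> - PI < t < PI ->
  carg (r * cos t, r * sin t) = t.
Proof.
  intros Hr Ht. unfold carg. rewrite Cmod_polar by lra. simpl Re; simpl Im.
  assert (Hc : 0 < cos (t / 2)) by (apply cos_gt_0; lra).
  replace (r * sin t / (r + r * cos t)) with (tan (t / 2)).
  - rewrite atan_tan; lra.
  - replace t with (2 * (t / 2)) at 2 3 by field.
    rewrite cos_2a_cos, sin_2a. unfold tan.
    assert (H2 : r + r * (2 * cos (t / 2) * cos (t / 2) - 1)
                 = 2 * r * (cos (t / 2) * cos (t / 2))) by ring.
    rewrite H2. field. lra.
Qed.

Lemma cexp_clog (w : C) : slit w -> cexp (clog w) = w.
Proof.
  intros H. unfold cexp, clog. simpl Re; simpl Im.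
  rewrite exp_ln by (apply Cmod_gt_0, slit_neq0; auto).
  symmetry. apply carg_polar; auto.
Qed.

Lemma clog_1 : clog 1 = 0%C.
Proof.
  unfold clog, carg. rewrite Cmod_1, ln_1. simpl Im. simpl Re.
  replace (0 / (1 + 1)) with 0 by field. rewrite atan_0, Rmult_0_r. reflexivity.
Qed.

Lemma rcontinuous_carg (w : C) : slit w -> rcontinuous carg w.
Proof.
  intros H. unfold carg.
  apply (continuous_mult (K := R_AbsRing) (fun _ : C_UniformSpace => 2)).
  { apply continuous_const. }
  apply (continuous_comp (fun w : C_UniformSpace => Im w / (Cmod w + Re w)) atan).
  - apply (continuous_mult (K := R_AbsRing) (fun w : C_UniformSpace => Im w)).
    { apply rcontinuous_Im. }
    apply (continuous_comp (fun w : C_UniformSpace => Cmod w + Re w) Rinv).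
    + apply (continuous_plus (K := R_AbsRing) (V := R_NormedModule)
               (fun w : C_UniformSpace => Cmod w) Re).
      * apply rcontinuous_Cmod.
      * apply rcontinuous_Re.
    + apply continuous_Rinv. apply Rgt_not_eq. exact H.
  - apply continuous_atan.
Qed.

Lemma slit_open (w : C) : slit w ->
  exists delta, 0 < delta /\ forall h, Cmod h < delta -> slit (w + h)%C.
Proof.
  intros H. unfold slit in *. exists ((Cmod w + Re w) / 2). split; [lra|].
  intros h Hh. assert (H1 := Cmod_triangle_rev' w h).
  assert (H2 := re_le_Cmod h). apply Rabs_le_between in H2.
  change (Re (w + h)%C) with (Re w + Re h). lra.
Qed.

Lemma continuous_clog (w : C) : slit w -> ccontinuous clog w.
Proof.
  intros H. apply ccontinuous_iff. intros eps He.
  assert (Hn := proj1 (Cmod_gt_0 w) (slit_neq0 w H)).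
  assert (C1 : rcontinuous (fun w => ln (Cmod w)) w).
  { apply (continuous_comp (fun w : C_UniformSpace => Cmod w) ln).
    - apply rcontinuous_Cmod.
    - apply continuous_ln; auto. }
  assert (He2 : 0 < eps / 2) by lra.
  destruct (proj1 (rcontinuous_iff _ _) C1 _ He2) as [d1 [Hd1 D1]].
  destruct (proj1 (rcontinuous_iff _ _) (rcontinuous_carg w H) _ He2) as [d2 [Hd2 D2]].
  exists (Rmin d1 d2). split; [apply Rmin_pos; auto|]. intros h Hh.
  assert (h1 := Rmin_l d1 d2). assert (h2 := Rmin_r d1 d2).
  specialize (D1 h ltac:(lra)). specialize (D2 h ltac:(lra)).
  change (clog (w + h) - clog w)%C
    with (ln (Cmod (w + h)%C) - ln (Cmod w), carg (w + h)%C - carg w).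
  set (a := ln (Cmod (w + h)%C) - ln (Cmod w)) in *.
  set (b := carg (w + h)%C - carg w) in *.
  replace (a, b) with (a + b * Ci)%C
    by (apply injective_projections; simpl; ring).
  eapply Rle_lt_trans; [apply Cmod_triangle|].
  rewrite Cmod_mult, Cmod_Ci, !Cmod_R. lra.
Qed.

(* The inverse function rule for [cexp]: if [k] is the increment of [clog], then
   [h = w (cexp k - 1) = w (k + o(k))]. *)
Lemma cderiv_clog (w : C) : slit w -> cderiv clog w (/ w)%C.
Proof.
  intros H. assert (Hn := slit_neq0 w H). assert (Hm := proj1 (Cmod_gt_0 w) Hn).
  apply cderiv_iff. intros eps He.
  set (e := Rmin (/ 2) (eps * Cmod w / 2)).
  assert (He1 : e <= / 2) by apply Rmin_l.
  assert (He2 : e <= eps * Cmod w / 2) by apply Rmin_r.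
  assert (He0 : 0 < e) by (apply Rmin_pos; nra).
  destruct (proj1 (cderiv_iff _ _ _) (cderiv_cexp 0) e He0) as [d1 [Hd1 D1]].
  destruct (slit_open w H) as [d2 [Hd2 D2]].
  destruct (proj1 (ccontinuous_iff _ _) (continuous_clog w H) d1 Hd1) as [d3 [Hd3 D3]].
  exists (Rmin d2 d3). split; [apply Rmin_pos; auto|]. intros h Hh.
  assert (h1 := Rmin_l d2 d3). assert (h2 := Rmin_r d2 d3).
  specialize (D2 h ltac:(lra)). specialize (D3 h ltac:(lra)).
  set (k := (clog (w + h) - clog w)%C) in *. specialize (D1 k D3).
  rewrite cexp_0, Cplus_0_l, Cmult_1_l in D1.
  assert (E : h = (w * (cexp k - 1))%C).
  { assert (E1 : cexp (clog w + k)%C = (w + h)%C).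
    { unfold k. replace (clog w + (clog (w + h) - clog w))%C with (clog (w + h)%C) by ring.
      apply cexp_clog; auto. }
    rewrite cexp_plus, cexp_clog in E1 by auto.
    replace h with (w + h - w)%C by ring. rewrite <- E1. ring. }
  replace (k - / w * h)%C with (- (cexp k - 1 - k))%C by (rewrite E; field; auto).
  rewrite Cmod_opp.
  (* Since e <= 1/2, |k| <= |cexp k - 1| + |k| / 2, and |cexp k - 1| = |h| / |w|. *)
  assert (K : Cmod k <= 2 * (Cmod h / Cmod w)).
  { assert (K1 : Cmod (cexp k - 1)%C = Cmod h / Cmod w)
      by (rewrite E at 1; rewrite Cmod_mult; field; lra).
    assert (K2 := Cmod_triangle_rev k (cexp k - 1)%C).
    rewrite (Cmod_minus_sym k), K1 in K2.
    assert (Hk := Cmod_ge_0 k). nra. }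
  eapply Rle_trans; [exact D1|].
  apply Rle_trans with (eps * Cmod w / 2 * (2 * (Cmod h / Cmod w))).
  - apply Rmult_le_compat; auto; [lra | apply Cmod_ge_0].
  - right. field. lra.
Qed.

(** * Functions with two complex derivatives *)

(** A derivative in a neighbourhood that is again differentiable at z: just enough to differentiate
    twice along a line through z, and stable under products and composition. *)
Definition cderiv2 (f : C -> C) (z : C) : Prop :=
  exists f1 : C -> C,
    (exists delta, 0 < delta /\
       forall k, Cmod k < delta -> cderiv f (z + k)%C (f1 (z + k)%C)) /\
    exists f2 : C, cderiv f1 z f2.

Lemma cderiv2_cderiv (f : C -> C) (z : C) : cderiv2 f z -> exists d, cderiv f z d.
Proof.
  intros [f1 [[de [Hde Hd]] _]]. exists (f1 z).
  replace z with (z + 0)%C by ring. apply Hd. rewrite Cmod_0; auto.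
Qed.

Lemma cderiv2_continuous (f : C -> C) (z : C) : cderiv2 f z -> ccontinuous f z.
Proof.
  intros H. destruct (cderiv2_cderiv f z H) as [d Hd].
  exact (cderiv_continuous f z d Hd).
Qed.

Lemma cderiv2_intro (f f1 : C -> C) (z f2 : C) (P : C -> Prop) :
  (exists delta, 0 < delta /\ forall k, Cmod k < delta -> P (z + k)%C) ->
  (forall y, P y -> cderiv f y (f1 y)) -> cderiv f1 z f2 -> cderiv2 f z.
Proof.
  intros [de [Hde Hd]] H1 H2. exists f1. split; [|exists f2; auto].
  exists de; split; auto.
Qed.

Lemma cderiv2_const (c z : C) : cderiv2 (fun _ => c) z.
Proof.
  exists (fun _ => RtoC 0). split; [|exists (RtoC 0); apply cderiv_const].
  exists 1; split; [lra|]. intros; apply cderiv_const.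
Qed.

Lemma cderiv2_plus (f g : C -> C) (z : C) :
  cderiv2 f z -> cderiv2 g z -> cderiv2 (fun y => f y + g y)%C z.
Proof.
  intros [f1 [[d [Hd H]] [f2 H2]]] [g1 [[e [He K]] [g2 K2]]].
  exists (fun y => f1 y + g1 y)%C. split; [|exists (f2 + g2)%C; apply cderiv_plus; auto].
  exists (Rmin d e). split; [apply Rmin_pos; auto|]. intros k Hk.
  assert (h1 := Rmin_l d e). assert (h2 := Rmin_r d e).
  apply cderiv_plus; [apply H | apply K]; lra.
Qed.

Lemma cderiv2_mult (f g : C -> C) (z : C) :
  cderiv2 f z -> cderiv2 g z -> cderiv2 (fun y => f y * g y)%C z.
Proof.
  intros Hf Hg. destruct (cderiv2_cderiv f z Hf) as [df Df].
  destruct (cderiv2_cderiv g z Hg) as [dg Dg].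
  destruct Hf as [f1 [[d [Hd H]] [f2 H2]]]. destruct Hg as [g1 [[e [He K]] [g2 K2]]].
  exists (fun y => f1 y * g y + f y * g1 y)%C. split.
  - exists (Rmin d e). split; [apply Rmin_pos; auto|]. intros k Hk.
    assert (h1 := Rmin_l d e). assert (h2 := Rmin_r d e).
    apply cderiv_mult; [apply H | apply K]; lra.
  - eexists. apply cderiv_plus; apply cderiv_mult; eauto.
Qed.

Lemma cderiv2_comp (f g : C -> C) (z : C) :
  cderiv2 f (g z) -> cderiv2 g z -> cderiv2 (fun y => f (g y)) z.
Proof.
  intros [f1 [[d [Hd H]] [f2 H2]]] Hg.
  destruct (cderiv2_cderiv g z Hg) as [dg Dg].
  destruct (proj1 (ccontinuous_iff _ _) (cderiv2_continuous g z Hg) d Hd) as [d' [Hd' Hc]].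
  destruct Hg as [g1 [[e [He K]] [g2 K2]]].
  exists (fun y => f1 (g y) * g1 y)%C. split.
  - exists (Rmin d' e). split; [apply Rmin_pos; auto|]. intros k Hk.
    assert (h1 := Rmin_l d' e). assert (h2 := Rmin_r d' e).
    apply cderiv_comp; [|apply K; lra].
    assert (E : (g z + (g (z + k) - g z))%C = g (z + k)%C) by ring.
    rewrite <- E. apply H. apply Hc. lra.
  - eexists. apply cderiv_mult; [apply cderiv_comp|]; eauto.
Qed.

Lemma cderiv2_Cinv (z : C) : z <> RtoC 0 -> cderiv2 Cinv z.
Proof.
  intros Hz. assert (Hm := proj1 (Cmod_gt_0 z) Hz).
  apply (cderiv2_intro Cinv (fun y => -1 * / (y * y))%C z
           (-1 * (- (1 * z + z * 1) / (z * z * (z * z))))%C (fun y => y <> RtoC 0)).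
  - exists (Cmod z). split; auto. intros k Hk. apply Cmod_pos_neq0.
    assert (H := Cmod_triangle_rev' z k). lra.
  - intros y Hy. eapply cderiv_ext; [ | | apply cderiv_Cinv; auto]; [auto | ].
    field; auto.
  - apply cderiv_scal.
    apply (cderiv_inv (fun y => y * y)%C); [apply Cmult_neq_0; auto|].
    apply cderiv_mult; apply cderiv_id.
Qed.

Lemma cderiv2_cexp (z : C) : cderiv2 cexp z.
Proof.
  apply (cderiv2_intro cexp cexp z (cexp z) (fun _ => True)); auto using cderiv_cexp.
  exists 1; split; [lra | auto].
Qed.

Lemma cderiv2_clog (z : C) : slit z -> cderiv2 clog z.
Proof.
  intros H. apply (cderiv2_intro clog Cinv z (- / (z * z))%C slit).
  - apply slit_open; auto.
  - apply cderiv_clog.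
  - apply cderiv_Cinv, slit_neq0; auto.
Qed.

Lemma cderiv2_pow (f : C -> C) (n : nat) (z : C) :
  cderiv2 f z -> cderiv2 (fun y => f y ^ n)%C z.
Proof.
  intros H. induction n; simpl.
  - apply cderiv2_const.
  - apply cderiv2_mult; auto.
Qed.

(** * The maximum principle *)

Lemma bounded_cluster_R (u : nat -> R) (a b : R) :
  (forall n, a <= u n <= b) ->
  exists l, forall eps N, 0 < eps -> exists k, (N <= k)%nat /\ Rabs (u k - l) < eps.
Proof.
  intros H.
  destruct (Bolzano_Weierstrass u (fun c => a <= c <= b) (compact_P3 a b) H) as [l Hl].
  exists l. intros eps N He.
  destruct (Hl (fun y => Rabs (y - l) < eps) N) as [k [Hk1 Hk2]].
  - exists (mkposreal eps He). intros y Hy. exact Hy.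
  - exists k; auto.
Qed.

Lemma bounded_cluster_C (u : nat -> C) (M : R) :
  (forall n, Cmod (u n) <= M) ->
  exists l, forall eps N, 0 < eps -> exists k, (N <= k)%nat /\ Cmod (u k - l)%C < eps.
Proof.
  intros H.
  destruct (bounded_cluster_R (fun n => Re (u n)) (- M) M) as [x Hx].
  { intros n. apply Rabs_le_between. eapply Rle_trans; [apply re_le_Cmod | auto]. }
  assert (Hp : forall n, 0 < / (INR n + 1)).
  { intros n. apply Rinv_0_lt_compat. assert (H0 := pos_INR n). lra. }
  (* A selection of indices along which the real parts converge at the rate 1 / (n + 1); a cluster
     point of the imaginary parts is then sought among the selected terms only. *)
  destruct (choice (fun n k => (n <= k)%nat /\ Rabs (Re (u k) - x) < / (INR n + 1))) as [s Hs].
  { intros n. apply Hx. auto. }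
  destruct (bounded_cluster_R (fun n => Im (u (s n))) (- M) M) as [y Hy].
  { intros n. apply Rabs_le_between. eapply Rle_trans; [apply im_le_Cmod | auto]. }
  exists (x, y). intros eps N He.
  destruct (archimed_cor1 (eps / 2)) as [N1 [HN1 HN1']]; [lra|].
  destruct (Hy (eps / 2) (Nat.max N N1)) as [k [Hk1 Hk2]]; [lra|].
  destruct (Hs k) as [Hs1 Hs2].
  exists (s k). split; [lia|].
  replace (u (s k) - (x, y))%C with (RtoC (Re (u (s k)) - x) + RtoC (Im (u (s k)) - y) * Ci)%C
    by (apply injective_projections; unfold Re, Im; simpl; ring).
  eapply Rle_lt_trans; [apply Cmod_triangle|].
  rewrite Cmod_mult, Cmod_Ci, !Cmod_R.
  assert (/ (INR k + 1) < eps / 2); [|lra].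
  eapply Rle_lt_trans; [|exact HN1]. apply Rinv_le_contravar.
  - apply lt_0_INR; auto.
  - assert (INR N1 <= INR k) by (apply le_INR; lia). lra.
Qed.

(** The supremum is taken over [atan (g z)], bounded before anything is known about g. A cluster
    point of a maximising sequence attains it, and [atan] is increasing. *)
Lemma compact_max (K : C -> Prop) (g : C -> R) (M : R) :
  (exists z, K z) ->
  (forall z, K z -> Cmod z <= M) ->
  (forall z, (forall eps, 0 < eps -> exists y, K y /\ Cmod (y - z)%C < eps) -> K z) ->
  (forall z, K z -> rcontinuous g z) ->
  exists zm, K zm /\ forall z, K z -> g z <= g zm.
Proof.
  intros [z0 Hz0] HM Hcl Hg.
  set (E := fun v => exists z, K z /\ v = atan (g z)).
  destruct (completeness E) as [s [Hs1 Hs2]].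
  { exists (PI / 2). intros v [z [_ ->]]. left; apply atan_bound. }
  { exists (atan (g z0)), z0; auto. }
  assert (Hp : forall n, 0 < / (INR n + 1)).
  { intros n. apply Rinv_0_lt_compat. assert (H0 := pos_INR n). lra. }
  destruct (choice (fun n z => K z /\ s - / (INR n + 1) < atan (g z))) as [u Hu].
  { intros n. apply NNPP. intros Hn. specialize (Hp n).
    assert (s <= s - / (INR n + 1)); [|lra].
    apply Hs2. intros v [z [Hz ->]]. apply Rnot_lt_le. intros Hlt.
    apply Hn. exists z; auto. }
  destruct (bounded_cluster_C u M) as [l Hl].
  { intros n. apply HM, Hu. }
  assert (Kl : K l).
  { apply Hcl. intros eps He. destruct (Hl eps 0%nat He) as [k [_ Hk]].
    exists (u k). split; auto. apply Hu. }
  exists l. split; auto.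
  assert (Hsl : s <= atan (g l)).
  { apply le_epsilon. intros eps He.
    assert (Hc : rcontinuous (fun z => atan (g z)) l).
    { apply (continuous_comp (g : C_UniformSpace -> R_UniformSpace) atan);
        [apply Hg; auto | apply continuous_atan]. }
    destruct (proj1 (rcontinuous_iff _ _) Hc (eps / 2)) as [d [Hd D]]; [lra|].
    destruct (archimed_cor1 (eps / 2)) as [N1 [HN1 HN1']]; [lra|].
    destruct (Hl d N1 Hd) as [k [Hk1 Hk2]].
    specialize (D _ Hk2). replace (l + (u k - l))%C with (u k) in D by ring.
    destruct (Hu k) as [_ Hk3]. apply Rabs_lt_between in D.
    assert (/ (INR k + 1) < eps / 2); [|lra].
    eapply Rle_lt_trans; [|exact HN1]. apply Rinv_le_contravar.
    - apply lt_0_INR; auto.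
    - assert (INR N1 <= INR k) by (apply le_INR; lia). lra. }
  intros z Hz. apply Rnot_lt_le. intros Hlt. apply atan_increasing in Hlt.
  assert (atan (g z) <= s) by (apply Hs1; exists z; auto). lra.
Qed.

(** If c were positive, f1, which is 0 at the maximum, would be positive just to the right of 0, and
    the mean value theorem would push f above f 0. *)
Lemma second_derivative_at_max (f f1 : R -> R) (c rho : R) : 0 < rho ->
  (forall t, Rabs t < rho -> is_derive f t (f1 t)) -> is_derive f1 0 c ->
  (forall t, Rabs t < rho -> f t <= f 0) -> c <= 0.
Proof.
  intros Hr H1 H2 Hm. apply Rnot_lt_le. intros Hc.
  assert (R0 : Rabs 0 < rho) by (rewrite Rabs_R0; auto).
  assert (Hf0 : f1 0 = 0).
  { assert (Hd := H1 0 R0).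
    assert (pr : derivable_pt f 0) by (exists (f1 0); apply is_derive_Reals; auto).
    rewrite <- (derive_pt_eq_0 f 0 (f1 0) pr) by (apply is_derive_Reals; auto).
    apply (deriv_maximum f (- rho) rho); try lra.
    intros x Hx1 Hx2. apply Hm. apply Rabs_def1; lra. }
  apply is_derive_Reals in H2.
  destruct (H2 c Hc) as [[d Hd] D]. simpl in D.
  set (t := Rmin d rho / 2).
  assert (h1 := Rmin_l d rho). assert (h2 := Rmin_r d rho).
  assert (Ht : 0 < t) by (unfold t; assert (0 < Rmin d rho) by (apply Rmin_pos; auto); lra).
  assert (Ht' : t < d /\ t < rho) by (unfold t in *; lra).
  assert (Hmt := Hm t ltac:(apply Rabs_def1; lra)).
  destruct (MVT_cor2 f f1 0 t Ht) as [y [Hy1 Hy2]].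
  { intros y Hy. apply is_derive_Reals, H1. apply Rabs_def1; lra. }
  assert (Hy := D y ltac:(lra) ltac:(rewrite Rabs_pos_eq; lra)).
  rewrite Rplus_0_l, Hf0, Rminus_0_r in Hy. apply Rabs_lt_between in Hy.
  assert (0 < f1 y); [|nra].
  replace (f1 y) with (f1 y / y * y) by (field; lra). nra.
Qed.

Definition Cnorm2 (z : C) : R := Re z ^ 2 + Im z ^ 2.

Lemma Cnorm2_Cmod (z : C) : Cnorm2 z = Cmod z ^ 2.
Proof. symmetry. apply Cmod2_alt. Qed.

(* [|h|^2] is subharmonic, [ln |y|^2] harmonic and [|y|^2] strictly subharmonic. *)
Lemma no_interior_max (h : C -> C) (z : C) (de ep rho : R) :
  z <> RtoC 0 -> cderiv2 h z -> 0 < ep -> 0 < rho ->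
  (forall k, Cmod k < rho ->
     Cnorm2 (h (z + k)%C) + de * ln (Cnorm2 (z + k)%C) + ep * Cnorm2 (z + k)%C
     <= Cnorm2 (h z) + de * ln (Cnorm2 z) + ep * Cnorm2 z) -> False.
Proof.
  intros Hz [h1 [[d [Hd H1]] [h2 H2]]] Hep Hrho Hmax.
  assert (Hm := proj1 (Cmod_gt_0 z) Hz).
  set (r := Rmin (Rmin d rho) (Cmod z)).
  assert (Hr : 0 < r) by (repeat apply Rmin_pos; auto).
  assert (Hr' : r <= d /\ r <= rho /\ r <= Cmod z).
  { assert (a1 := Rmin_l (Rmin d rho) (Cmod z)). assert (a2 := Rmin_r (Rmin d rho) (Cmod z)).
    assert (a3 := Rmin_l d rho). assert (a4 := Rmin_r d rho). unfold r; lra. }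
  (* The left side is the second derivative at t = 0 of the maximised function along z + t e. *)
  assert (Dir : forall e : C, Cmod e = 1 ->
    2 * (Re (h1 z * e)%C ^ 2 + Im (h1 z * e)%C ^ 2
         + Re (h z) * Re (h2 * e * e)%C + Im (h z) * Im (h2 * e * e)%C)
    + de * (2 * (Re e ^ 2 + Im e ^ 2) / Cnorm2 z
            - 4 * (Re z * Re e + Im z * Im e) ^ 2 / Cnorm2 z ^ 2)
    + 2 * ep * (Re e ^ 2 + Im e ^ 2) <= 0).
  { intros e He.
    assert (Hte : forall t : R, Cmod (t * e)%C = Rabs t)
      by (intros; rewrite Cmod_mult, Cmod_R, He; ring).
    assert (Hn : forall t : R, Rabs t < r ->
                 0 < (Re z + t * Re e) ^ 2 + (Im z + t * Im e) ^ 2).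
    { intros t Ht. replace ((Re z + t * Re e) ^ 2 + (Im z + t * Im e) ^ 2)
        with (Cnorm2 (z + t * e)%C) by (unfold Cnorm2; rewrite re_plus, re_scal_l;
          destruct z, e; simpl; ring).
      rewrite Cnorm2_Cmod. apply pow_lt.
      assert (a := Cmod_triangle_rev' z (t * e)%C). rewrite Hte in a. lra. }
    apply (second_derivative_at_max
      (fun t : R => Re (h (z + t * e)%C) ^ 2 + Im (h (z + t * e)%C) ^ 2
        + de * ln ((Re z + t * Re e) ^ 2 + (Im z + t * Im e) ^ 2)
        + ep * ((Re z + t * Re e) ^ 2 + (Im z + t * Im e) ^ 2))
      (fun t : R => 2 * (Re (h (z + t * e)%C) * Re (h1 (z + t * e)%C * e)%C
                     + Im (h (z + t * e)%C) * Im (h1 (z + t * e)%C * e)%C)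
        + de * (2 * ((Re z + t * Re e) * Re e + (Im z + t * Im e) * Im e)
                 / ((Re z + t * Re e) ^ 2 + (Im z + t * Im e) ^ 2))
        + 2 * ep * ((Re z + t * Re e) * Re e + (Im z + t * Im e) * Im e)) _ r Hr).
    - intros t Ht.
      assert (A := cderiv_line_Re h z e _ t (H1 (t * e)%C ltac:(rewrite Hte; lra))).
      assert (B := cderiv_line_Im h z e _ t (H1 (t * e)%C ltac:(rewrite Hte; lra))).
      assert (N := Hn t Ht).
      pose (u := fun t : R => Re (h (z + t * e)%C)).
      pose (v := fun t : R => Im (h (z + t * e)%C)).
      change (is_derive (fun t : R => u t ^ 2 + v t ^ 2
        + de * ln ((Re z + t * Re e) ^ 2 + (Im z + t * Im e) ^ 2)
        + ep * ((Re z + t * Re e) ^ 2 + (Im z + t * Im e) ^ 2)) t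
        (2 * (u t * Re (h1 (z + t * e)%C * e)%C + v t * Im (h1 (z + t * e)%C * e)%C)
        + de * (2 * ((Re z + t * Re e) * Re e + (Im z + t * Im e) * Im e)
                 / ((Re z + t * Re e) ^ 2 + (Im z + t * Im e) ^ 2))
        + 2 * ep * ((Re z + t * Re e) * Re e + (Im z + t * Im e) * Im e))).
      change (is_derive u t (Re (h1 (z + t * e)%C * e)%C)) in A.
      change (is_derive v t (Im (h1 (z + t * e)%C * e)%C)) in B.
      clearbody u v.
      auto_derive.
      + repeat split; auto; eexists; eassumption.
      + replace (Derive (fun x : R => u x) t) with (Re (h1 (z + t * e)%C * e)%C)
          by (symmetry; apply is_derive_unique, A).
        replace (Derive (fun x : R => v x) t) with (Im (h1 (z + t * e)%C * e)%C)
          by (symmetry; apply is_derive_unique, B).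
        field. simpl in N. lra.
    - assert (E0 : (z + 0%R * e)%C = z) by ring.
      assert (Hz1 : cderiv h z (h1 z)).
      { rewrite <- E0. apply H1. rewrite Hte, Rabs_R0; auto. }
      assert (A : is_derive (fun t : R => Re (h (z + t * e)%C)) 0 (Re (h1 z * e)%C)).
      { apply cderiv_line_Re. rewrite E0. exact Hz1. }
      assert (B : is_derive (fun t : R => Im (h (z + t * e)%C)) 0 (Im (h1 z * e)%C)).
      { apply cderiv_line_Im. rewrite E0. exact Hz1. }
      assert (H2' : cderiv (fun y => h1 y * e)%C (z + 0%R * e)%C (h2 * e)%C).
      { rewrite E0. apply (cderiv_ext (fun y => e * h1 y)%C _ z (e * h2)%C);
          [intros; ring | ring | apply cderiv_scal; auto]. }
      assert (A' := cderiv_line_Re _ z e _ 0 H2').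
      assert (B' := cderiv_line_Im _ z e _ 0 H2').
      assert (N := Hn 0 ltac:(rewrite Rabs_R0; auto)).
      pose (u := fun t : R => Re (h (z + t * e)%C)).
      pose (v := fun t : R => Im (h (z + t * e)%C)).
      pose (u' := fun t : R => Re (h1 (z + t * e) * e)%C).
      pose (v' := fun t : R => Im (h1 (z + t * e) * e)%C).
      assert (U0 : Re (h z) = u 0) by (unfold u; rewrite E0; auto).
      assert (V0 : Im (h z) = v 0) by (unfold v; rewrite E0; auto).
      assert (U0' : Re (h1 z * e)%C = u' 0) by (unfold u'; rewrite E0; auto).
      assert (V0' : Im (h1 z * e)%C = v' 0) by (unfold v'; rewrite E0; auto).
      change (is_derive (fun t : R => 2 * (u t * u' t + v t * v' t)
        + de * (2 * ((Re z + t * Re e) * Re e + (Im z + t * Im e) * Im e)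
                 / ((Re z + t * Re e) ^ 2 + (Im z + t * Im e) ^ 2))
        + 2 * ep * ((Re z + t * Re e) * Re e + (Im z + t * Im e) * Im e)) 0
        (2 * (Re (h1 z * e)%C ^ 2 + Im (h1 z * e)%C ^ 2
         + Re (h z) * Re (h2 * e * e)%C + Im (h z) * Im (h2 * e * e)%C)
    + de * (2 * (Re e ^ 2 + Im e ^ 2) / Cnorm2 z
            - 4 * (Re z * Re e + Im z * Im e) ^ 2 / Cnorm2 z ^ 2)
    + 2 * ep * (Re e ^ 2 + Im e ^ 2))).
      change (is_derive u 0 (Re (h1 z * e)%C)) in A.
      change (is_derive v 0 (Im (h1 z * e)%C)) in B.
      change (is_derive u' 0 (Re (h2 * e * e)%C)) in A'.
      change (is_derive v' 0 (Im (h2 * e * e)%C)) in B'.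
      rewrite U0, V0, U0', V0' in *.
      clearbody u v u' v'. unfold Cnorm2.
      auto_derive.
      + repeat split; try (eexists; eassumption). simpl in N. lra.
      + replace (Derive (fun x : R => u x) 0) with (u' 0)
          by (symmetry; apply is_derive_unique, A).
        replace (Derive (fun x : R => v x) 0) with (v' 0)
          by (symmetry; apply is_derive_unique, B).
        replace (Derive (fun x : R => u' x) 0) with (Re (h2 * e * e)%C)
          by (symmetry; apply is_derive_unique, A').
        replace (Derive (fun x : R => v' x) 0) with (Im (h2 * e * e)%C)
          by (symmetry; apply is_derive_unique, B').
        rewrite !Rmult_0_l, !Rplus_0_r in *. simpl in N.
        field. simpl. lra.
    - intros t Ht.
      assert (M := Hmax (t * e)%C ltac:(rewrite Hte; lra)).
      replace (z + 0%R * e)%C with z by ring.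
      rewrite !Rmult_0_l, !Rplus_0_r.
      assert (E : Cnorm2 (z + t * e)%C = (Re z + t * Re e) ^ 2 + (Im z + t * Im e) ^ 2)
        by (destruct z, e; unfold Cnorm2, Re, Im; simpl; ring).
      rewrite E in M. exact M. }
  (* The inequalities for the directions 1 and i are added. Since i^2 = -1 the terms in h2 cancel,
     the logarithmic terms cancel by harmonicity, and 4 |h1 z|^2 + 4 ep <= 0 is left. *)
  assert (D1 := Dir 1%C Cmod_1). assert (D2 := Dir Ci Cmod_Ci).
  assert (Hn : 0 < Cnorm2 z) by (rewrite Cnorm2_Cmod; apply pow_lt; auto).
  replace (h2 * 1 * 1)%C with h2 in D1 by ring.
  replace (h2 * Ci * Ci)%C with (- h2)%C in D2
    by (destruct h2; apply injective_projections; simpl; ring).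
  assert (E : forall x y, Cnorm2 z = x ^ 2 + y ^ 2 ->
     2 / Cnorm2 z - 4 * x ^ 2 / Cnorm2 z ^ 2 = - (2 / Cnorm2 z - 4 * y ^ 2 / Cnorm2 z ^ 2)).
  { intros x y Exy. replace (y ^ 2) with (Cnorm2 z - x ^ 2) by lra. field. lra. }
  specialize (E (Re z) (Im z) eq_refl).
  replace (2 * (Re (RtoC 1) ^ 2 + Im (RtoC 1) ^ 2) / Cnorm2 z
           - 4 * (Re z * Re (RtoC 1) + Im z * Im (RtoC 1)) ^ 2 / Cnorm2 z ^ 2)
    with (2 / Cnorm2 z - 4 * Re z ^ 2 / Cnorm2 z ^ 2) in D1
    by (simpl; field; lra).
  replace (2 * (Re Ci ^ 2 + Im Ci ^ 2) / Cnorm2 z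
           - 4 * (Re z * Re Ci + Im z * Im Ci) ^ 2 / Cnorm2 z ^ 2)
    with (2 / Cnorm2 z - 4 * Im z ^ 2 / Cnorm2 z ^ 2) in D2
    by (simpl; field; lra).
  rewrite E in D1.
  set (q := 2 / Cnorm2 z - 4 * Im z ^ 2 / Cnorm2 z ^ 2) in *.
  rewrite re_opp in D2.
  change (Im (- h2)%C) with (- Im h2) in D2.
  assert (P1 := pow2_ge_0 (Re (h1 z * 1)%C)). assert (P2 := pow2_ge_0 (Im (h1 z * 1)%C)).
  assert (P3 := pow2_ge_0 (Re (h1 z * Ci)%C)). assert (P4 := pow2_ge_0 (Im (h1 z * Ci)%C)).
  replace (Re (RtoC 1) ^ 2 + Im (RtoC 1) ^ 2) with 1 in D1 by (simpl; ring).
  replace (Re Ci ^ 2 + Im Ci ^ 2) with 1 in D2 by (simpl; ring).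
  lra.
Qed.

Lemma rcontinuous_Cnorm2_comp (h : C -> C) (z : C) :
  ccontinuous h z -> rcontinuous (fun y => Cnorm2 (h y)) z.
Proof.
  intros H. unfold Cnorm2.
  assert (Sq : forall L : C -> R, (forall y, rcontinuous L y) ->
                 rcontinuous (fun y => L (h y) ^ 2) z).
  { intros L HL. apply (continuous_comp (fun y : C_UniformSpace => L (h y)) (fun x => x ^ 2)).
    - apply (continuous_comp (h : C_UniformSpace -> C_UniformSpace) L); auto.
    - apply (ex_derive_continuous (V := R_NormedModule) (fun x : R => x ^ 2)). auto_derive; auto. }
  apply (continuous_plus (K := R_AbsRing) (V := R_NormedModule)
           (fun y : C_UniformSpace => Re (h y) ^ 2) (fun y => Im (h y) ^ 2)); apply Sq.
  - apply rcontinuous_Re.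
  - apply rcontinuous_Im.
Qed.

(* The barrier [de * ln |z|^2] takes care of the puncture. *)
Lemma punctured_max_principle (h : C -> C) (r rho M : R) :
  0 < r -> 0 < rho ->
  (forall z, 0 < Cmod z < r -> cderiv2 h z) ->
  (forall z, 0 < Cmod z <= r -> ccontinuous h z) ->
  (forall z, Cmod z = r -> Cmod (h z) <= 1) ->
  (forall z, 0 < Cmod z < rho -> Cmod (h z) <= M) ->
  forall z, 0 < Cmod z <= r -> Cmod (h z) <= 1.
Proof.
  intros Hr Hrho H2 Hc Hb HM zs [Hzs Hzs'].
  apply Rnot_lt_le. intros Hlt.
  destruct (Rle_lt_or_eq_dec _ _ Hzs') as [Hzr|Hzr]; [|specialize (Hb zs Hzr); lra].
  set (m := Cmod (h zs) ^ 2 - 1).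
  assert (Hm : 0 < m) by (unfold m; nra).
  assert (Hln : ln (Cmod zs) < ln r) by (apply ln_increasing; auto).
  (* Between zs and the circle |z| = r the two barrier terms change by at most 2 (m / 8) + m / 4 <
     m, so the excess m at zs survives: g zs beats every value of g on that circle. *)
  set (de := m / (8 * (ln r - ln (Cmod zs)))).
  assert (Hde : 0 < de) by (apply Rdiv_lt_0_compat; lra).
  set (ep := m / (4 * r ^ 2)).
  assert (Hr2 : 0 < r ^ 2) by (apply pow_lt; auto).
  assert (Hep : 0 < ep) by (apply Rdiv_lt_0_compat; lra).
  set (g := fun z => Cnorm2 (h z) + de * ln (Cnorm2 z) + ep * Cnorm2 z).
  assert (Gval : forall z, 0 < Cmod z ->
            g z = Cmod (h z) ^ 2 + 2 * de * ln (Cmod z) + ep * Cmod z ^ 2).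
  { intros z Hz. unfold g. rewrite !Cnorm2_Cmod.
    replace (Cmod z ^ 2) with (Cmod z * Cmod z) at 1 by ring.
    rewrite ln_mult by auto. ring. }
  set (c0 := 2 * de * ln r + ep * r ^ 2).
  assert (Gzs : c0 + 1 < g zs).
  { rewrite Gval by auto. replace (Cmod (h zs) ^ 2) with (1 + m) by (unfold m; ring).
    assert (E1 : de * (ln r - ln (Cmod zs)) = m / 8) by (unfold de; field; lra).
    assert (E2 : ep * r ^ 2 = m / 4) by (unfold ep; field; lra).
    assert (0 <= ep * Cmod zs ^ 2) by (apply Rmult_le_pos; [lra | apply pow2_ge_0]).
    unfold c0. lra. }
  (* X solves M^2 + 2 de X + ep r^2 = c0. On the circle |z| = r1 <= exp X the logarithm therefore
     brings g down to c0, and the maximum over the annulus must be interior. *)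
  set (X := (c0 - M ^ 2 - ep * r ^ 2) / (2 * de)).
  set (r1 := Rmin (Rmin (rho / 2) (Cmod zs / 2)) (exp X)).
  assert (Hr1 : 0 < r1) by (repeat apply Rmin_pos; try lra; apply exp_pos).
  assert (B : r1 <= rho / 2 /\ r1 <= Cmod zs / 2 /\ r1 <= exp X).
  { assert (a1 := Rmin_l (Rmin (rho / 2) (Cmod zs / 2)) (exp X)).
    assert (a2 := Rmin_r (Rmin (rho / 2) (Cmod zs / 2)) (exp X)).
    assert (a3 := Rmin_l (rho / 2) (Cmod zs / 2)).
    assert (a4 := Rmin_r (rho / 2) (Cmod zs / 2)). unfold r1; lra. }
  destruct B as [B1 [B2 B3]].
  destruct (compact_max (fun z => r1 <= Cmod z <= r) g r) as [zm [[Km1 Km2] Kmax]].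
  - exists zs; lra.
  - intros z; lra.
  - intros z Hz. split; apply le_epsilon; intros eps He;
      destruct (Hz eps He) as [y [Hy1 Hy2]].
    + assert (a := Cmod_triangle_rev y z). lra.
    + assert (a := Cmod_triangle_rev z y). rewrite Cmod_minus_sym in a. lra.
  - intros z Hz. unfold g.
    apply (continuous_plus (K := R_AbsRing) (V := R_NormedModule)
      (fun z : C_UniformSpace => Cnorm2 (h z) + de * ln (Cnorm2 z)) (fun z => ep * Cnorm2 z)).
    + apply (continuous_plus (K := R_AbsRing) (V := R_NormedModule)
        (fun z : C_UniformSpace => Cnorm2 (h z)) (fun z => de * ln (Cnorm2 z))).
      * apply rcontinuous_Cnorm2_comp, Hc. lra.
      * apply (continuous_comp (Cnorm2 : C_UniformSpace -> R_UniformSpace) (fun x => de * ln x)).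
        { apply (rcontinuous_Cnorm2_comp (fun y => y)). apply continuous_id. }
        apply (ex_derive_continuous (V := R_NormedModule) (fun x : R => de * ln x)).
        auto_derive. rewrite Cnorm2_Cmod. apply pow_lt. lra.
    + apply (continuous_comp (Cnorm2 : C_UniformSpace -> R_UniformSpace) (fun x => ep * x)).
      { apply (rcontinuous_Cnorm2_comp (fun y => y)). apply continuous_id. }
      apply (ex_derive_continuous (V := R_NormedModule) (fun x : R => ep * x)).
      auto_derive; auto.
  - assert (Gm := Kmax zs ltac:(lra)).
    assert (Hzm : 0 < Cmod zm) by lra.
    assert (Nr : Cmod zm <> r).
    { intros E. assert (Hb' := Hb zm E). rewrite (Gval zm Hzm), E in Gm.
      assert (Cmod (h zm) ^ 2 <= 1 ^ 2) by (apply pow_incr; split; [apply Cmod_ge_0|auto]).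
      unfold c0 in Gzs. lra. }
    assert (Nr1 : Cmod zm <> r1).
    { intros E. assert (Hb' := HM zm ltac:(lra)). rewrite (Gval zm Hzm), E in Gm.
      assert (Cmod (h zm) ^ 2 <= M ^ 2) by (apply pow_incr; split; [apply Cmod_ge_0|auto]).
      assert (ln r1 <= X).
      { rewrite <- (ln_exp X). destruct B3 as [B3|B3]; [left; apply ln_increasing; auto | right; f_equal; auto]. }
      assert (2 * de * ln r1 <= c0 - M ^ 2 - ep * r ^ 2).
      { replace (c0 - M ^ 2 - ep * r ^ 2) with (2 * de * X) by (unfold X; field; lra).
        apply Rmult_le_compat_l; lra. }
      assert (ep * r1 ^ 2 <= ep * r ^ 2).
      { apply Rmult_le_compat_l; [lra|]. apply pow_incr. lra. }
      lra. }
    apply (no_interior_max h zm de ep (Rmin (Cmod zm - r1) (r - Cmod zm))).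
    + apply Cmod_pos_neq0; auto.
    + apply H2. lra.
    + auto.
    + apply Rmin_pos; lra.
    + intros k Hk.
      assert (a1 := Rmin_l (Cmod zm - r1) (r - Cmod zm)).
      assert (a2 := Rmin_r (Cmod zm - r1) (r - Cmod zm)).
      apply Kmax. assert (a3 := Cmod_triangle zm k). assert (a4 := Cmod_triangle_rev' zm k).
      lra.
Qed.

(** * The Schwarz lemma of order n and Jack's lemma *)

Lemma schwarz_order_n (w : C -> C) (n : nat) (r rho M : R) :
  0 < r -> 0 < rho ->
  (forall z, 0 < Cmod z < r -> cderiv2 w z) ->
  (forall z, 0 < Cmod z <= r -> ccontinuous w z) ->
  (forall z, Cmod z = r -> Cmod (w z) <= 1) ->
  (forall z, 0 < Cmod z < rho -> Cmod (w z) <= M * Cmod z ^ n) ->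
  forall z, 0 < Cmod z <= r -> Cmod (w z) <= (Cmod z / r) ^ n.
Proof.
  intros Hr Hrho H2 Hc Hb HM.
  (* On |z| = r the factor r / z has modulus 1, and near 0 its n-th power is compensated by the
     order of w. So h is bounded near the puncture and at most 1 in modulus on the outer circle. *)
  set (h := fun z => (w z * (r * / z) ^ n)%C).
  assert (Hh : forall z, 0 < Cmod z -> Cmod (h z) = Cmod (w z) * (r / Cmod z) ^ n).
  { intros z Hz. unfold h. rewrite Cmod_mult, Cmod_pow, Cmod_mult, Cmod_R.
    rewrite Cmod_inv by (apply Cmod_pos_neq0; auto). rewrite Rabs_pos_eq by lra. reflexivity. }
  assert (Hp : forall z, 0 < Cmod z -> cderiv2 (fun z => (r * / z) ^ n)%C z).
  { intros z Hz. apply (cderiv2_pow (fun z => r * / z)%C).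
    apply (cderiv2_mult (fun _ => RtoC r)); [apply cderiv2_const|].
    apply cderiv2_Cinv, Cmod_pos_neq0; auto. }
  intros z Hz.
  assert (B : Cmod (h z) <= 1).
  { apply (punctured_max_principle h r rho (M * r ^ n)); auto.
    - intros y Hy. apply (cderiv2_mult w); [apply H2 | apply Hp]; lra.
    - intros y Hy. apply ccontinuous_iff.
      assert (Q := cderiv2_continuous _ _ (Hp y ltac:(lra))).
      assert (W := Hc y Hy). rewrite ccontinuous_iff in Q, W.
      set (q := fun z => ((r * / z) ^ n)%C) in *.
      intros eps He. set (A := Cmod (w y) + Cmod (q y) + 1).
      assert (HA : 0 < A) by (assert (a := Cmod_ge_0 (w y)); assert (b := Cmod_ge_0 (q y)); unfold A; lra).
      set (e := Rmin 1 (eps / (2 * A))).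
      assert (e1 : e <= 1) by apply Rmin_l. assert (e2 : e <= eps / (2 * A)) by apply Rmin_r.
      assert (e0 : 0 < e) by (apply Rmin_pos; [lra | apply Rdiv_lt_0_compat; lra]).
      destruct (Q e e0) as [d1 [Hd1 D1]]. destruct (W e e0) as [d2 [Hd2 D2]].
      exists (Rmin d1 d2). split; [apply Rmin_pos; auto|]. intros k Hk.
      assert (h1 := Rmin_l d1 d2). assert (h2 := Rmin_r d1 d2).
      specialize (D1 k ltac:(lra)). specialize (D2 k ltac:(lra)).
      change (h (y + k)%C) with (w (y + k) * q (y + k))%C.
      change (h y) with (w y * q y)%C.
      set (a := (w (y + k) - w y)%C) in *. set (b := (q (y + k) - q y)%C) in *.
      change (Cmod b < e) in D1. change (Cmod a < e) in D2.
      replace (w (y + k) * q (y + k) - w y * q y)%C with (a * b + (a * q y + b * w y))%C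
        by (unfold a, b; ring).
      eapply Rle_lt_trans; [apply Cmod_triangle|].
      eapply Rle_lt_trans; [apply Rplus_le_compat_l, Cmod_triangle|].
      rewrite !Cmod_mult.
      assert (Ha := Cmod_ge_0 a). assert (Hb' := Cmod_ge_0 b).
      assert (Hw := Cmod_ge_0 (w y)). assert (Hq := Cmod_ge_0 (q y)).
      apply Rle_lt_trans with (e * A).
      + assert (Cmod a * Cmod b <= e * 1) by (apply Rmult_le_compat; lra).
        assert (Cmod a * Cmod (q y) <= e * Cmod (q y)) by (apply Rmult_le_compat_r; lra).
        assert (Cmod b * Cmod (w y) <= e * Cmod (w y)) by (apply Rmult_le_compat_r; lra).
        unfold A. lra.
      + apply Rle_lt_trans with (eps / (2 * A) * A).
        * apply Rmult_le_compat_r; lra.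
        * replace (eps / (2 * A) * A) with (eps / 2) by (field; lra). lra.
    - intros y Hy. rewrite Hh, Hy by lra.
      replace (r / r) with 1 by (field; lra). rewrite pow1, Rmult_1_r. auto.
    - intros y Hy. rewrite Hh by lra.
      replace (r / Cmod y) with (/ Cmod y * r) by (unfold Rdiv; ring).
      rewrite Rpow_mult_distr, pow_inv, <- Rmult_assoc.
      apply Rmult_le_compat_r; [apply pow_le; lra|].
      assert (0 < Cmod y ^ n) by (apply pow_lt; lra).
      apply Rmult_le_reg_r with (Cmod y ^ n); auto.
      rewrite Rmult_assoc, Rinv_l, Rmult_1_r by lra. auto. }
  rewrite Hh in B by lra.
  assert (P : 0 < (r / Cmod z) ^ n) by (apply pow_lt, Rdiv_lt_0_compat; lra).
  apply Rmult_le_reg_r with ((r / Cmod z) ^ n); auto.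
  rewrite <- Rpow_mult_distr. replace (Cmod z / r * (r / Cmod z)) with 1 by (field; lra).
  rewrite pow1. auto.
Qed.

Lemma derivative_sign (f : R -> R) (l T : R) : 0 < T ->
  is_derive f 0 l -> (forall t, 0 < t < T -> f 0 <= f t) -> 0 <= l.
Proof.
  intros HT Hd Hf. apply Rnot_lt_le. intros Hl.
  apply is_derive_Reals in Hd. destruct (Hd (- l) ltac:(lra)) as [[d Hd0] D]. simpl in D.
  set (t := Rmin d T / 2).
  assert (h1 := Rmin_l d T). assert (h2 := Rmin_r d T).
  assert (Ht : 0 < t) by (unfold t; assert (0 < Rmin d T) by (apply Rmin_pos; auto); lra).
  assert (Ht' : t < d /\ t < T) by (unfold t in *; lra).
  assert (Dt := D t ltac:(lra) ltac:(rewrite Rabs_pos_eq; lra)).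
  assert (Ft := Hf t ltac:(lra)). rewrite Rplus_0_l in Dt. apply Rabs_lt_between in Dt.
  assert (0 <= (f t - f 0) / t); [|lra].
  apply Rdiv_le_0_compat; lra.
Qed.

(* [|w|^2] and [(|z|/|z0|)^(2n)] agree at [z0]: compare their derivatives along every inward
   direction [z0 (-1 + i tau)]. *)
Lemma jack (w : C -> C) (z0 d : C) (n : nat) :
  z0 <> RtoC 0 -> cderiv w z0 d -> Cmod (w z0) = 1 ->
  (forall z, 0 < Cmod z <= Cmod z0 -> Cmod (w z) <= (Cmod z / Cmod z0) ^ n) ->
  exists k : R, INR n <= k /\ (z0 * d / w z0)%C = RtoC k.
Proof.
  intros Hz Hd Hw Hb. assert (Hm := proj1 (Cmod_gt_0 z0) Hz).
  set (ka := (z0 * d / w z0)%C).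
  assert (Hw0 : w z0 <> RtoC 0) by (apply Cmod_pos_neq0; lra).
  assert (Key : forall tau : R, INR n <= Re ka + tau * Im ka).
  { intros tau. set (e := (z0 * (-1, tau))%C).
    assert (E0 : (z0 + 0%R * e)%C = z0) by ring.
    assert (He : cderiv w (z0 + 0%R * e)%C d) by (rewrite E0; auto).
    assert (A := cderiv_line_Re w z0 e d 0 He). assert (B := cderiv_line_Im w z0 e d 0 He).
    pose (u := fun t : R => Re (w (z0 + t * e)%C)).
    pose (v := fun t : R => Im (w (z0 + t * e)%C)).
    change (is_derive u 0 (Re (d * e)%C)) in A.
    change (is_derive v 0 (Im (d * e)%C)) in B.
    assert (U0 : u 0 = Re (w z0)) by (unfold u; rewrite E0; auto).
    assert (V0 : v 0 = Im (w z0)) by (unfold v; rewrite E0; auto).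
    assert (N1 : Re (w z0) ^ 2 + Im (w z0) ^ 2 = 1)
      by (rewrite <- Cmod2_alt, Hw; ring).
    assert (D : is_derive
      (fun t : R => ((1 - t) ^ 2 + (t * tau) ^ 2) ^ n - (u t ^ 2 + v t ^ 2)) 0
      (2 * (Re ka + tau * Im ka) - 2 * INR n)).
    { assert (K : Re ka + tau * Im ka = - (u 0 * Re (d * e)%C + v 0 * Im (d * e)%C)).
      { rewrite U0, V0.
        replace (d * e)%C with (ka * w z0 * (-1, tau))%C by (unfold ka, e; field; auto).
        destruct ka as [k1 k2], (w z0) as [w1 w2]. unfold Re, Im in *; simpl in *.
        transitivity ((w1 * (w1 * 1) + w2 * (w2 * 1)) * (k1 + tau * k2));
          [rewrite N1; ring | ring]. }
      rewrite K. clearbody u v.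
      auto_derive.
      - repeat split; eexists; eassumption.
      - replace (Derive (fun x : R => u x) 0) with (Re (d * e)%C)
          by (symmetry; apply is_derive_unique, A).
        replace (Derive (fun x : R => v x) 0) with (Im (d * e)%C)
          by (symmetry; apply is_derive_unique, B).
        match goal with |- context [?x ^ Nat.pred n] =>
          replace x with 1 by ring end.
        rewrite pow1. ring. }
    (* |1 - t + i t tau|^2 = 1 - t (2 - t (1 + tau^2)), so for 0 < t < 1 / (1 + tau^2) the point z0
       + t e stays in the disc |z| <= |z0| and away from 0. *)
    assert (Hq : 0 < 1 + tau ^ 2) by (assert (H := pow2_ge_0 tau); lra).
    assert (HT : 0 < / (1 + tau ^ 2)) by (apply Rinv_0_lt_compat; lra).
    assert (S := derivative_sign _ _ _ HT D).
    assert (0 <= 2 * (Re ka + tau * Im ka) - 2 * INR n); [|lra].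
    apply S. intros t [Ht1 Ht2].
    rewrite U0, V0, N1.
    replace ((1 - 0) ^ 2 + (0 * tau) ^ 2) with 1 by ring. rewrite pow1, Rminus_diag.
    assert (Ht3 : t * (1 + tau ^ 2) < 1).
    { apply Rlt_le_trans with (/ (1 + tau ^ 2) * (1 + tau ^ 2)).
      - apply Rmult_lt_compat_r; lra.
      - right; field; lra. }
    assert (Tau := pow2_ge_0 tau).
    set (zt := (z0 + t * e)%C) in *.
    assert (Nz : Cmod zt ^ 2 = Cmod z0 ^ 2 * ((1 - t) ^ 2 + (t * tau) ^ 2)).
    { replace zt with (z0 * ((1 - t)%R, (t * tau)%R))%C.
      - rewrite Cmod_mult, Rpow_mult_distr, (Cmod2_alt (_, _)). reflexivity.
      - unfold zt, e. destruct z0 as [x y]. apply injective_projections; simpl; ring. }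
    assert (Ht4 : t < 1) by nra.
    assert (P : 0 < (1 - t) ^ 2 + (t * tau) ^ 2 <= 1).
    { split; [assert (H1 := pow2_ge_0 (t * tau)); assert (0 < (1 - t) ^ 2) by (apply pow_lt; lra); lra|].
      replace ((1 - t) ^ 2 + (t * tau) ^ 2) with (1 - t * (2 - t * (1 + tau ^ 2))) by ring.
      nra. }
    assert (Hz2 : 0 < Cmod z0 ^ 2) by (apply pow_lt; auto).
    assert (Bz : 0 < Cmod zt <= Cmod z0).
    { split.
      - destruct (Cmod_ge_0 zt) as [Hp|Hp]; auto. rewrite <- Hp in Nz. nra.
      - apply Rsqr_incr_0; [|apply Cmod_ge_0|lra]. rewrite !Rsqr_pow2, Nz. nra. }
    assert (Bw := Hb zt Bz).
    change (u t) with (Re (w zt)). change (v t) with (Im (w zt)).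
    rewrite <- Cmod2_alt.
    replace ((1 - t) ^ 2 + (t * tau) ^ 2) with ((Cmod zt / Cmod z0) ^ 2)
      by (unfold Rdiv; rewrite Rpow_mult_distr, Nz, pow_inv; field; lra).
    rewrite <- pow_mult, Nat.mul_comm, pow_mult.
    assert (Cmod (w zt) ^ 2 <= ((Cmod zt / Cmod z0) ^ n) ^ 2)
      by (apply pow_incr; split; [apply Cmod_ge_0 | auto]).
    lra. }
  (* An affine function of tau that is bounded below on the whole line is constant. With a nonzero
     slope the chosen tau would give the value n - 1. *)
  assert (Hi : Im ka = 0).
  { destruct (Req_dec (Im ka) 0) as [H|H]; auto.
    assert (K := Key ((INR n - 1 - Re ka) / Im ka)).
    replace (Re ka + (INR n - 1 - Re ka) / Im ka * Im ka) with (INR n - 1) in K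
      by (field; auto). lra. }
  exists (Re ka). split.
  - assert (K := Key 0). lra.
  - destruct ka as [a b]. simpl in *. rewrite Hi. reflexivity.
Qed.

(** * Nunokawa's lemma *)

Lemma sector_slit (w : C) (c : R) :
  0 <= c < PI -> w <> RtoC 0 -> Cmod w * cos c <= Re w -> slit w.
Proof.
  intros Hc Hw H. apply Cmod_gt_0 in Hw. unfold slit.
  assert (-1 < cos c) by (rewrite <- cos_PI; apply cos_decreasing_1; lra). nra.
Qed.

Lemma carg_Re (w : C) : slit w -> Re w = Cmod w * cos (carg w).
Proof. intros H. rewrite (carg_polar w H) at 1. reflexivity. Qed.

Lemma cos_le_Rabs (x c : R) : - PI <= x <= PI -> 0 <= c <= PI ->
  cos c <= cos x -> Rabs x <= c.
Proof.
  intros Hx Hc H. apply Rnot_lt_le. intros Hlt.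
  assert (cos (Rabs x) < cos c).
  { apply cos_decreasing_1; try lra; try apply Rabs_pos; apply Rabs_le; lra. }
  assert (E : cos (Rabs x) = cos x).
  { unfold Rabs. destruct (Rcase_abs x); [apply cos_neg | auto]. }
  lra.
Qed.

Lemma cos_lt_Rabs (x c : R) : - PI <= x <= PI -> 0 <= c <= PI ->
  cos c < cos x -> Rabs x < c.
Proof.
  intros Hx Hc H. assert (Ha := cos_le_Rabs x c Hx Hc ltac:(lra)).
  destruct Ha as [Ha|Ha]; auto.
  assert (E : cos (Rabs x) = cos x).
  { unfold Rabs. destruct (Rcase_abs x); [apply cos_neg | auto]. }
  rewrite Ha in E. lra.
Qed.

Lemma Rabs_lt_cos (x c : R) : 0 <= c <= PI -> Rabs x < c -> cos c < cos x.
Proof.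
  intros Hc H.
  assert (E : cos (Rabs x) = cos x).
  { unfold Rabs. destruct (Rcase_abs x); [apply cos_neg | auto]. }
  rewrite <- E. assert (H0 := Rabs_pos x). apply cos_decreasing_1; lra.
Qed.

Lemma carg_sector (w : C) (c : R) : slit w -> 0 <= c <= PI ->
  Cmod w * cos c <= Re w -> Rabs (carg w) <= c.
Proof.
  intros Hs Hc H. assert (Hm := proj1 (Cmod_gt_0 w) (slit_neq0 w Hs)).
  assert (B := carg_bound w). apply cos_le_Rabs; try lra.
  rewrite carg_Re in H by auto. apply Rmult_le_reg_l in H; auto.
Qed.

(** W is Lipschitz at 1, so p - 1 = O(z^n) passes to W(p) - W(1). Applied to the transform in Jack's
    lemma and to the reciprocal of p. *)
Lemma comp_bound_at_0 (W p : C -> C) (n : nat) (d : C) (rho M : R) :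
  (0 < n)%nat -> 0 < rho -> cderiv W (RtoC 1) d ->
  (forall z, 0 < Cmod z < rho -> Cmod (p z - 1)%C <= M * Cmod z ^ n) ->
  exists rho' M', 0 < rho' /\
    forall z, 0 < Cmod z < rho' -> Cmod (W (p z) - W 1)%C <= M' * Cmod z ^ n.
Proof.
  intros Hn Hrho HW Hp. destruct (cderiv_lipschitz W 1 d HW) as [de [Hde HL]].
  assert (HM := Rabs_pos M).
  set (r := Rmin (Rmin rho 1) (de / (Rabs M + 1))).
  assert (r1 := Rmin_l (Rmin rho 1) (de / (Rabs M + 1))).
  assert (r2 := Rmin_r (Rmin rho 1) (de / (Rabs M + 1))).
  assert (r3 := Rmin_l rho 1). assert (r4 := Rmin_r rho 1). fold r in r1, r2.
  exists r, ((Cmod d + 1) * M). split.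
  - apply Rmin_pos; [apply Rmin_pos; lra | apply Rdiv_lt_0_compat; lra].
  - intros z Hz. assert (Hpz := Hp z ltac:(lra)).
    assert (E : (1 + (p z - 1))%C = p z) by ring.
    assert (Hs : Cmod (p z - 1)%C < de).
    { eapply Rle_lt_trans; [exact Hpz|].
      assert (Cmod z ^ n <= Cmod z).
      { destruct n; [lia|]. simpl. rewrite <- (Rmult_1_r (Cmod z)) at 3.
        apply Rmult_le_compat_l; [lra|]. rewrite <- (pow1 n). apply pow_incr. lra. }
      assert (0 <= Cmod z ^ n) by (apply pow_le; lra).
      assert (M <= Rabs M) by apply Rle_abs.
      apply Rle_lt_trans with (Rabs M * Cmod z); [nra|].
      apply Rlt_le_trans with ((Rabs M + 1) * r); [nra|].
      apply Rle_trans with ((Rabs M + 1) * (de / (Rabs M + 1))).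
      - apply Rmult_le_compat_l; lra.
      - right; field; lra. }
    assert (HLz := HL _ Hs). rewrite E in HLz.
    eapply Rle_trans; [exact HLz|]. rewrite Rmult_assoc.
    apply Rmult_le_compat_l; [assert (H := Cmod_ge_0 d); lra | auto].
Qed.

Lemma Cmod_le_of_sq (x y : C) : Cmod x ^ 2 <= Cmod y ^ 2 -> Cmod x <= Cmod y.
Proof.
  intros H. apply Rsqr_incr_0; try apply Cmod_ge_0. rewrite !Rsqr_pow2; auto.
Qed.

(* The transform [w = (q - 1) / (q + 1)] of [q = p ^ (1/b)] satisfies Jack's lemma at [z0]. *)
Lemma nunokawa_upper (p : C -> C) (n : nat) (b : R) (z0 d : C) (rho M : R) :
  (0 < n)%nat -> 0 < b < 2 -> 0 < rho -> z0 <> RtoC 0 ->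
  (forall z, Cmod z <= Cmod z0 -> p z <> RtoC 0 /\ Cmod (p z) * cos (PI / 2 * b) <= Re (p z)) ->
  (forall z, Cmod z <= Cmod z0 -> cderiv2 p z) ->
  (forall z, 0 < Cmod z < rho -> Cmod (p z - 1)%C <= M * Cmod z ^ n) ->
  cderiv p z0 d ->
  Re (p z0) = Cmod (p z0) * cos (PI / 2 * b) -> 0 <= Im (p z0) ->
  exists a k : R, 0 < a /\ INR n * ((a + / a) / 2) <= k /\
    p z0 = (Rpower a b * cos (PI / 2 * b), Rpower a b * sin (PI / 2 * b)) /\
    (z0 * d / p z0)%C = (0, b * k).
Proof.
  intros Hn Hb Hrho Hz0 Hsec Hp2 Hp1 Hd HRe HIm.
  assert (Hpi := PI_RGT_0).
  set (c := PI / 2 * b) in *.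
  assert (Hc : 0 < c < PI) by (unfold c; nra).
  destruct (Hsec z0 ltac:(lra)) as [Hp0 _].
  set (L := Cmod (p z0)) in *. assert (HL : 0 < L) by (apply Cmod_gt_0; auto).
  assert (Hpol : p z0 = (L * cos c, L * sin c)).
  { assert (E := Cmod2_alt (p z0)). fold L in E.
    assert (Hsin : 0 < sin c) by (apply sin_gt_0; lra).
    assert (S := sin2_cos2 c). unfold Rsqr in S.
    clearbody L. destruct (p z0) as [x y]. simpl Re in *; simpl Im in *. subst x. f_equal.
    assert (E2 : Rsqr y = Rsqr (L * sin c)) by (unfold Rsqr; nra).
    apply Rsqr_inj; auto. nra. }
  (* As b < 2, the closed sector without 0 avoids the negative half-line, so the principal logarithm
     of p is differentiable on the whole closed disc. *)
  assert (Hslit : forall z, Cmod z <= Cmod z0 -> slit (p z)).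
  { intros z Hz. destruct (Hsec z Hz) as [h1 h2].
    apply (sector_slit (p z) c); auto. lra. }
  set (a := Rpower L (/ b)).
  assert (Ha : 0 < a) by apply exp_pos.
  assert (Hab : Rpower a b = L).
  { unfold a. rewrite Rpower_mult. rewrite Rinv_l by lra. apply Rpower_1; auto. }
  set (G := fun u => cexp (RtoC (/ b) * clog u)%C).
  set (W := fun u => ((G u - 1) * / (G u + 1))%C).
  assert (GRe : forall z, Cmod z <= Cmod z0 -> 0 <= Re (G (p z))).
  { intros z Hz. unfold G, cexp. rewrite re_scal_l. simpl Re.
    apply Rmult_le_pos; [left; apply exp_pos|].
    assert (B := carg_sector (p z) c (Hslit z Hz) ltac:(lra) (proj2 (Hsec z Hz))).
    replace (Im (RtoC (/ b) * clog (p z))%C) with (/ b * carg (p z)) by (simpl; ring).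
    assert (Hib : 0 < / b) by (apply Rinv_0_lt_compat; lra).
    apply Rabs_le_between in B.
    assert (/ b * c = PI / 2) by (unfold c; field; lra).
    apply cos_ge_0; nra. }
  assert (Gn1 : forall u, 0 <= Re (G u) -> (G u + 1)%C <> RtoC 0).
  { intros u Hu E. assert (E2 : Re (G u + 1)%C = 0) by (rewrite E; reflexivity).
    rewrite re_plus, re_RtoC in E2. lra. }
  assert (G2 : forall u, slit u -> cderiv2 G u).
  { intros u Hu. apply (cderiv2_comp cexp (fun u => RtoC (/ b) * clog u)%C); [apply cderiv2_cexp|].
    apply cderiv2_mult; [apply cderiv2_const | apply cderiv2_clog; auto]. }
  assert (W2 : forall u, slit u -> 0 <= Re (G u) -> cderiv2 W u).
  { intros u Hu Hre. apply cderiv2_mult.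
    - apply (cderiv2_plus G (fun _ => (- (1))%C)); [auto | apply cderiv2_const].
    - apply (cderiv2_comp Cinv (fun u => G u + 1)%C); [apply cderiv2_Cinv; auto|].
      apply cderiv2_plus; [auto | apply cderiv2_const]. }
  assert (G1 : G 1 = 1%C).
  { unfold G. rewrite clog_1. rewrite Cmult_0_r. apply cexp_0. }
  assert (W1 : W 1 = 0%C) by (unfold W; rewrite G1; ring).
  assert (Slit1 : slit 1) by (unfold slit; rewrite Cmod_1; simpl; lra).
  assert (Wd1 : exists d1, cderiv W (RtoC 1) d1).
  { apply cderiv2_cderiv, W2; auto. rewrite G1. simpl. lra. }
  destruct Wd1 as [d1 Wd1].
  destruct (comp_bound_at_0 W p n d1 rho M Hn Hrho Wd1 Hp1) as [rho' [M' [Hrho' HW']]].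
  set (w := fun z => W (p z)).
  assert (w2 : forall z, Cmod z <= Cmod z0 -> cderiv2 w z).
  { intros z Hz. apply (cderiv2_comp W p); auto. }
  assert (wb : forall z, Cmod z <= Cmod z0 -> Cmod (w z) <= 1).
  { intros z Hz. unfold w, W. assert (R := GRe z Hz). assert (N := Gn1 _ R).
    rewrite Cmod_mult, Cmod_inv by auto.
    apply Cmod_gt_0 in N.
    apply Rmult_le_reg_r with (Cmod (G (p z) + 1)%C); auto.
    rewrite Rmult_assoc, Rinv_l, Rmult_1_r, Rmult_1_l by lra.
    apply Cmod_le_of_sq. rewrite !Cmod2_alt.
    destruct (G (p z)) as [x y]. simpl in *. nra. }
  assert (Hm := proj1 (Cmod_gt_0 z0) Hz0).
  assert (Sch := schwarz_order_n w n (Cmod z0) rho' M' Hm Hrho'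
    (fun z Hz => w2 z (Rlt_le _ _ (proj2 Hz)))
    (fun z Hz => cderiv2_continuous w z (w2 z (proj2 Hz)))
    (fun z Hz => wb z (Req_le _ _ Hz))).
  assert (Sch' : forall z, 0 < Cmod z <= Cmod z0 -> Cmod (w z) <= (Cmod z / Cmod z0) ^ n).
  { apply Sch. intros z Hz. specialize (HW' z Hz). rewrite W1 in HW'.
    unfold w. replace (W (p z)) with (W (p z) - 0)%C by ring. exact HW'. }
  clear Sch.
  assert (q0 : G (p z0) = (RtoC a * Ci)%C).
  { unfold G, cexp. rewrite Hpol.
    assert (EC : Cmod (L * cos c, L * sin c) = L) by (apply Cmod_polar; lra).
    assert (EA : carg (L * cos c, L * sin c) = c) by (apply carg_of_polar; lra).
    rewrite re_scal_l.
    replace (Im (RtoC (/ b) * clog ((L * cos c)%R, (L * sin c)%R))%C)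
      with (/ b * carg ((L * cos c)%R, (L * sin c)%R)) by (simpl; ring).
    unfold clog. rewrite EC, EA. simpl Re.
    replace (/ b * c) with (PI / 2) by (unfold c; field; lra).
    rewrite cos_PI2, sin_PI2. fold (Rpower L (/ b)). fold a.
    apply injective_projections; simpl; ring. }
  set (q' := (RtoC a * Ci * (RtoC (/ b) * (/ p z0 * d)))%C).
  assert (Dq : cderiv (fun z => G (p z)) z0 q').
  { unfold q'. rewrite <- q0. unfold G.
    apply (cderiv_comp cexp (fun z => RtoC (/ b) * clog (p z))%C); [apply cderiv_cexp|].
    apply cderiv_scal. apply (cderiv_comp clog p); auto.
    apply cderiv_clog, Hslit; lra. }
  assert (N0 : (RtoC a * Ci + 1)%C <> RtoC 0).
  { rewrite <- q0. apply Gn1, GRe. lra. }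
  assert (N1 : (RtoC a * Ci - 1)%C <> RtoC 0).
  { intros E. assert (E2 : Re (a * Ci - 1)%C = 0) by (rewrite E; reflexivity).
    simpl in E2. lra. }
  set (dw := (2 * q' / ((RtoC a * Ci + 1) * (RtoC a * Ci + 1)))%C).
  assert (Dw : cderiv w z0 dw).
  { apply (cderiv_ext (fun z => (G (p z) - 1) * / (G (p z) + 1))%C w z0
      ((q' - 0) * / (G (p z0) + 1) + (G (p z0) - 1)
         * (- (q' + 0) / ((G (p z0) + 1) * (G (p z0) + 1))))%C).
    - reflexivity.
    - rewrite q0. unfold dw. field. auto.
    - apply (cderiv_mult (fun z => G (p z) - 1)%C (fun z => / (G (p z) + 1))%C).
      + apply (cderiv_minus (fun z => G (p z)) (fun _ => RtoC 1)); [auto | apply cderiv_const].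
      + apply (cderiv_inv (fun z => G (p z) + 1)%C); [rewrite q0; auto|].
        apply (cderiv_plus (fun z => G (p z)) (fun _ => RtoC 1)); [auto | apply cderiv_const]. }
  assert (Ew : w z0 = ((RtoC a * Ci - 1) / (RtoC a * Ci + 1))%C)
    by (unfold w, W; rewrite q0; reflexivity).
  assert (Mw : Cmod (w z0) = 1).
  { rewrite Ew, Cmod_div by auto.
    assert (E : Cmod (a * Ci - 1)%C = Cmod (a * Ci + 1)%C).
    { apply Rle_antisym; apply Cmod_le_of_sq; rewrite !Cmod2_alt; right; simpl; ring. }
    rewrite E. field. apply Rgt_not_eq, Cmod_gt_0. auto. }
  destruct (jack w z0 dw n Hz0 Dw Mw Sch') as [k' [Hk' Ek]].
  (* For q = p^(1/b) and w = (q - 1) / (q + 1) one has z w'/w = 2 z q' / (q^2 - 1), hence z q'/q =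
     k' (q^2 - 1) / (2 q). At q = i a this is i k' (a + 1/a) / 2, and z p'/p = b z q'/q. *)
  exists a, (k' * ((a + / a) / 2)). split; [auto|]. split; [|split].
  - apply Rmult_le_compat_r; auto.
    assert (0 < / a) by (apply Rinv_0_lt_compat; auto). lra.
  - rewrite Hab. exact Hpol.
  - assert (Na : RtoC a <> RtoC 0) by (intros E; apply RtoC_inj in E; lra).
    assert (Nb : RtoC b <> RtoC 0) by (intros E; apply RtoC_inj in E; lra).
    assert (NCi : Ci <> RtoC 0) by (apply Cmod_pos_neq0; rewrite Cmod_Ci; lra).
    assert (E : (z0 * d / p z0)%C
                = (z0 * dw / w z0 * (RtoC b * ((RtoC a * Ci - 1) * (RtoC a * Ci + 1)) / (2 * (RtoC a * Ci))))%C).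
    { rewrite Ew. unfold dw, q'. rewrite RtoC_inv by lra.
      assert (N2 : RtoC 2 <> RtoC 0) by (intros E; apply RtoC_inj in E; lra).
      field. repeat split; auto. }
    rewrite E, Ek.
    replace (RtoC b * ((RtoC a * Ci - 1) * (RtoC a * Ci + 1)) / (2 * (RtoC a * Ci)))%C
      with (RtoC (b * ((a + / a) / 2)) * Ci)%C.
    + apply injective_projections; simpl; ring.
    + replace ((RtoC a * Ci - 1) * (RtoC a * Ci + 1))%C with (- (RtoC a * RtoC a + 1))%C
        by (apply injective_projections; simpl; ring).
      unfold Cdiv.
      replace (/ (2 * (RtoC a * Ci)))%C with (RtoC (/ (2 * a)) * - Ci)%C.
      * apply injective_projections; simpl; field; lra.
      * rewrite <- Ci_inv, RtoC_inv, RtoC_mult by lra. field. auto.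
Qed.

(** The lower ray is reduced to the upper one through 1/p, which negates arguments, preserves the
    sector and is again differentiable, as conjugation would not be. It replaces a by 1/a, leaving a
    + 1/a unchanged. *)
Lemma nunokawa (p : C -> C) (n : nat) (b : R) (z0 d : C) (rho M : R) :
  (0 < n)%nat -> 0 < b < 2 -> 0 < rho -> z0 <> RtoC 0 ->
  (forall z, Cmod z <= Cmod z0 -> p z <> RtoC 0 /\ Cmod (p z) * cos (PI / 2 * b) <= Re (p z)) ->
  (forall z, Cmod z <= Cmod z0 -> cderiv2 p z) ->
  (forall z, 0 < Cmod z < rho -> Cmod (p z - 1)%C <= M * Cmod z ^ n) ->
  cderiv p z0 d ->
  Re (p z0) = Cmod (p z0) * cos (PI / 2 * b) ->
  exists a k s : R, 0 < a /\ INR n * ((a + / a) / 2) <= k /\ (s = 1 \/ s = -1) /\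
    p z0 = (Rpower a b * cos (PI / 2 * b), s * (Rpower a b * sin (PI / 2 * b))) /\
    (z0 * d / p z0)%C = (0, s * (b * k)).
Proof.
  intros Hn Hb Hrho Hz0 Hsec Hp2 Hp1 Hd HRe.
  destruct (Rle_dec 0 (Im (p z0))) as [HIm|HIm].
  - destruct (nunokawa_upper p n b z0 d rho M Hn Hb Hrho Hz0 Hsec Hp2 Hp1 Hd HRe HIm)
      as [a [k [Ha [Hk [E1 E2]]]]].
    exists a, k, 1. rewrite !Rmult_1_l. tauto.
  - set (P := fun z => (/ p z)%C).
    assert (Hp0 := proj1 (Hsec z0 ltac:(lra))).
    assert (Hm : forall z, p z <> RtoC 0 -> Cmod (P z) = / Cmod (p z))
      by (intros; apply Cmod_inv; auto).
    assert (HR : forall z, p z <> RtoC 0 -> Re (P z) = Re (p z) * / Cmod (p z) ^ 2).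
    { intros z Hz. apply Cmod_gt_0 in Hz. unfold P. rewrite Cmod2_alt.
      destruct (p z) as [x y]. reflexivity. }
    assert (HI : Im (P z0) = - Im (p z0) * / Cmod (p z0) ^ 2).
    { unfold P. rewrite Cmod2_alt. destruct (p z0) as [x y]. reflexivity. }
    assert (H1 : cderiv Cinv (RtoC 1) (- / (1 * 1))%C)
      by (apply cderiv_Cinv; intros E; apply RtoC_inj in E; lra).
    destruct (comp_bound_at_0 Cinv p n _ rho M Hn Hrho H1 Hp1) as [rho' [M' [Hrho' HW']]].
    destruct (nunokawa_upper P n b z0 (- d / (p z0 * p z0))%C rho' M')
      as [a [k [Ha [Hk [E1 E2]]]]]; auto.
    + intros z Hz. destruct (Hsec z Hz) as [h1 h2]. split.
      * apply Cmod_pos_neq0. rewrite Hm by auto. apply Rinv_0_lt_compat, Cmod_gt_0; auto.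
      * rewrite Hm, HR by auto. apply Cmod_gt_0 in h1.
        apply Rmult_le_reg_r with (Cmod (p z) ^ 2); [apply pow_lt; auto|].
        field_simplify; lra.
    + intros z Hz. destruct (Hsec z Hz) as [h1 h2].
      apply (cderiv2_comp Cinv p); [apply cderiv2_Cinv|]; auto.
    + intros z Hz. specialize (HW' z Hz).
      replace (/ 1)%C with (RtoC 1) in HW' by (apply injective_projections; simpl; field).
      exact HW'.
    + apply cderiv_inv; auto.
    + rewrite Hm, HR, HRe by auto. field. apply Rgt_not_eq, Cmod_gt_0; auto.
    + rewrite HI. apply Rmult_le_pos; [lra|]. left; apply Rinv_0_lt_compat.
      apply pow_lt, Cmod_gt_0; auto.
    + exists (/ a), k, (-1).
      assert (Hia : 0 < / a) by (apply Rinv_0_lt_compat; auto).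
      assert (HLP : 0 < Rpower a b) by apply exp_pos.
      assert (Hpow : Rpower (/ a) b = / Rpower a b).
      { unfold Rpower. rewrite ln_Rinv by auto. rewrite <- exp_Ropp. f_equal; ring. }
      split; [auto|]. split; [rewrite Rinv_inv, (Rplus_comm (/ a)); auto|].
      split; [auto|]. split.
      * replace (p z0) with (/ P z0)%C by (unfold P; field; auto).
        rewrite E1, Hpow. set (L := Rpower a b) in *. set (c := PI / 2 * b).
        assert (S := sin2_cos2 c). unfold Rsqr in S.
        assert (E : (L * cos c) ^ 2 + (L * sin c) ^ 2 = L ^ 2)
          by (transitivity (L ^ 2 * (sin c * sin c + cos c * cos c)); [ring | rewrite S; ring]).
        unfold Cinv. simpl fst; simpl snd. rewrite E.
        apply injective_projections; simpl; field; lra.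
      * replace (z0 * d / p z0)%C with (- (z0 * (- d / (p z0 * p z0)) / P z0))%C
          by (unfold P; field; auto).
        rewrite E2. apply injective_projections; simpl; ring.
Qed.

(** * First exit from a sector *)

Lemma rcontinuous_sector (p : C -> C) (c : R) (z : C) :
  ccontinuous p z -> rcontinuous (fun z => Re (p z) - Cmod (p z) * cos c) z.
Proof.
  intros H.
  apply (continuous_minus (K := R_AbsRing) (V := R_NormedModule)
           (fun z : C_UniformSpace => Re (p z)) (fun z => Cmod (p z) * cos c)).
  - apply (continuous_comp (p : C_UniformSpace -> C_UniformSpace) Re); auto.
    apply rcontinuous_Re.
  - apply (continuous_comp (p : C_UniformSpace -> C_UniformSpace) (fun y => Cmod y * cos c)); auto.
    apply (continuous_comp (Cmod : C_UniformSpace -> R_UniformSpace) (fun x => x * cos c)).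
    + apply rcontinuous_Cmod.
    + apply (ex_derive_continuous (V := R_NormedModule) (fun x : R => x * cos c)).
      auto_derive; auto.
Qed.

(** z0 has the least modulus among the points where the strict inequality fails. On the circle
    through z0 the weak inequality is obtained by approaching each point along its radius. A zero of
    p also counts as an exit, both sides of the equality being 0 there. *)
Lemma first_exit (p : C -> C) (c : R) :
  0 < c < PI -> p 0 = 1%C -> (forall z, in_U z -> ccontinuous p z) ->
  (exists z, in_U z /\ Re (p z) <= Cmod (p z) * cos c) ->
  exists z0, 0 < Cmod z0 < 1 /\
    (forall z, Cmod z < Cmod z0 -> Cmod (p z) * cos c < Re (p z)) /\
    (forall z, Cmod z <= Cmod z0 -> Cmod (p z) * cos c <= Re (p z)) /\
    Re (p z0) = Cmod (p z0) * cos c.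
Proof.
  intros Hc H0 Hcont [z1 [Hz1 Hb1]]. unfold in_U in *.
  set (F := fun z => Re (p z) - Cmod (p z) * cos c).
  assert (FC : forall z, Cmod z < 1 -> rcontinuous F z)
    by (intros; apply rcontinuous_sector; auto).
  destruct (compact_max (fun z => Cmod z <= Cmod z1 /\ F z <= 0) (fun z => - Cmod z) (Cmod z1))
    as [z0 [[K1 K2] Kmax]].
  - exists z1. unfold F. lra.
  - tauto.
  - intros z Hz.
    assert (Hzz : Cmod z <= Cmod z1).
    { apply le_epsilon; intros eps He. destruct (Hz eps He) as [y [[Hy1 _] Hy2]].
      assert (a := Cmod_triangle_rev z y). rewrite Cmod_minus_sym in a. lra. }
    split; auto. apply le_epsilon; intros eps He.
    destruct (proj1 (rcontinuous_iff _ _) (FC z ltac:(lra)) eps He) as [d [Hd D]].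
    destruct (Hz d Hd) as [y [[_ Hy1] Hy2]]. specialize (D _ Hy2).
    replace (z + (y - z))%C with y in D by ring. apply Rabs_lt_between in D. lra.
  - intros z _. apply (continuous_opp (K := R_AbsRing) (V := R_NormedModule)
      (fun z : C_UniformSpace => Cmod z)). apply rcontinuous_Cmod.
  - assert (Hlt : forall z, Cmod z < Cmod z0 -> Cmod (p z) * cos c < Re (p z)).
    { intros z Hz. apply Rnot_le_lt. intros Hle.
      assert (a := Kmax z ltac:(unfold F; lra)). lra. }
    assert (Hpos : 0 < Cmod z0).
    { destruct (Cmod_ge_0 z0) as [H|H]; auto. symmetry in H. apply Cmod_eq_0 in H.
      unfold F in K2. rewrite H, H0, Cmod_1 in K2. simpl in K2.
      assert (cos c < cos 0) by (apply cos_decreasing_1; lra). rewrite cos_0 in *. lra. }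
    assert (Hle : forall z, Cmod z <= Cmod z0 -> Cmod (p z) * cos c <= Re (p z)).
    { intros z Hz. apply Rnot_lt_le. intros Hn.
      assert (HF : 0 < - F z) by (unfold F; lra).
      destruct (proj1 (rcontinuous_iff _ _) (FC z ltac:(lra)) (- F z) HF) as [d [Hd D]].
      set (t := Rmin (d / 2) (/ 2)).
      assert (t1 : t <= d / 2) by apply Rmin_l. assert (t2 : t <= / 2) by apply Rmin_r.
      assert (t0 : 0 < t) by (apply Rmin_pos; lra).
      assert (Hm : Cmod (- (RtoC t * z))%C = t * Cmod z)
        by (rewrite Cmod_opp, Cmod_mult, Cmod_R, Rabs_pos_eq; lra).
      assert (Hz1' := Cmod_ge_0 z).
      specialize (D (- (RtoC t * z))%C ltac:(rewrite Hm; nra)).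
      assert (Hs : Cmod (z + - (RtoC t * z))%C = (1 - t) * Cmod z).
      { replace (z + - (RtoC t * z))%C with (RtoC (1 - t) * z)%C
          by (apply injective_projections; simpl; ring).
        rewrite Cmod_mult, Cmod_R, Rabs_pos_eq; lra. }
      destruct (Req_dec (Cmod z) 0) as [E|E].
      - specialize (Hlt z ltac:(lra)). lra.
      - specialize (Hlt (z + - (RtoC t * z))%C ltac:(rewrite Hs; nra)).
        apply Rabs_lt_between in D. unfold F in D at 2. unfold F in *. lra. }
    exists z0. split; [lra|]. split; [auto|]. split; [auto|].
    specialize (Hle z0 ltac:(lra)). unfold F in K2. lra.
Qed.

(** A stands for the argument of z0 p'(z0) at a zero z0 of p. A small step in the direction - z0
    e^(- i tau), which points into the disc for |tau| < PI/2, gives p the argument A + PI - tau to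
    first order. The conclusion says that this value lies outside the closed sector of half-opening
    c. *)
Lemma escape_direction (A c : R) : 0 < c < PI -> Rabs A < PI -> Rabs A + c < 3 * (PI / 2) ->
  exists tau, - (PI / 2) < tau < PI / 2 /\ - cos (A - tau) < cos c.
Proof.
  assert (P : forall A, 0 < c < PI -> 0 <= A < PI -> A + c < 3 * (PI / 2) ->
    exists tau, - (PI / 2) < tau < PI / 2 /\ - cos (A - tau) < cos c).
  { clear A. intros A Hc HA HAc.
    destruct (Rlt_dec A (PI / 2)) as [H|H].
    - exists A. split; [lra|]. rewrite Rminus_diag, cos_0.
      assert (-1 < cos c) by (rewrite <- cos_PI; apply cos_decreasing_1; lra). lra.
    - set (lo := Rmax 0 (c - PI + A)).
      assert (l1 : 0 <= lo) by apply Rmax_l. assert (l2 : c - PI + A <= lo) by apply Rmax_r.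
      assert (l3 : lo < PI / 2) by (apply Rmax_lub_lt; lra).
      exists ((lo + PI / 2) / 2). split; [lra|].
      rewrite <- Rtrigo_facts.cos_pi_minus. apply cos_decreasing_1; lra. }
  intros Hc HA HAc. unfold Rabs in *. destruct (Rcase_abs A).
  - destruct (P (- A)) as [tau [Ht1 Ht2]]; try lra.
    exists (- tau). split; [lra|].
    replace (A - - tau) with (- (- A - tau)) by ring. rewrite cos_neg. auto.
  - apply P; lra.
Qed.

(* At a zero [z0], [p] is conformal with derivative [d <> 0], so it maps the disc near [z0] onto
   a half plane, which does not fit into the sector. *)
Lemma exit_neq0 (p : C -> C) (z0 d : C) (b c : R) :
  0 < c < PI -> 0 <= b <= PI -> b + c <= 3 * (PI / 2) ->
  z0 <> RtoC 0 -> cderiv p z0 d ->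
  (forall z, Cmod z < Cmod z0 -> Cmod (p z) * cos c < Re (p z)) ->
  Cmod (p z0 + z0 * d)%C * cos b < Re (p z0 + z0 * d)%C ->
  p z0 <> RtoC 0.
Proof.
  intros Hc Hb Hbc Hz0 Hd Hsec Hg Hp0. rewrite Hp0, Cplus_0_l in Hg.
  set (g := (z0 * d)%C) in *.
  assert (Hgn : g <> RtoC 0).
  { intros E. rewrite E, Cmod_0 in Hg. simpl in Hg. lra. }
  assert (Hgm := proj1 (Cmod_gt_0 g) Hgn).
  assert (Hs : slit g).
  { unfold slit. assert (B := COS_bound b). nra. }
  assert (Bc := carg_bound g).
  assert (HA : Rabs (carg g) < b).
  { apply cos_lt_Rabs; try lra. rewrite (carg_Re g Hs) in Hg.
    apply Rmult_lt_reg_l in Hg; auto. }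
  destruct (escape_direction (carg g) c Hc) as [tau [Ht1 Ht2]]; [apply Rabs_def1; lra | lra |].
  assert (Hcos : 0 < cos tau) by (apply cos_gt_0; lra).
  set (eta := (cos tau, - sin tau) : C).
  assert (HRg : Re (g * eta)%C = Cmod g * cos (carg g - tau)).
  { rewrite (carg_polar g Hs) at 1. rewrite cos_minus. unfold eta. simpl. ring. }
  assert (Heta : Cmod eta = 1).
  { replace eta with (1 * cos (- tau), 1 * sin (- tau))
      by (rewrite cos_neg, sin_neg; unfold eta; f_equal; ring).
    apply Cmod_polar; lra. }
  (* The margin by which the first-order term leaves the sector. The remainder r enters both through
     Re P and through |P|, so bounding it by a quarter of t |g| mu is enough. *)
  set (mu := cos (carg g - tau) + cos c).
  assert (Hmu : 0 < mu) by (unfold mu; lra).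
  assert (Hm := proj1 (Cmod_gt_0 z0) Hz0).
  set (e := Cmod g * mu / (4 * Cmod z0)).
  assert (He : 0 < e) by (apply Rdiv_lt_0_compat; [apply Rmult_lt_0_compat|]; lra).
  destruct (proj1 (cderiv_iff _ _ _) Hd e He) as [de [Hde D]].
  (* t <= cos tau gives |1 - t eta|^2 = 1 - 2 t cos tau + t^2 < 1, so z0 + h is strictly inside; the
     other bound gives |h| <= de / 2. *)
  set (t := Rmin (cos tau) (de / (2 * Cmod z0))).
  assert (t1 : t <= cos tau) by apply Rmin_l.
  assert (t2 : t <= de / (2 * Cmod z0)) by apply Rmin_r.
  assert (t0 : 0 < t) by (apply Rmin_pos; [auto | apply Rdiv_lt_0_compat; lra]).
  set (h := (- (RtoC t * (z0 * eta)))%C).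
  assert (Hh : Cmod h = t * Cmod z0).
  { unfold h. rewrite Cmod_opp, !Cmod_mult, Cmod_R, Heta, Rabs_pos_eq; lra. }
  assert (Dh : Cmod (p (z0 + h) - p z0 - d * h)%C <= e * Cmod h).
  { apply D. rewrite Hh. apply Rle_lt_trans with (de / (2 * Cmod z0) * Cmod z0).
    - apply Rmult_le_compat_r; lra.
    - replace (de / (2 * Cmod z0) * Cmod z0) with (de / 2) by (field; lra). lra. }
  assert (Hin : Cmod (z0 + h)%C < Cmod z0).
  { replace (z0 + h)%C with (z0 * (1 - t * cos tau, t * sin tau)%R)%C.
    - rewrite Cmod_mult.
      assert (Cmod (1 - t * cos tau, t * sin tau) < 1); [|nra].
      apply Rsqr_incrst_0; [|apply Cmod_ge_0|lra]. rewrite !Rsqr_pow2, Cmod2_alt.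
      simpl Re; simpl Im. assert (S := sin2_cos2 tau). unfold Rsqr in S.
      replace ((1 - t * cos tau) ^ 2 + (t * sin tau) ^ 2)
        with (1 - 2 * t * cos tau + t ^ 2 * (sin tau * sin tau + cos tau * cos tau)) by ring.
      rewrite S. nra.
    - unfold h, eta. destruct z0. apply injective_projections; simpl; ring. }
  specialize (Hsec _ Hin).
  rewrite Hp0 in Dh. set (P := p (z0 + h)%C) in *.
  set (r := (P - 0 - d * h)%C) in *.
  assert (EP : P = (- (RtoC t * (g * eta)) + r)%C) by (unfold r, h, g; ring).
  assert (Mg : Cmod (- (RtoC t * (g * eta)))%C = t * Cmod g).
  { rewrite Cmod_opp, !Cmod_mult, Cmod_R, Heta, Rabs_pos_eq; lra. }
  assert (MP : Rabs (Cmod P - t * Cmod g) <= Cmod r).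
  { rewrite <- Mg, EP. set (q := (- (RtoC t * (g * eta)))%C).
    assert (a1 := Cmod_triangle q r). assert (a2 := Cmod_triangle_rev' q r).
    apply Rabs_le. lra. }
  assert (RP : Re P <= - (t * (Cmod g * cos (carg g - tau))) + Cmod r).
  { rewrite EP, re_plus, re_opp, re_scal_l, HRg. assert (a := re_le_Cmod r).
    apply Rabs_le_between in a. lra. }
  assert (Bc2 := COS_bound c). apply Rabs_le_between in MP.
  assert (Cmod P * cos c >= t * Cmod g * cos c - Cmod r).
  { assert (0 <= Cmod r) by apply Cmod_ge_0. nra. }
  rewrite Hh in Dh.
  replace (e * (t * Cmod z0)) with (t * Cmod g * mu / 4) in Dh by (unfold e; field; lra).
  assert (0 < t * Cmod g * mu) by (repeat apply Rmult_lt_0_compat; lra).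
  unfold mu in *. nra.
Qed.

(** The arc from x to 2 PI - x is what the open sector |arg| < x leaves of the circle. The arguments
    found at an exit may exceed PI, and monotonicity on [0, PI] alone would not cover them. *)
Lemma cos_le_wrap (x y : R) : 0 <= x <= y -> y <= 2 * PI - x -> cos y <= cos x.
Proof.
  intros H1 H2. destruct (Rle_dec y PI).
  - destruct (Req_dec x y) as [->|]; [lra|]. left. apply cos_decreasing_1; lra.
  - replace (cos y) with (cos (2 * PI - y))
      by (rewrite cos_minus, cos_2PI, sin_2PI; ring).
    destruct (Req_dec x (2 * PI - y)) as [->|]; [lra|]. left. apply cos_decreasing_1; lra.
Qed.

Lemma polar_exists (x y : R) : 0 < x ->
  exists r, 0 < r /\ x = r * cos (atan (y / x)) /\ y = r * sin (atan (y / x)).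
Proof.
  intros Hx. set (u := y / x).
  assert (H : 0 < 1 + Rsqr u) by (assert (H := Rle_0_sqr u); lra).
  assert (Hs := sqrt_lt_R0 _ H).
  exists (x * sqrt (1 + Rsqr u)). split; [apply Rmult_lt_0_compat; auto|].
  rewrite cos_atan, sin_atan. set (S := sqrt (1 + Rsqr u)) in *. clearbody S.
  split; [field; lra|]. unfold u. field; lra.
Qed.

Lemma amgm_inv (a : R) : 0 < a -> 1 <= (a + / a) / 2.
Proof.
  intros Ha. replace ((a + / a) / 2) with (1 + (a - 1) ^ 2 / (2 * a)) by (field; lra).
  assert (0 <= (a - 1) ^ 2 / (2 * a)); [|lra].
  apply Rdiv_le_0_compat; [apply pow2_ge_0 | lra].
Qed.

(** The condition alpha + beta <= 3 acts twice. It excludes an exit through 0, and it keeps the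
    argument c + psi < c + PI/2 of p + zp' at the exit below 2 PI - a', so that this value has not
    turned round the circle back into the sector of p + zp'. *)
Lemma arg_step (p p1 : C -> C) (n : nat) (alpha beta rho M : R) :
  (0 < n)%nat -> 0 < beta < 2 -> 0 < rho ->
  alpha = beta + 2 / PI * atan (INR n * beta) -> alpha <= 2 -> alpha + beta <= 3 ->
  p 0 = 1%C ->
  (forall z, in_U z -> cderiv2 p z) -> (forall z, in_U z -> cderiv p z (p1 z)) ->
  (forall z, 0 < Cmod z < rho -> Cmod (p z - 1)%C <= M * Cmod z ^ n) ->
  (forall z, in_U z ->
     Cmod (p z + z * p1 z)%C * cos (PI / 2 * alpha) < Re (p z + z * p1 z)%C) ->
  forall z, in_U z -> Cmod (p z) * cos (PI / 2 * beta) < Re (p z).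
Proof.
  intros Hn Hb Hrho Hab Ha2 Hab3 H0 H2 H1 Hbd Hg z Hz.
  assert (Hpi := PI_RGT_0). apply Rnot_le_lt. intros Hle.
  assert (Hnb : 0 < INR n * beta) by (apply Rmult_lt_0_compat; [apply lt_0_INR; auto | lra]).
  assert (Hat : 0 < atan (INR n * beta)) by (rewrite <- atan_0; apply atan_increasing; auto).
  assert (Hac : PI / 2 * alpha = PI / 2 * beta + atan (INR n * beta))
    by (rewrite Hab; field; lra).
  set (c := PI / 2 * beta) in *. set (a' := PI / 2 * alpha) in *.
  assert (Hc : 0 < c < PI) by (unfold c; nra).
  assert (Ha' : 0 < a' <= PI) by (unfold a' in *; nra).
  assert (Hca : a' + c <= 3 * (PI / 2)) by (unfold a', c; nra).
  destruct (first_exit p c Hc H0) as [z0 [Hz0 [Hlt [Hle' Heq]]]].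
  { intros y Hy. apply cderiv2_continuous; auto. }
  { exists z; auto. }
  assert (Hz0n : z0 <> RtoC 0) by (apply Cmod_pos_neq0; lra).
  assert (Hnz : forall y, Cmod y <= Cmod z0 -> p y <> RtoC 0).
  { intros y Hy. destruct Hy as [Hy|Hy].
    - intros E. specialize (Hlt y Hy). rewrite E, Cmod_0 in Hlt. simpl in Hlt. lra.
    - apply (exit_neq0 p y (p1 y) a' c); try lra.
      + apply Cmod_pos_neq0. lra.
      + apply H1. unfold in_U; lra.
      + intros x Hx. apply Hlt. lra.
      + apply Hg. unfold in_U; lra. }
  destruct (nunokawa p n beta z0 (p1 z0) rho M) as [a [k [s [Ha [Hk [Hs [E1 E2]]]]]]]; auto.
  { intros y Hy. apply H2. unfold in_U; lra. }
  { apply H1. unfold in_U; lra. }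
  assert (Hg0 := Hg z0 ltac:(unfold in_U; lra)).
  assert (Hp0 := Hnz z0 ltac:(lra)).
  set (L := Rpower a beta) in *. assert (HL : 0 < L) by apply exp_pos.
  assert (Hkn : INR n <= k).
  { eapply Rle_trans; [|exact Hk]. rewrite <- (Rmult_1_r (INR n)) at 1.
    apply Rmult_le_compat_l; [apply pos_INR | apply amgm_inv; auto]. }
  destruct (polar_exists 1 (beta * k) Rlt_0_1) as [r [Hr [Er1 Er2]]].
  rewrite Rdiv_1_r in *. set (psi := atan (beta * k)) in *.
  assert (Hpsi : atan (INR n * beta) <= psi < PI / 2).
  { split; [|apply atan_bound]. unfold psi.
    assert (Hle2 : INR n * beta <= beta * k) by (rewrite (Rmult_comm _ beta); apply Rmult_le_compat_l; lra).
    destruct Hle2 as [Hlt2|Heq2]; [left; apply atan_increasing; auto | right; f_equal; auto]. }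
  assert (EG : (p z0 + z0 * p1 z0)%C
               = (L * r * cos (c + psi), s * (L * r * sin (c + psi)))).
  { replace (p z0 + z0 * p1 z0)%C with (p z0 * (1 + z0 * p1 z0 / p z0))%C by (field; auto).
    rewrite E2, E1, cos_plus, sin_plus.
    assert (Ess : s * s = 1) by (destruct Hs as [-> | ->]; ring).
    apply injective_projections; simpl; fold c.
    - transitivity (L * (cos c * (r * cos psi) - s * s * (sin c * (r * sin psi))));
        [rewrite <- Er1, <- Er2; ring | rewrite Ess; ring].
    - transitivity (s * L * (cos c * (r * sin psi) + sin c * (r * cos psi)));
        [rewrite <- Er1, <- Er2; ring | ring]. }
  assert (HM : Cmod (p z0 + z0 * p1 z0)%C = L * r).
  { rewrite EG. transitivity (Cmod (L * r * cos (c + psi), L * r * sin (c + psi)));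
      [|apply Cmod_polar, Rmult_le_pos; lra].
    apply Rle_antisym; apply Cmod_le_of_sq; rewrite !Cmod2_alt; simpl;
      destruct Hs as [-> | ->]; right; ring. }
  rewrite HM in Hg0. rewrite EG in Hg0. simpl Re in Hg0.
  assert (HLr : 0 < L * r) by (apply Rmult_lt_0_compat; auto).
  apply Rmult_lt_reg_l in Hg0; auto.
  assert (cos (c + psi) <= cos a') by (apply cos_le_wrap; lra). lra.
Qed.

(* Weighted AM-GM for [a^(1-mu) / (1+mu)] and [a^(-1-mu) / (1-mu)]. *)
Lemma mocanu_constant (a mu : R) : 0 < a -> 0 < mu < 1 ->
  / (1 - mu) * Rpower ((1 - mu) / (1 + mu)) ((1 + mu) / 2)
  <= (a + / a) / 2 * / Rpower a mu.
Proof.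
  intros Ha Hmu. unfold Rpower. set (la := ln a).
  set (l1 := ln (1 + mu)). set (l2 := ln (1 - mu)).
  assert (E0 : ln ((1 - mu) / (1 + mu)) = l2 - l1)
    by (unfold Rdiv; rewrite ln_mult, ln_Rinv by (try apply Rinv_0_lt_compat; lra); reflexivity).
  assert (Ea : a = exp la) by (unfold la; rewrite exp_ln; auto).
  assert (E1 : 1 + mu = exp l1) by (unfold l1; rewrite exp_ln; lra).
  assert (E2 : 1 - mu = exp l2) by (unfold l2; rewrite exp_ln; lra).
  rewrite E0.
  (* Logarithms of the two terms, to be weighted by (1 + mu) / 2 and (1 - mu) / 2. With these
     weights [la] cancels in the mean m, which makes the bound independent of a. *)
  set (x1 := (1 - mu) * la - l1). set (x2 := - (1 + mu) * la - l2).
  set (m := (1 + mu) / 2 * x1 + (1 - mu) / 2 * x2).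
  assert (EL : / (1 - mu) * exp ((1 + mu) / 2 * (l2 - l1)) = exp m).
  { rewrite E2 at 1. rewrite <- exp_Ropp, <- exp_plus. f_equal. unfold m, x1, x2. field. }
  assert (ER : (a + / a) / 2 * / exp (mu * la)
               = (1 + mu) / 2 * exp x1 + (1 - mu) / 2 * exp x2).
  { replace ((1 + mu) / 2 * exp x1) with (/ 2 * exp ((1 - mu) * la)).
    2:{ unfold x1. rewrite E1. unfold Rdiv.
        replace ((1 - mu) * la - l1) with ((1 - mu) * la + - l1) by ring.
        rewrite exp_plus, exp_Ropp. field. apply Rgt_not_eq, exp_pos. }
    replace ((1 - mu) / 2 * exp x2) with (/ 2 * exp (- (1 + mu) * la)).
    2:{ unfold x2. rewrite E2. unfold Rdiv.
        replace (- (1 + mu) * la - l2) with (- (1 + mu) * la + - l2) by ring.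
        rewrite exp_plus, exp_Ropp. field. apply Rgt_not_eq, exp_pos. }
    replace ((1 - mu) * la) with (la + - (mu * la)) by ring.
    replace (- (1 + mu) * la) with (- la + - (mu * la)) by ring.
    rewrite !exp_plus, !exp_Ropp, <- Ea. field.
    split; (lra || apply Rgt_not_eq, exp_pos). }
  rewrite EL, ER.
  (* The exponential lies above its tangent at m; in the weighted sum the linear terms cancel, m
     being the weighted mean of x1 and x2. *)
  assert (T : forall x, exp m * (1 + (x - m)) <= exp x).
  { intros x. replace (exp x) with (exp m * exp (x - m)) by (rewrite <- exp_plus; f_equal; ring).
    apply Rmult_le_compat_l; [left; apply exp_pos | apply exp_ineq1_le]. }
  assert (T1 := T x1). assert (T2 := T x2).
  replace (exp m) with ((1 + mu) / 2 * (exp m * (1 + (x1 - m)))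
                        + (1 - mu) / 2 * (exp m * (1 + (x2 - m))))
    by (unfold m; field).
  apply Rplus_le_compat; apply Rmult_le_compat_l; lra.
Qed.

Lemma phi_le_PI (n : nat) (mu : R) : 0 < mu <= 1 -> phi n mu <= PI / 2 * (mu + 1).
Proof.
  intros Hmu. unfold phi. assert (Hpi := PI_RGT_0).
  match goal with |- _ - atan ?x <= _ => assert (0 <= x) end.
  - assert (0 <= cos (mu * PI / 2)) by (apply cos_ge_0; nra).
    assert (0 < sin (mu * PI / 2)) by (apply sin_gt_0; nra).
    apply Rdiv_le_0_compat; auto.
    assert (0 <= INR n * mu / (1 - mu)); [|].
    (* At mu = 1 the quotient by 0 has the value 0, so the denominator in [phi] is sin (PI/2) = 1;
       the numerator cos (PI/2) is 0 and [phi n 1] is PI. *)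
    { destruct (Req_dec mu 1) as [->|].
      - rewrite Rminus_diag. unfold Rdiv. rewrite Rinv_0. lra.
      - apply Rdiv_le_0_compat; [apply Rmult_le_pos; [apply pos_INR | lra] | lra]. }
    match goal with |- 0 < _ + _ * Rpower ?x ?y => assert (0 < Rpower x y) by apply exp_pos end.
    nra.
  - match goal with |- _ - atan ?x <= _ => assert (atan 0 <= atan x) end.
    { destruct H as [H| <-]; [left; apply atan_increasing; auto | lra]. }
    rewrite atan_0 in *. lra.
Qed.

Lemma final_step (P P1 : C -> C) (n : nat) (mu rho M : R) :
  (0 < n)%nat -> 0 < mu <= 1 -> 0 < rho -> 0 <= phi n mu ->
  P 0 = 1%C ->
  (forall z, in_U z -> P z <> RtoC 0) ->
  (forall z, in_U z -> cderiv2 P z) -> (forall z, in_U z -> cderiv P z (P1 z)) ->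
  (forall z, 0 < Cmod z < rho -> Cmod (P z - 1)%C <= M * Cmod z ^ n) ->
  (forall z, in_U z ->
     Cmod (P z * P z + z * P1 z)%C * cos (phi n mu) < Re (P z * P z + z * P1 z)%C) ->
  forall z, in_U z -> Cmod (P z) * cos (PI / 2 * mu) < Re (P z).
Proof.
  intros Hn Hmu Hrho Hphi H0 Hnz H2 H1 Hbd Hg z Hz.
  assert (Hpi := PI_RGT_0). apply Rnot_le_lt. intros Hle.
  set (c := PI / 2 * mu) in *.
  assert (Hc : 0 < c <= PI / 2) by (unfold c; nra).
  assert (Hcos : 0 <= cos c) by (apply cos_ge_0; lra).
  assert (Hsin : 0 < sin c) by (apply sin_gt_0; lra).
  destruct (first_exit P c ltac:(lra) H0) as [z0 [Hz0 [Hlt [Hle' Heq]]]].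
  { intros y Hy. apply cderiv2_continuous; auto. }
  { exists z; auto. }
  assert (Hz0n : z0 <> RtoC 0) by (apply Cmod_pos_neq0; lra).
  destruct (nunokawa P n mu z0 (P1 z0) rho M) as [a [k [s [Ha [Hk [Hs [E1 E2]]]]]]]; auto; try lra.
  { intros y Hy. split; [apply Hnz; unfold in_U; lra | apply Hle'; auto]. }
  { intros y Hy. apply H2. unfold in_U; lra. }
  { apply H1. unfold in_U; lra. }
  assert (Hg0 := Hg z0 ltac:(unfold in_U; lra)).
  assert (Hp0 := Hnz z0 ltac:(unfold in_U; lra)).
  set (L := Rpower a mu) in *. assert (HL : 0 < L) by apply exp_pos.
  fold c in E1.
  assert (Hn0 : 0 < INR n) by (apply lt_0_INR; auto).
  assert (Hk0 : INR n <= k).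
  { eapply Rle_trans; [|exact Hk]. rewrite <- (Rmult_1_r (INR n)) at 1.
    apply Rmult_le_compat_l; [lra | apply amgm_inv; auto]. }
  (* At the exit, P + z P'/P = X + i s Y. Its argument is measured from the imaginary axis through
     om = arctan (X / Y), because Y > 0 always holds while X vanishes for mu = 1. *)
  set (X := L * cos c). set (Y := L * sin c + mu * k).
  assert (HX : 0 <= X) by (apply Rmult_le_pos; lra).
  assert (HY : 0 < Y).
  { assert (0 < L * sin c) by (apply Rmult_lt_0_compat; auto).
    assert (0 < mu * k) by (apply Rmult_lt_0_compat; lra). unfold Y; lra. }
  destruct (polar_exists Y X HY) as [r [Hr [Er1 Er2]]].
  set (om := atan (X / Y)) in *.
  (* The upper bound is the arctan subtracted in [phi]. After division by L it suffices that mu k /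
     L is at least the constant m, which is the lower bound for k combined with
     [mocanu_constant]. *)
  assert (Hom : 0 <= om <= PI / 2 * (mu + 1) - phi n mu).
  { assert (Hmono : forall x y, x <= y -> atan x <= atan y).
    { intros x y [h|h]; [left; apply atan_increasing; auto | right; f_equal; auto]. }
    split.
    - rewrite <- atan_0. apply Hmono. apply Rdiv_le_0_compat; auto.
    - unfold phi, om.
      match goal with |- _ <= ?u - (?u - ?v) => replace (u - (u - v)) with v by ring end.
      apply Hmono. replace (mu * PI / 2) with c by (unfold c; field).
      destruct (Req_dec mu 1) as [E|Hmu1].
      + assert (Ec : cos c = 0) by (unfold c; rewrite E, Rmult_1_r; apply cos_PI2).
        unfold X. rewrite Ec. unfold Rdiv. rewrite Rmult_0_r, !Rmult_0_l. lra.
      + assert (Hmu' : 0 < mu < 1) by lra.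
        set (m := INR n * mu / (1 - mu) * Rpower ((1 - mu) / (1 + mu)) ((1 + mu) / 2)).
        assert (Hm0 : 0 < m).
        { unfold m. apply Rmult_lt_0_compat; [apply Rdiv_lt_0_compat; [nra | lra] | apply exp_pos]. }
        assert (Hm : m <= mu * k / L).
        { assert (HC := mocanu_constant a mu Ha Hmu'). fold L in HC.
          unfold m.
          apply Rle_trans with (mu * (INR n * ((a + / a) / 2 * / L))).
          - replace (INR n * mu / (1 - mu) * Rpower ((1 - mu) / (1 + mu)) ((1 + mu) / 2))
              with (mu * (INR n * (/ (1 - mu) * Rpower ((1 - mu) / (1 + mu)) ((1 + mu) / 2))))
              by (field; lra).
            apply Rmult_le_compat_l; [lra|]. apply Rmult_le_compat_l; lra.
          - unfold Rdiv. rewrite !Rmult_assoc. apply Rmult_le_compat_l; [lra|].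
            rewrite <- !Rmult_assoc. apply Rmult_le_compat_r.
            + left; apply Rinv_0_lt_compat; auto.
            + rewrite Rmult_assoc. exact Hk. }
        replace (X / Y) with (cos c / (sin c + mu * k / L))
          by (replace (sin c + mu * k / L) with (Y / L) by (unfold Y; field; lra);
              unfold X; field; lra).
        unfold Rdiv at 1 3. apply Rmult_le_compat_l; auto.
        apply Rinv_le_contravar; lra. }
  assert (EG : (P z0 * P z0 + z0 * P1 z0)%C
               = (L * r * cos (c + (PI / 2 - om)), s * (L * r * sin (c + (PI / 2 - om))))).
  { replace (P z0 * P z0 + z0 * P1 z0)%C with (P z0 * (P z0 + z0 * P1 z0 / P z0))%C
      by (field; auto).
    rewrite E2, E1. rewrite cos_plus, sin_plus, cos_shift, sin_shift.
    assert (Ess : s * s = 1) by (destruct Hs as [-> | ->]; ring).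
    fold L. apply injective_projections; simpl.
    - transitivity (L * (cos c * X - s * s * (sin c * Y))); [unfold X, Y; ring|].
      rewrite Ess, Er1, Er2. ring.
    - transitivity (s * L * (cos c * Y + sin c * X)); [unfold X, Y; ring|].
      rewrite Er1, Er2. ring. }
  assert (HM : Cmod (P z0 * P z0 + z0 * P1 z0)%C = L * r).
  { rewrite EG. transitivity (Cmod (L * r * cos (c + (PI / 2 - om)), L * r * sin (c + (PI / 2 - om))));
      [|apply Cmod_polar, Rmult_le_pos; lra].
    apply Rle_antisym; apply Cmod_le_of_sq; rewrite !Cmod2_alt; simpl;
      destruct Hs as [-> | ->]; right; ring. }
  rewrite HM in Hg0. rewrite EG in Hg0. simpl Re in Hg0.
  assert (HLr : 0 < L * r) by (apply Rmult_lt_0_compat; auto).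
  apply Rmult_lt_reg_l in Hg0; auto.
  assert (cos (c + (PI / 2 - om)) <= cos (phi n mu)); [|lra].
  (* The angle lies between phi and c + PI/2 <= PI, and phi itself is at most c + PI/2, so the angle
     does not exceed 2 PI - phi. *)
  assert (Hp := phi_le_PI n mu Hmu).
  apply cos_le_wrap; unfold c in *; nra.
Qed.

(** * Complex power series *)

Local Notation cseries := (is_series (K := C_AbsRing) (V := C_NormedModule)).
Local Notation cpseries := (is_pseries (K := C_AbsRing) (V := C_NormedModule)).

Local Notation csum_n := (sum_n (G := C_AbelianMonoid)).
Local Notation rsum_n := (sum_n (G := R_AbelianMonoid)).

Lemma pow_n_Cpow (z : C) (k : nat) : pow_n (K := C_Ring) z k = (z ^ k)%C.
Proof. induction k; simpl; [reflexivity | rewrite IHk; reflexivity]. Qed.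

Lemma cpseries_iff (a : nat -> C) (z l : C) :
  cpseries a z l <-> cseries (fun k => z ^ k * a k)%C l.
Proof.
  unfold is_pseries. split; apply is_series_ext; intros k; rewrite <- pow_n_Cpow; reflexivity.
Qed.

Lemma cseries_eventually (u : nat -> C) (l : C) (eps : R) : 0 < eps ->
  cseries u l -> exists N, forall n, (N <= n)%nat -> Cmod (csum_n u n - l)%C < eps.
Proof.
  intros He H.
  assert (L : locally (T := C_UniformSpace) l (fun y => Cmod (y - l)%C < eps)).
  { apply locally_C_iff. exists eps; split; auto. intros h Hh.
    replace (l + h - l)%C with h by ring. auto. }
  exact (H _ L).
Qed.

Lemma cseries_plus (u v : nat -> C) (l m : C) :
  cseries u l -> cseries v m -> cseries (fun k => u k + v k)%C (l + m)%C.
Proof. exact (is_series_plus (K := C_AbsRing) (V := C_NormedModule) u v l m). Qed.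

Lemma cseries_scal (c : C) (u : nat -> C) (l : C) :
  cseries u l -> cseries (fun k => c * u k)%C (c * l)%C.
Proof. exact (is_series_scal (K := C_AbsRing) (V := C_NormedModule) c u l). Qed.

Lemma cseries_ext (u v : nat -> C) (l m : C) :
  (forall k, u k = v k) -> l = m -> cseries u l -> cseries v m.
Proof. intros E <-. apply is_series_ext; auto. Qed.

Lemma cseries_unique (u : nat -> C) (l m : C) : cseries u l -> cseries u m -> l = m.
Proof.
  apply (filterlim_locally_unique (K := C_AbsRing) (V := C_NormedModule)
           (F := eventually) (sum_n u)).
Qed.

Lemma cseries_decr (u : nat -> C) (l : C) :
  u 0%nat = RtoC 0 -> cseries (fun k => u (S k)) l -> cseries u l.
Proof.
  intros H0 H. apply (is_series_decr_1 (K := C_AbsRing) (V := C_NormedModule) u l).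
  rewrite H0. refine (cseries_ext _ _ _ _ _ _ H); auto.
  change (l = l + - 0)%C. ring.
Qed.

Lemma cseries_bound (u : nat -> C) (v : nat -> R) (l : C) (s : R) :
  (forall k, Cmod (u k) <= v k) -> cseries u l -> is_series v s -> Cmod l <= s.
Proof.
  intros Huv Hu Hv.
  assert (Hsum : forall n, Cmod (csum_n u n) <= rsum_n v n).
  { induction n.
    - rewrite !sum_O. auto.
    - rewrite !sum_Sn. eapply Rle_trans; [apply Cmod_triangle|].
      apply Rplus_le_compat; auto. }
  apply le_epsilon. intros eps He.
  destruct (cseries_eventually u l (eps / 2)) as [N1 H1]; [lra | auto |].
  assert (L : locally s (fun y => Rabs (y - s) < eps / 2)).
  { assert (He2 : 0 < eps / 2) by lra. exists (mkposreal _ He2). intros y Hy. exact Hy. }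
  destruct (Hv _ L) as [N2 H2].
  set (n := Nat.max N1 N2).
  specialize (H1 n ltac:(lia)). specialize (Hsum n).
  assert (H3 : Rabs (rsum_n v n - s) < eps / 2) by (apply H2; lia).
  apply Rabs_lt_between in H3.
  assert (a := Cmod_triangle_rev l (csum_n u n)). rewrite Cmod_minus_sym in a. lra.
Qed.

Lemma cseries_terms_bounded (u : nat -> C) (l : C) :
  cseries u l -> exists M, forall k, Cmod (u k) <= M.
Proof.
  intros H. destruct (cseries_eventually u l 1 Rlt_0_1 H) as [N HN].
  assert (F : forall m, exists M, forall k, (k <= m)%nat -> Cmod (u k) <= M).
  { induction m as [|m [M HM]].
    - exists (Cmod (u 0%nat)). intros k Hk. replace k with 0%nat by lia. lra.
    - exists (Rmax M (Cmod (u (S m)))). intros k Hk.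
      destruct (Nat.eq_dec k (S m)) as [->|]; [apply Rmax_r|].
      eapply Rle_trans; [apply HM; lia | apply Rmax_l]. }
  destruct (F (S N)) as [M HM]. exists (Rmax M 2). intros k.
  destruct (Nat.le_gt_cases k (S N)).
  - eapply Rle_trans; [apply HM; auto | apply Rmax_l].
  - eapply Rle_trans; [|apply Rmax_r]. destruct k; [lia|].
    assert (h1 := HN (S k) ltac:(lia)). assert (h2 := HN k ltac:(lia)).
    rewrite sum_Sn in h1. change (plus (csum_n u k) (u (S k))) with (csum_n u k + u (S k))%C in h1.
    replace (u (S k)) with (csum_n u k + u (S k) - l - (csum_n u k - l))%C by ring.
    eapply Rle_trans; [apply Cmod_triangle|]. rewrite Cmod_opp. lra.
Qed.

(* At least [1]: entire series are included. *)
Definition unit_radius (b : nat -> C) : Prop :=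
  forall r, 0 < r < 1 -> exists M, forall k, Cmod (b k) * r ^ k <= M.

(** Bernoulli's inequality for (y / x)^k. *)
Lemma linear_geometric (x y : R) (k : nat) : 0 < x < y ->
  INR k * x ^ k <= x / (y - x) * y ^ k.
Proof.
  intros H.
  assert (P : 1 + INR k * ((y - x) / x) <= (y / x) ^ k).
  { replace (y / x) with (1 + (y - x) / x) by (field; lra).
    assert (0 < (y - x) / x) by (apply Rdiv_lt_0_compat; lra).
    apply poly; auto. }
  assert (Hx : 0 < x ^ k) by (apply pow_lt; lra).
  replace (y ^ k) with ((y / x) ^ k * x ^ k)
    by (rewrite <- Rpow_mult_distr; f_equal; field; lra).
  rewrite <- Rmult_assoc. apply Rmult_le_compat_r; [lra|].
  apply Rmult_le_reg_l with ((y - x) / x); [apply Rdiv_lt_0_compat; lra|].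
  replace ((y - x) / x * (x / (y - x) * (y / x) ^ k)) with ((y / x) ^ k) by (field; lra).
  lra.
Qed.

Lemma unit_radius_of_sum (a : nat -> C) (f : C -> C) :
  (forall z, in_U z -> cpseries a z (f z)) -> unit_radius a.
Proof.
  intros H r Hr.
  assert (Hin : in_U (RtoC r)) by (unfold in_U; rewrite Cmod_R, Rabs_pos_eq; lra).
  destruct (cseries_terms_bounded _ _ (proj1 (cpseries_iff _ _ _) (H _ Hin))) as [M HM].
  exists M. intros k. specialize (HM k).
  rewrite Cmod_mult, Cmod_pow, Cmod_R, Rabs_pos_eq in HM by lra. lra.
Qed.

Lemma unit_radius_shift (a : nat -> C) : unit_radius a -> unit_radius (fun k => a (S k)).
Proof.
  intros H r Hr. destruct (H r Hr) as [M HM]. exists (M / r). intros k.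
  specialize (HM (S k)). simpl in HM.
  apply Rmult_le_reg_l with r; [lra|].
  replace (r * (M / r)) with M by (field; lra). lra.
Qed.

Lemma unit_radius_le (a b : nat -> C) :
  (forall k, Cmod (b k) <= Cmod (a k)) -> unit_radius a -> unit_radius b.
Proof.
  intros Hab H r Hr. destruct (H r Hr) as [M HM]. exists M. intros k.
  eapply Rle_trans; [|apply HM]. apply Rmult_le_compat_r; [apply pow_le; lra | auto].
Qed.

Definition dcoef (b : nat -> C) (k : nat) : C := (RtoC (INR (S k)) * b (S k))%C.

Lemma unit_radius_dcoef (b : nat -> C) : unit_radius b -> unit_radius (dcoef b).
Proof.
  intros H. apply (unit_radius_shift (fun k => RtoC (INR k) * b k)%C).
  (* The factor k is paid for by enlarging the radius from r to the midpoint between r and 1. *)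
  intros r Hr. destruct (H ((r + 1) / 2)) as [M HM]; [lra|].
  set (s := (r + 1) / 2) in *.
  exists (r / (s - r) * M). intros k. rewrite Cmod_mult, Cmod_R, Rabs_pos_eq by apply pos_INR.
  assert (L := linear_geometric r s k ltac:(unfold s; lra)).
  assert (Hb := Cmod_ge_0 (b k)).
  apply Rle_trans with (Cmod (b k) * (r / (s - r) * s ^ k)).
  - replace (INR k * Cmod (b k) * r ^ k) with (Cmod (b k) * (INR k * r ^ k)) by ring.
    apply Rmult_le_compat_l; auto.
  - replace (Cmod (b k) * (r / (s - r) * s ^ k)) with (r / (s - r) * (Cmod (b k) * s ^ k)) by ring.
    apply Rmult_le_compat_l; auto. apply Rdiv_le_0_compat; unfold s; lra.
Qed.

Lemma unit_radius_sum (b : nat -> C) :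
  unit_radius b -> exists g : C -> C, forall z, in_U z -> cpseries b z (g z).
Proof.
  intros H.
  apply (choice (fun z l => in_U z -> cpseries b z l)).
  intros z. destruct (classic (in_U z)) as [Hz|Hz]; [|exists (RtoC 0); tauto].
  unfold in_U in Hz. assert (Hz0 := Cmod_ge_0 z).
  destruct (H ((Cmod z + 1) / 2)) as [M HM]; [lra|].
  set (s := (Cmod z + 1) / 2) in *.
  assert (Hs : 0 < s < 1 /\ Cmod z < s) by (unfold s; lra).
  assert (Hq : 0 <= Cmod z / s < 1).
  { split; [apply Rdiv_le_0_compat; lra|]. apply Rmult_lt_reg_r with s; [lra|].
    replace (Cmod z / s * s) with (Cmod z) by (field; lra). lra. }
  destruct (ex_series_le (K := C_AbsRing) (V := C_CompleteNormedModule)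
    (fun k => z ^ k * b k)%C (fun k => M * (Cmod z / s) ^ k)) as [l Hl].
  - intros k. change (Cmod (z ^ k * b k)%C <= M * (Cmod z / s) ^ k). rewrite Cmod_mult, Cmod_pow.
    unfold Rdiv. rewrite Rpow_mult_distr, pow_inv.
    assert (Hk := HM k). assert (0 < s ^ k) by (apply pow_lt; lra).
    apply Rle_trans with (Cmod z ^ k * (M * / s ^ k)); [|right; ring].
    apply Rmult_le_compat_l; [apply pow_le; auto|].
    apply Rmult_le_reg_r with (s ^ k); auto.
    rewrite Rmult_assoc, Rinv_l, Rmult_1_r; lra.
  - apply (ex_series_scal (V := R_NormedModule) M (fun k => (Cmod z / s) ^ k)).
    apply ex_series_geom. rewrite Rabs_pos_eq; lra.
  - exists l. intros _. apply cpseries_iff. exact Hl.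
Qed.

(** A joint induction: with E the increment of the k-th power and D its second-order remainder, the
    next remainder is z D + h E. The powers of r on the left avoid the exponents k - 1 and k - 2 on
    the right, which would be truncated for small k. *)
Lemma pow_increment_bound (z h : C) (r : R) (k : nat) :
  0 < r -> Cmod z <= r -> Cmod (z + h)%C <= r ->
  r * Cmod ((z + h) ^ k - z ^ k)%C <= INR k * r ^ k * Cmod h /\
  r ^ 2 * Cmod ((z + h) ^ k - z ^ k - INR k * z ^ (Nat.pred k) * h)%C
    <= INR k ^ 2 * r ^ k * Cmod h ^ 2.
Proof.
  intros Hr Hz Hzh. assert (Hh := Cmod_ge_0 h).
  induction k as [|k [IH1 IH2]].
  - simpl. replace (1 - 1)%C with (RtoC 0) by ring.
    replace (0 - 0 * 1 * h)%C with (RtoC 0) by ring. rewrite Cmod_0. lra.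
  - set (E := ((z + h) ^ k - z ^ k)%C) in *.
    set (D := (E - INR k * z ^ (Nat.pred k) * h)%C) in *.
    assert (Hrk : 0 < r ^ k) by (apply pow_lt; auto).
    assert (Hk := pos_INR k).
    assert (Hzk : Cmod (z ^ k)%C <= r ^ k)
      by (rewrite Cmod_pow; apply pow_incr; split; [apply Cmod_ge_0 | auto]).
    assert (S1 : ((z + h) ^ S k - z ^ S k)%C = ((z + h) * E + h * z ^ k)%C)
      by (unfold E; simpl; ring).
    assert (S2 : ((z + h) ^ S k - z ^ S k - INR (S k) * z ^ (Nat.pred (S k)) * h)%C
                 = (z * D + h * E)%C).
    { rewrite S1. unfold D. rewrite S_INR, RtoC_plus. simpl Nat.pred.
      assert (Z : (INR k * z ^ k)%C = (INR k * (z * z ^ Nat.pred k))%C).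
      { destruct k; [simpl; ring | reflexivity]. }
      replace ((INR k + 1) * z ^ k * h)%C with (INR k * z ^ k * h + z ^ k * h)%C by ring.
      rewrite Z. ring. }
    rewrite S2, S1, S_INR. split.
    + eapply Rle_trans; [apply Rmult_le_compat_l; [lra | apply Cmod_triangle]|].
      rewrite !Cmod_mult.
      assert (Cmod (z + h)%C * Cmod E <= r * Cmod E)
        by (apply Rmult_le_compat_r; [apply Cmod_ge_0 | auto]).
      assert (Cmod h * Cmod (z ^ k)%C <= Cmod h * r ^ k) by (apply Rmult_le_compat_l; auto).
      apply Rle_trans with (r * (INR k * r ^ k * Cmod h + Cmod h * r ^ k));
        [apply Rmult_le_compat_l; lra | right; simpl; ring].
    + eapply Rle_trans; [apply Rmult_le_compat_l; [apply pow2_ge_0 | apply Cmod_triangle]|].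
      rewrite !Cmod_mult.
      assert (H1 : Cmod z * Cmod D <= r * Cmod D)
        by (apply Rmult_le_compat_r; [apply Cmod_ge_0 | auto]).
      apply Rle_trans with (r * (r ^ 2 * Cmod D) + r * Cmod h * (r * Cmod E)).
      * assert (0 < r ^ 2) by (apply pow_lt; auto). nra.
      * apply Rle_trans with
          (r * (INR k ^ 2 * r ^ k * Cmod h ^ 2) + r * Cmod h * (INR k * r ^ k * Cmod h)).
        { apply Rplus_le_compat; apply Rmult_le_compat_l; auto; try lra.
          apply Rmult_le_pos; lra. }
        replace ((INR k + 1) ^ 2 * r ^ S k * Cmod h ^ 2)
          with (r * (INR k ^ 2 * r ^ k * Cmod h ^ 2) + r * Cmod h * (INR k * r ^ k * Cmod h)
                + (INR k + 1) * (r * r ^ k) * Cmod h ^ 2) by (simpl; ring).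
        assert (0 <= (INR k + 1) * (r * r ^ k) * Cmod h ^ 2); [|lra].
        apply Rmult_le_pos; [|apply pow2_ge_0]. apply Rmult_le_pos; nra.
Qed.

(** The k-th remainder is at most |b k| k^2 r^(k-2) |h|^2, and |b k| <= M / t^k with r < t < 1.
    Summation leaves a constant times |h|^2, which gives the derivative directly, without uniform
    convergence. *)
Lemma cderiv_cpseries (b : nat -> C) (g g1 : C -> C) :
  (forall z, in_U z -> cpseries b z (g z)) ->
  (forall z, in_U z -> cpseries (dcoef b) z (g1 z)) ->
  forall z, in_U z -> cderiv g z (g1 z).
Proof.
  intros Hg Hg1 z Hz. assert (HU := Hz). unfold in_U in Hz. assert (Hz0 := Cmod_ge_0 z).
  set (r := (Cmod z + 1) / 2).
  set (t := (r + 1) / 2).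
  assert (Hr : Cmod z < r /\ 0 < r /\ r < t /\ t < 1) by (unfold t, r; lra).
  (* The ratios [r / t < w1 < w2 < 1] absorb the factor [k^2]. *)
  set (q := r / t).
  assert (Hq : 0 < q < 1).
  { unfold q. split; [apply Rdiv_lt_0_compat; lra|].
    apply Rmult_lt_reg_r with t; [lra|]. replace (r / t * t) with r by (field; lra). lra. }
  set (w1 := (q + 1) / 2). set (w2 := (w1 + 1) / 2).
  assert (Hw : q < w1 /\ w1 < w2 /\ w2 < 1) by (unfold w2, w1; lra).
  destruct (unit_radius_of_sum b g Hg t ltac:(lra)) as [M HM].
  assert (HM0 : 0 <= M).
  { eapply Rle_trans; [|apply (HM 0%nat)]. simpl. assert (H := Cmod_ge_0 (b 0%nat)). lra. }
  set (c1 := q / (w1 - q)). set (c2 := w1 / (w2 - w1)).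
  assert (Hc1 : 0 < c1) by (apply Rdiv_lt_0_compat; lra).
  assert (Hc2 : 0 < c2) by (apply Rdiv_lt_0_compat; lra).
  assert (Hk2 : forall k, INR k ^ 2 * q ^ k <= c1 * c2 * w2 ^ k).
  { intros k. assert (L1 := linear_geometric q w1 k ltac:(lra)).
    assert (L2 := linear_geometric w1 w2 k ltac:(lra)).
    fold c1 in L1. fold c2 in L2. assert (Hk := pos_INR k).
    apply Rle_trans with (INR k * (c1 * w1 ^ k)).
    - simpl. rewrite Rmult_1_r, Rmult_assoc. apply Rmult_le_compat_l; auto.
    - apply Rle_trans with (c1 * (INR k * w1 ^ k)); [right; ring|].
      rewrite Rmult_assoc. apply Rmult_le_compat_l; lra. }
  set (K := M * (c1 * c2) / r ^ 2).
  assert (Hr2 : 0 < r ^ 2) by (apply pow_lt; lra).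
  assert (HK : 0 <= K) by (apply Rdiv_le_0_compat; auto; apply Rmult_le_pos; auto; nra).
  assert (Q : forall h, Cmod h < r - Cmod z ->
    Cmod (g (z + h) - g z - g1 z * h)%C <= K * / (1 - w2) * Cmod h ^ 2).
  { intros h Hh.
    assert (Hzh : Cmod (z + h)%C <= r) by (eapply Rle_trans; [apply Cmod_triangle | lra]).
    assert (HUh : in_U (z + h)%C) by (unfold in_U; lra).
    assert (A1 := proj1 (cpseries_iff _ _ _) (Hg _ HUh)).
    assert (A2 := proj1 (cpseries_iff _ _ _) (Hg _ HU)).
    assert (A3 := proj1 (cpseries_iff _ _ _) (Hg1 _ HU)).
    (* The derived series moved up by one index, to line up with the series of g; the new term k = 0
       vanishes through its factor [INR 0]. *)
    assert (A4 : cseries (fun k => INR k * z ^ (Nat.pred k) * b k)%C (g1 z)).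
    { apply cseries_decr; [simpl; ring|].
      refine (cseries_ext _ _ _ _ _ eq_refl A3). intros k. unfold dcoef.
      simpl Nat.pred. ring. }
    assert (A5 := cseries_plus _ _ _ _ A1
      (cseries_plus _ _ _ _ (cseries_scal (- (1))%C _ _ A2) (cseries_scal (- h)%C _ _ A4))).
    apply (cseries_bound
      (fun k => ((z + h) ^ k - z ^ k - INR k * z ^ (Nat.pred k) * h) * b k)%C
      (fun k => (K * Cmod h ^ 2) * w2 ^ k)).
    - intros k. rewrite Cmod_mult.
      destruct (pow_increment_bound z h r k) as [_ B]; try lra.
      set (D := Cmod ((z + h) ^ k - z ^ k - INR k * z ^ Nat.pred k * h)%C) in *.
      specialize (HM k). specialize (Hk2 k).
      assert (Htk : 0 < t ^ k) by (apply pow_lt; lra).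
      assert (Eq : r ^ k = q ^ k * t ^ k)
        by (rewrite <- Rpow_mult_distr; f_equal; unfold q; field; lra).
      assert (Hb := Cmod_ge_0 (b k)). assert (Hh2 := pow2_ge_0 (Cmod h)).
      apply Rmult_le_reg_l with (r ^ 2); auto.
      replace (r ^ 2 * (K * Cmod h ^ 2 * w2 ^ k)) with (M * (c1 * c2 * w2 ^ k) * Cmod h ^ 2)
        by (unfold K; field; lra).
      apply Rle_trans with (INR k ^ 2 * r ^ k * Cmod h ^ 2 * Cmod (b k)).
      + rewrite <- Rmult_assoc. apply Rmult_le_compat_r; auto.
      + rewrite Eq.
        replace (INR k ^ 2 * (q ^ k * t ^ k) * Cmod h ^ 2 * Cmod (b k))
          with ((Cmod (b k) * t ^ k) * (INR k ^ 2 * q ^ k) * Cmod h ^ 2) by ring.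
        apply Rmult_le_compat_r; auto. apply Rmult_le_compat; auto.
        * apply Rmult_le_pos; lra.
        * apply Rmult_le_pos; [apply pow2_ge_0 | apply pow_le; lra].
    - refine (cseries_ext _ _ _ _ _ _ A5).
      + intros k. simpl. ring.
      + ring.
    - replace (K * / (1 - w2) * Cmod h ^ 2) with (K * Cmod h ^ 2 * / (1 - w2)) by ring.
      apply (is_series_scal (K := R_AbsRing) (V := R_NormedModule) (K * Cmod h ^ 2)
               (fun k => w2 ^ k)).
      apply is_series_geom. rewrite Rabs_pos_eq; lra. }
  apply cderiv_iff. intros eps He.
  set (K' := K * / (1 - w2)) in *.
  assert (HK' : 0 <= K').
  { apply Rmult_le_pos; auto. left. apply Rinv_0_lt_compat. lra. }
  exists (Rmin (r - Cmod z) (eps / (K' + 1))). split.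
  - apply Rmin_pos; [lra | apply Rdiv_lt_0_compat; lra].
  - intros h Hh.
    assert (h1 := Rmin_l (r - Cmod z) (eps / (K' + 1))).
    assert (h2 := Rmin_r (r - Cmod z) (eps / (K' + 1))).
    eapply Rle_trans; [apply Q; lra|]. assert (Hh0 := Cmod_ge_0 h).
    replace (K' * Cmod h ^ 2) with (K' * Cmod h * Cmod h) by ring.
    apply Rmult_le_compat_r; auto.
    apply Rle_trans with ((K' + 1) * (eps / (K' + 1))); [nra | right; field; lra].
Qed.

(** Boundedness at radius 3/4 gives |b j| <= M (4/3)^j, and |z| < 1/2 gives |z|^j <= |z|^n 2^n
    2^(-j) for j >= n. The products are dominated by a geometric series of ratio 2/3. *)
Lemma cpseries_order (b : nat -> C) (g : C -> C) (n : nat) :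
  (0 < n)%nat -> (forall z, in_U z -> cpseries b z (g z)) ->
  (forall k, (1 <= k < n)%nat -> b k = RtoC 0) ->
  exists M, forall z, Cmod z < / 2 -> Cmod (g z - b 0%nat)%C <= M * Cmod z ^ n.
Proof.
  intros Hn Hg Hb.
  destruct (unit_radius_of_sum b g Hg (3 / 4) ltac:(lra)) as [M HM].
  exists (M * 2 ^ n * / (1 - 2 / 3)). intros z Hz.
  assert (HU : in_U z) by (unfold in_U; lra). assert (Hz0 := Cmod_ge_0 z).
  assert (A := proj1 (cpseries_iff _ _ _) (Hg z HU)).
  assert (HM0 : 0 <= M).
  { eapply Rle_trans; [|apply (HM 0%nat)]. simpl. assert (H := Cmod_ge_0 (b 0%nat)). lra. }
  set (u := fun k => match k with O => RtoC 0 | S _ => (z ^ k * b k)%C end).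
  assert (A' : cseries u (g z - b 0%nat)%C).
  { apply cseries_decr; [reflexivity|].
    apply (is_series_incr_1 (K := C_AbsRing) (V := C_NormedModule) (fun k => z ^ k * b k)%C).
    refine (cseries_ext _ _ _ _ _ _ A); auto.
    change (g z = g z - b 0%nat + z ^ 0 * b 0%nat)%C. simpl. ring. }
  set (E := M * 2 ^ n * Cmod z ^ n).
  assert (H2n : 0 < 2 ^ n) by (apply pow_lt; lra).
  assert (Hzn : 0 <= Cmod z ^ n) by (apply pow_le; auto).
  assert (HE : 0 <= E) by (unfold E; repeat apply Rmult_le_pos; auto; lra).
  replace (M * 2 ^ n * / (1 - 2 / 3) * Cmod z ^ n) with (E * / (1 - 2 / 3))
    by (unfold E; ring).
  apply (cseries_bound u (fun k => E * (2 / 3) ^ k)); auto.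
  - intros k. assert (HEk : 0 <= E * (2 / 3) ^ k) by (apply Rmult_le_pos; auto; apply pow_le; lra).
    destruct k as [|k]; [simpl; rewrite Cmod_0; simpl in HEk; lra|].
    change (u (S k)) with (z ^ (S k) * b (S k))%C. set (j := S k) in *.
    destruct (Nat.lt_ge_cases j n) as [Hj|Hj].
    + rewrite Hb by (unfold j in *; lia). rewrite Cmult_0_r, Cmod_0. auto.
    + rewrite Cmod_mult, Cmod_pow. specialize (HM j).
      assert (Hbj := Cmod_ge_0 (b j)).
      assert (P : Cmod z ^ j <= Cmod z ^ n * 2 ^ n * (/ 2) ^ j).
      { replace j with (n + (j - n))%nat by lia. rewrite !pow_add.
        replace (Cmod z ^ n * 2 ^ n * ((/ 2) ^ n * (/ 2) ^ (j - n)))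
          with (Cmod z ^ n * ((2 * / 2) ^ n * (/ 2) ^ (j - n)))
          by (rewrite Rpow_mult_distr; ring).
        apply Rmult_le_compat_l; auto. rewrite Rinv_r, pow1, Rmult_1_l by lra.
        apply pow_incr. lra. }
      apply Rle_trans with (Cmod z ^ n * 2 ^ n * (/ 2) ^ j * Cmod (b j)).
      * apply Rmult_le_compat_r; auto.
      * replace (E * (2 / 3) ^ j) with (Cmod z ^ n * 2 ^ n * (/ 2) ^ j * (M * (4 / 3) ^ j)).
        2:{ replace (2 / 3) with (/ 2 * (4 / 3)) by field. rewrite Rpow_mult_distr. unfold E. ring. }
        apply Rmult_le_compat_l.
        { repeat apply Rmult_le_pos; auto; try lra. apply pow_le; lra. }
        apply Rmult_le_reg_r with ((3 / 4) ^ j); [apply pow_lt; lra|].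
        rewrite Rmult_assoc, <- Rpow_mult_distr.
        replace (4 / 3 * (3 / 4)) with 1 by field. rewrite pow1, Rmult_1_r. auto.
  - apply (is_series_scal (K := R_AbsRing) (V := R_NormedModule) E (fun k => (2 / 3) ^ k)).
    apply is_series_geom. rewrite Rabs_pos_eq; lra.
Qed.

Lemma cpseries_at_0 (b : nat -> C) (g : C -> C) :
  (forall z, in_U z -> cpseries b z (g z)) -> g (RtoC 0) = b 0%nat.
Proof.
  intros Hg. destruct (cpseries_order b g 1 ltac:(lia) Hg) as [M HM]; [lia|].
  specialize (HM (RtoC 0)). rewrite Cmod_0 in HM. specialize (HM ltac:(lra)).
  assert (E : Cmod (g (RtoC 0) - b 0%nat)%C = 0).
  { apply Rle_antisym; [|apply Cmod_ge_0]. simpl in HM. lra. }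
  apply Cmod_eq_0 in E.
  replace (g (RtoC 0)) with (g (RtoC 0) - b 0%nat + b 0%nat)%C by ring.
  rewrite E. ring.
Qed.

(** * The principal argument and the integral transform *)

(** The cosine and the closed range are what a bound on |arg| depends on: the cosine is even and
    decreasing on [0, PI], so [abs_arg_lt] turns into an inequality for Re w. *)
Lemma Carg_spec (w : C) : w <> RtoC 0 ->
  Re w = Cmod w * cos (Carg w) /\ - PI <= Carg w <= PI.
Proof.
  intros Hw. assert (Hpi := PI_RGT_0). destruct w as [x y]. unfold Carg. simpl Re; simpl Im.
  destruct (Rlt_dec 0 x) as [Hx|Hx].
  - assert (B := atan_bound (y / x)). split; [|lra].
    destruct (polar_exists x y Hx) as [r [Hr [E1 E2]]].
    set (t := atan (y / x)) in *. clearbody t. subst x y.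
    rewrite Cmod_polar by lra. reflexivity.
  - destruct (Rlt_dec x 0) as [Hx'|Hx'].
    + destruct (polar_exists (- x) (- y) ltac:(lra)) as [r [Hr [E1 E2]]].
      replace (- y / - x) with (y / x) in * by (field; lra).
      assert (B := atan_bound (y / x)). set (t := atan (y / x)) in *.
      assert (Hm : Cmod (x, y) = r).
      { replace (x, y) with (Copp (r * cos t, r * sin t))
          by (rewrite <- E1, <- E2; apply injective_projections; simpl; ring).
        rewrite Cmod_opp. apply Cmod_polar; lra. }
      rewrite Hm.
      destruct (Rle_dec 0 y) as [Hy|Hy].
      * assert (Ht : t <= 0).
        { unfold t. rewrite <- atan_0.
          assert (H : y / x <= 0).
          { replace (y / x) with (- (y / - x)) by (field; lra).
            assert (0 <= y / - x) by (apply Rdiv_le_0_compat; lra). lra. }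
          destruct H as [H| ->]; [left; apply atan_increasing; auto | lra]. }
        split; [|lra]. rewrite neg_cos. lra.
      * assert (Ht : 0 <= t).
        { unfold t. rewrite <- atan_0.
          assert (H : 0 < y / x).
          { replace (y / x) with (- y / - x) by (field; lra). apply Rdiv_lt_0_compat; lra. }
          left; apply atan_increasing; auto. }
        split; [|lra].
        replace (t - PI) with (- (- t + PI)) by ring. rewrite cos_neg, neg_cos, cos_neg. lra.
    + assert (x = 0) by lra. subst x.
      destruct (Rlt_dec 0 y) as [Hy|Hy]; [rewrite cos_PI2; lra|].
      destruct (Rlt_dec y 0) as [Hy'|Hy']; [rewrite cos_neg, cos_PI2; lra|].
      exfalso. apply Hw. assert (y = 0) by lra. subst y. reflexivity.
Qed.

Lemma abs_arg_lt_sector (w : C) (c : R) : 0 <= c <= PI -> abs_arg_lt w c ->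
  Cmod w * cos c < Re w.
Proof.
  intros Hc [Hw H]. destruct (Carg_spec w Hw) as [E _]. rewrite E.
  apply Rmult_lt_compat_l; [apply Cmod_gt_0; auto|]. apply Rabs_lt_cos; auto.
Qed.

Lemma sector_abs_arg_lt (w : C) (c : R) : 0 <= c <= PI ->
  Cmod w * cos c < Re w -> abs_arg_lt w c.
Proof.
  intros Hc H.
  assert (Hw : w <> RtoC 0).
  { intros E. rewrite E, Cmod_0 in H. simpl in H. lra. }
  split; auto. destruct (Carg_spec w Hw) as [E B].
  apply cos_lt_Rabs; try lra. rewrite E in H.
  apply Rmult_lt_reg_l in H; auto. apply Cmod_gt_0; auto.
Qed.

Lemma sector_polar (w : C) (c : R) : 0 <= c <= PI -> Cmod w * cos c < Re w ->
  Rabs (carg w) < c /\ w = (Cmod w * cos (carg w), Cmod w * sin (carg w)).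
Proof.
  intros Hc H.
  assert (Hw : w <> RtoC 0).
  { intros E. rewrite E, Cmod_0 in H. simpl in H. lra. }
  apply Cmod_gt_0 in Hw.
  assert (Hs : slit w) by (unfold slit; assert (B := COS_bound c); nra).
  split; [|apply carg_polar; auto].
  assert (B := carg_bound w). apply cos_lt_Rabs; try lra.
  rewrite (carg_Re w Hs) in H. apply Rmult_lt_reg_l in H; auto.
Qed.

(** The difference of the arguments of u and v is an argument of u / v, and it stays below a + b <=
    PI in absolute value, so no reduction modulo 2 PI occurs. *)
Lemma sector_div (u v : C) (a b c : R) :
  0 <= a <= PI -> 0 <= b <= PI -> a + b <= c <= PI ->
  Cmod u * cos a < Re u -> Cmod v * cos b < Re v ->
  Cmod (u / v)%C * cos c < Re (u / v)%C.
Proof.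
  intros Ha Hb Hc Hu Hv.
  destruct (sector_polar u a Ha Hu) as [Au Eu]. destruct (sector_polar v b Hb Hv) as [Av Ev].
  assert (Mu : 0 < Cmod u).
  { destruct (Cmod_ge_0 u) as [H|H]; auto. symmetry in H. apply Cmod_eq_0 in H.
    rewrite H, Cmod_0 in Hu. simpl in Hu. lra. }
  assert (Mv : 0 < Cmod v).
  { destruct (Cmod_ge_0 v) as [H|H]; auto. symmetry in H. apply Cmod_eq_0 in H.
    rewrite H, Cmod_0 in Hv. simpl in Hv. lra. }
  assert (Hvn := Cmod_pos_neq0 v Mv).
  rewrite Cmod_div by auto.
  assert (E : Re (u / v)%C = Cmod u / Cmod v * cos (carg u - carg v)).
  { assert (N := Cmod2_alt v). rewrite cos_minus.
    set (m := Cmod u) in *. set (k := Cmod v) in *.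
    set (s := carg u) in *. set (t := carg v) in *.
    clearbody m k s t. rewrite Eu, Ev. rewrite Ev in N. simpl in N.
    unfold Cdiv, Cinv, Cmult. simpl.
    replace (k * cos t * (k * cos t * 1) + k * sin t * (k * sin t * 1)) with (k * (k * 1))
      by (rewrite N; ring).
    field. lra. }
  rewrite E. apply Rmult_lt_compat_l; [apply Rdiv_lt_0_compat; auto|].
  apply Rabs_lt_cos; [lra|].
  apply Rle_lt_trans with (Rabs (carg u) + Rabs (carg v)); [|lra].
  unfold Rminus. rewrite <- (Rabs_Ropp (carg v)). apply Rabs_triang.
Qed.

(** The function z q(z) is a primitive of p, since its derivative is q + z q' = p, and p extends
    f(t) / t to t = 0. The fundamental theorem is applied on the segment to real and imaginary parts
    separately. *)
Lemma int_f_over_t_eq (f p q q1 : C -> C) :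
  (forall z, in_U z -> f z = (z * p z)%C) ->
  (forall z, in_U z -> exists d, cderiv p z d) ->
  (forall z, in_U z -> cderiv q z (q1 z)) ->
  (forall z, in_U z -> (q z + z * q1 z)%C = p z) ->
  forall z, in_U z -> int_f_over_t f z = (z * q z)%C.
Proof.
  intros Hf Hp Hq Hqp z Hz.
  assert (Hin : forall s : R, 0 <= s <= 1 -> in_U (0 + s * z)%C).
  { intros s Hs. unfold in_U in *. rewrite Cplus_0_l, Cmod_mult, Cmod_R, Rabs_pos_eq by lra.
    assert (H := Cmod_ge_0 z). nra. }
  unfold int_f_over_t. apply (is_RInt_unique (V := C_R_CompleteNormedModule)).
  set (Q := fun y => (y * q y)%C).
  assert (DQ : forall y, in_U y -> cderiv Q y (p y)).
  { intros y Hy. refine (cderiv_ext _ _ _ _ _ (fun _ => eq_refl) _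
      (cderiv_mult _ _ _ _ _ (cderiv_id y) (Hq y Hy))).
    rewrite <- Hqp by auto. ring. }
  assert (Main : is_RInt (V := C_R_NormedModule) (fun s : R => (p (0 + s * z) * z)%C) 0 1
                   (Re (z * q z)%C, Im (z * q z)%C)).
  { assert (E1 : Q (0 + 1%R * z)%C = (z * q z)%C)
      by (unfold Q; replace (0 + 1%R * z)%C with z by ring; reflexivity).
    assert (E0 : Q (0 + 0%R * z)%C = RtoC 0) by (unfold Q; ring).
    apply is_RInt_fct_extend_pair.
    - replace (Re (z * q z)%C) with (minus (Re (Q (0 + 1%R * z)%C)) (Re (Q (0 + 0%R * z)%C)))
        by (rewrite E1, E0; change (Re (z * q z)%C - 0 = Re (z * q z)%C); ring).
      apply (is_RInt_derive (V := R_CompleteNormedModule) (fun s : R => Re (Q (0 + s * z)%C))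
               (fun s : R => Re (p (0 + s * z) * z)%C)).
      + intros s Hs. rewrite Rmin_left, Rmax_right in Hs by lra.
        apply cderiv_line_Re. auto.
      + intros s Hs. rewrite Rmin_left, Rmax_right in Hs by lra.
        destruct (Hp _ (Hin s Hs)) as [d Hd].
        apply (ex_derive_continuous (V := R_NormedModule)). eexists.
        apply (cderiv_line_Re (fun y => p y * z)%C).
        refine (cderiv_ext _ _ _ _ _ _ eq_refl (cderiv_scal z _ _ _ Hd)). intros; ring.
    - replace (Im (z * q z)%C) with (minus (Im (Q (0 + 1%R * z)%C)) (Im (Q (0 + 0%R * z)%C)))
        by (rewrite E1, E0; change (Im (z * q z)%C - 0 = Im (z * q z)%C); ring).
      apply (is_RInt_derive (V := R_CompleteNormedModule) (fun s : R => Im (Q (0 + s * z)%C))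
               (fun s : R => Im (p (0 + s * z) * z)%C)).
      + intros s Hs. rewrite Rmin_left, Rmax_right in Hs by lra.
        apply cderiv_line_Im. auto.
      + intros s Hs. rewrite Rmin_left, Rmax_right in Hs by lra.
        destruct (Hp _ (Hin s Hs)) as [d Hd].
        apply (ex_derive_continuous (V := R_NormedModule)). eexists.
        apply (cderiv_line_Im (fun y => p y * z)%C).
        refine (cderiv_ext _ _ _ _ _ _ eq_refl (cderiv_scal z _ _ _ Hd)). intros; ring. }
  replace (z * q z)%C with (Re (z * q z)%C, Im (z * q z)%C)
    by (destruct (z * q z)%C; reflexivity).
  (* Agreement on 0 < s < 1 suffices: at s = 0 the original integrand is a division by 0. *)
  refine (is_RInt_ext (V := C_R_NormedModule) _ _ _ _ _ _ Main).
  intros s Hs. rewrite Rmin_left, Rmax_right in Hs by lra.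
  assert (Hs' := Hin s ltac:(lra)). rewrite Cplus_0_l in *.
  rewrite Hf by auto.
  match goal with |- ?u = ?v => change (@eq C u v) end.
  destruct (Ceq_dec z 0) as [->|Hz0]; [ring|].
  assert (RtoC s <> RtoC 0) by (intros E; apply RtoC_inj in E; lra).
  field; auto.
Qed.

Theorem theorem2 (n : nat) (alpha beta gamma mu : R) (f : C -> C) :
  (0 < n)%nat ->
  0 < alpha -> 0 < gamma -> 0 < mu -> mu <= 1 ->
  alpha = beta + 2 / PI * atan (INR n * beta) ->
  beta = gamma + 2 / PI * atan (INR n * gamma) ->
  PI / 2 * (alpha + gamma) <= phi n mu ->
  in_A n f ->
  (forall z : C, in_U z ->
     forall df : C, is_derive (K := C_AbsRing) (V := C_NormedModule) f z df ->
       abs_arg_lt df (PI / 2 * alpha)) ->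
  in_STS n mu (int_f_over_t f).
Proof.
  intros Hn Ha Hg Hmu Hmu1 Eab Ebg Hphi [a [a0 [a1 [aj Hfa]]]] Harg.
  assert (Hpi := PI_RGT_0).
  assert (Hn0 : 0 < INR n) by (apply lt_0_INR; auto).
  assert (Hphi1 := phi_le_PI n mu (conj Hmu Hmu1)).
  (* Each of the two arctan terms adds something between 0 and 1. Together with alpha + gamma <= mu
     + 1 <= 2 this gives alpha + beta < 3 and beta + gamma < 3, as both uses of [arg_step]
     require. *)
  assert (Hatan : forall x, 0 < x -> 0 < 2 / PI * atan x < 1).
  { intros x Hx. assert (B := atan_bound x).
    assert (0 < atan x) by (rewrite <- atan_0; apply atan_increasing; auto).
    assert (0 < 2 / PI) by (apply Rdiv_lt_0_compat; lra).
    split; [apply Rmult_lt_0_compat; auto|].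
    replace 1 with (2 / PI * (PI / 2)) by (field; lra).
    apply Rmult_lt_compat_l; lra. }
  assert (H1 := Hatan (INR n * gamma) ltac:(apply Rmult_lt_0_compat; lra)).
  assert (Hb : 0 < beta) by lra.
  assert (H2 := Hatan (INR n * beta) ltac:(apply Rmult_lt_0_compat; lra)).
  assert (Hag : alpha + gamma <= 2).
  { apply Rmult_le_reg_l with (PI / 2); [lra|].
    assert (PI / 2 * (mu + 1) <= PI / 2 * 2) by (apply Rmult_le_compat_l; lra). lra. }
  (* b and c are the coefficients of p = f/z and q = F/z. The division by k + 1 comes from p = q + z
     q', that is b k = (k + 1) c k. *)
  set (b := fun k => a (S k)).
  set (c := fun k => (RtoC (/ INR (S k)) * b k)%C).
  assert (Rb : unit_radius b).
  { apply (unit_radius_shift a). exact (unit_radius_of_sum a f Hfa). }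
  assert (Rc : unit_radius c).
  { apply (unit_radius_le b); auto. intros k. unfold c.
    rewrite Cmod_mult, Cmod_R, Rabs_inv, (Rabs_pos_eq (INR (S k))) by apply pos_INR.
    rewrite <- (Rmult_1_l (Cmod (b k))) at 2.
    apply Rmult_le_compat_r; [apply Cmod_ge_0|].
    rewrite <- Rinv_1. apply Rinv_le_contravar; [lra|].
    rewrite S_INR. assert (H := pos_INR k). lra. }
  destruct (unit_radius_sum b Rb) as [p Hp].
  destruct (unit_radius_sum _ (unit_radius_dcoef b Rb)) as [p1 Hp1].
  destruct (unit_radius_sum _ (unit_radius_dcoef _ (unit_radius_dcoef b Rb))) as [p2 Hp2].
  destruct (unit_radius_sum c Rc) as [q Hq].
  destruct (unit_radius_sum _ (unit_radius_dcoef c Rc)) as [q1 Hq1].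
  destruct (unit_radius_sum _ (unit_radius_dcoef _ (unit_radius_dcoef c Rc))) as [q2 Hq2].
  assert (Dp := cderiv_cpseries _ _ _ Hp Hp1). assert (Dp1 := cderiv_cpseries _ _ _ Hp1 Hp2).
  assert (Dq := cderiv_cpseries _ _ _ Hq Hq1). assert (Dq1 := cderiv_cpseries _ _ _ Hq1 Hq2).
  assert (Uopen : forall z, in_U z -> exists delta, 0 < delta /\
            forall k, Cmod k < delta -> in_U (z + k)%C).
  { intros z Hz. unfold in_U in *. exists (1 - Cmod z). split; [lra|].
    intros k Hk. eapply Rle_lt_trans; [apply Cmod_triangle|]. lra. }
  assert (p_2 : forall z, in_U z -> cderiv2 p z)
    by (intros z Hz; apply (cderiv2_intro p p1 z (p2 z) in_U); auto).
  assert (q_2 : forall z, in_U z -> cderiv2 q z)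
    by (intros z Hz; apply (cderiv2_intro q q1 z (q2 z) in_U); auto).
  assert (Efp : forall z, in_U z -> f z = (z * p z)%C).
  { intros z Hz.
    apply (cseries_unique (fun k => z ^ k * a k)%C (f z) (z * p z)%C).
    - exact (proj1 (cpseries_iff _ _ _) (Hfa z Hz)).
    - apply cseries_decr; [rewrite a0; ring|].
      refine (cseries_ext _ _ _ _ _ eq_refl
        (cseries_scal z _ _ (proj1 (cpseries_iff _ _ _) (Hp z Hz)))).
      intros k. unfold b. simpl. ring. }
  assert (Eqp : forall z, in_U z -> (q z + z * q1 z)%C = p z).
  { intros z Hz.
    assert (A := proj1 (cpseries_iff _ _ _) (Hq z Hz)).
    assert (B : cseries (fun k => INR k * (z ^ k * c k))%C (z * q1 z)%C).
    { apply cseries_decr; [simpl; ring|].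
      refine (cseries_ext _ _ _ _ _ eq_refl
        (cseries_scal z _ _ (proj1 (cpseries_iff _ _ _) (Hq1 z Hz)))).
      intros k. unfold dcoef. change (z ^ S k)%C with (z * z ^ k)%C. ring. }
    apply (cseries_unique (fun k => z ^ k * b k)%C (q z + z * q1 z)%C (p z));
      [|exact (proj1 (cpseries_iff _ _ _) (Hp z Hz))].
    refine (cseries_ext _ _ _ _ _ eq_refl (cseries_plus _ _ _ _ A B)).
    intros k. unfold c.
    replace (z ^ k * (RtoC (/ INR (S k)) * b k) + INR k * (z ^ k * (RtoC (/ INR (S k)) * b k)))%C
      with (RtoC ((INR k + 1) * / INR (S k)) * (z ^ k * b k))%C
      by (rewrite RtoC_mult, RtoC_plus; ring).
    rewrite S_INR, Rinv_r by (assert (H := pos_INR k); lra). ring. }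
  assert (p0 : p (RtoC 0) = RtoC 1) by (rewrite (cpseries_at_0 b p Hp); exact a1).
  assert (c0 : c 0%nat = RtoC 1).
  { unfold c, b. rewrite a1. simpl. rewrite Rinv_1. ring. }
  assert (q0 : q (RtoC 0) = RtoC 1) by (rewrite (cpseries_at_0 c q Hq); exact c0).
  assert (b_0 : forall k, (1 <= k < n)%nat -> b k = RtoC 0) by (intros; apply aj; lia).
  assert (c_0 : forall k, (1 <= k < n)%nat -> c k = RtoC 0).
  { intros k Hk. unfold c. rewrite b_0 by auto. ring. }
  destruct (cpseries_order b p n Hn Hp b_0) as [Mp Op].
  destruct (cpseries_order c q n Hn Hq c_0) as [Mq Oq].
  change (b 0%nat) with (a 1%nat) in Op. rewrite a1 in Op. rewrite c0 in Oq.
  assert (Sf : forall z, in_U z ->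
    Cmod (p z + z * p1 z)%C * cos (PI / 2 * alpha) < Re (p z + z * p1 z)%C).
  { intros z Hz. apply abs_arg_lt_sector; [nra|]. apply (Harg z Hz).
    destruct (Uopen z Hz) as [d [Hd D]].
    apply (cderiv_ext_loc (fun y => y * p y)%C).
    - exists d. split; auto. intros h Hh. symmetry. apply Efp. auto.
    - refine (cderiv_ext _ _ _ _ _ (fun _ => eq_refl) _
        (cderiv_mult _ _ _ _ _ (cderiv_id z) (Dp z Hz))). ring. }
  assert (Sp : forall z, in_U z -> Cmod (p z) * cos (PI / 2 * beta) < Re (p z)).
  { apply (arg_step p p1 n alpha beta (/ 2) Mp); auto; try lra. intros; apply Op; lra. }
  assert (Sq : forall z, in_U z -> Cmod (q z) * cos (PI / 2 * gamma) < Re (q z)).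
  { apply (arg_step q q1 n beta gamma (/ 2) Mq); auto; try lra.
    - intros; apply Oq; lra.
    - intros z Hz. rewrite Eqp by auto. auto. }
  assert (Snz : forall w x, Cmod w * x < Re w -> w <> RtoC 0).
  { intros w x H E. rewrite E, Cmod_0 in H. simpl in H. lra. }
  assert (p_n : forall z, in_U z -> p z <> RtoC 0) by (intros z Hz; exact (Snz _ _ (Sp z Hz))).
  assert (q_n : forall z, in_U z -> q z <> RtoC 0) by (intros z Hz; exact (Snz _ _ (Sq z Hz))).
  set (P := fun z => (p z * / q z)%C).
  set (P1 := fun z => (p1 z * / q z + p z * (- q1 z / (q z * q z)))%C).
  assert (SP : forall z, in_U z -> Cmod (P z) * cos (PI / 2 * mu) < Re (P z)).
  (* On |z| < d one has |q - 1| < 1/2, hence |q| >= 1/2; this is the factor 2 in the bound for P - 1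
     = (p - q) / q. *)
  { destruct (proj1 (ccontinuous_iff q (RtoC 0)) (cderiv2_continuous q (RtoC 0)
      (q_2 (RtoC 0) ltac:(unfold in_U; rewrite Cmod_0; lra))) (/ 2) ltac:(lra)) as [d [Hd D]].
    apply (final_step P P1 n mu (Rmin d (/ 2)) (2 * (Mp + Mq))); auto.
    - apply Rmin_pos; lra.
    - eapply Rle_trans; [|exact Hphi]. apply Rmult_le_pos; lra.
    - unfold P. rewrite p0, q0. apply injective_projections; simpl; field.
    - intros z Hz. unfold P. apply Cmult_neq_0; auto.
      apply Cmod_pos_neq0. rewrite Cmod_inv by auto.
      apply Rinv_0_lt_compat, Cmod_gt_0; auto.
    - intros z Hz. apply (cderiv2_mult p (fun y => / q y)%C); auto.
      apply (cderiv2_comp Cinv q); auto. apply cderiv2_Cinv; auto.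
    - intros z Hz. apply (cderiv_mult p (fun y => / q y)%C); auto.
      apply (cderiv_inv q); auto.
    - intros z Hz.
      assert (m1 := Rmin_l d (/ 2)). assert (m2 := Rmin_r d (/ 2)).
      assert (Hz2 : in_U z) by (unfold in_U; lra).
      assert (o1 := Op z ltac:(lra)). assert (o2 := Oq z ltac:(lra)).
      specialize (D z ltac:(lra)). rewrite Cplus_0_l, q0 in D.
      assert (Hqz : / 2 <= Cmod (q z)).
      { assert (t := Cmod_triangle_rev 1 (1 - q z)%C).
        rewrite Cmod_1 in t. rewrite Cmod_minus_sym in D. replace (1 - (1 - q z))%C with (q z) in t by ring. lra. }
      replace (P z - 1)%C with ((p z - 1 - (q z - 1)) / q z)%C
        by (unfold P; field; auto).
      rewrite Cmod_div by auto.
      assert (t := Cmod_triangle (p z - 1)%C (- (q z - 1))%C). rewrite Cmod_opp in t.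
      change (p z - 1 + - (q z - 1))%C with (p z - 1 - (q z - 1))%C in t.
      apply Rmult_le_reg_r with (Cmod (q z)); [lra|].
      unfold Rdiv. rewrite Rmult_assoc, Rinv_l, Rmult_1_r by lra.
      assert (0 <= Cmod (p z - 1 - (q z - 1))%C) by apply Cmod_ge_0.
      assert (0 <= (Mp + Mq) * Cmod z ^ n) by lra. nra.
    - intros z Hz.
      replace (P z * P z + z * P1 z)%C with ((p z + z * p1 z) / q z)%C.
      + apply (sector_div _ _ (PI / 2 * alpha) (PI / 2 * gamma)); auto; nra.
      + unfold P, P1.
        (* One factor p of P^2 = p^2 / q^2 is written as q + z q1, which cancels the term in q1
           coming from z P1. *)
        transitivity ((p z * (q z + z * q1 z) + z * (p1 z * q z - p z * q1 z)) / (q z * q z))%C.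
        * field; auto.
        * rewrite (Eqp z Hz). field; auto. }
  assert (EF := int_f_over_t_eq f p q q1 Efp
    (fun z Hz => ex_intro _ _ (Dp z Hz)) Dq Eqp).
  split.
  - exists (fun k => match k with O => RtoC 0 | S j => c j end).
    split; [reflexivity|]. split; [exact c0|]. split.
    + intros k Hk. destruct k; [lia|]. apply c_0. lia.
    + intros z Hz. rewrite EF by auto. apply cpseries_iff.
      apply cseries_decr; [ring|].
      refine (cseries_ext _ _ _ _ _ eq_refl
        (cseries_scal z _ _ (proj1 (cpseries_iff _ _ _) (Hq z Hz)))).
      intros k. simpl. ring.
  (* The derivative of F = z q is q + z q1 = p, so z F'/F = z p / (z q) is P. *)
  - intros z Hz Hz0. exists (p z). rewrite EF by auto. split; [|split].
    + destruct (Uopen z Hz) as [d [Hd D]].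
      apply (cderiv_ext_loc (fun y => y * q y)%C).
      * exists d. split; auto. intros h Hh. symmetry. apply EF. auto.
      * refine (cderiv_ext _ _ _ _ _ (fun _ => eq_refl) _
          (cderiv_mult _ _ _ _ _ (cderiv_id z) (Dq z Hz))).
        rewrite <- Eqp by auto. ring.
    + apply Cmult_neq_0; auto.
    + replace (z * p z / (z * q z))%C with (P z) by (unfold P; field; auto).
      apply sector_abs_arg_lt; auto. nra.
Qed.
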